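(* For the random geometric graph $G_n$ (with any $r=r(n)>0$, $r(n)\to0$), $\chi(G_n)/\chi_f(G_n)\to1$ almost surely.
   Context: Setup: $d\ge1$, a norm $\|\cdot\|$ on $\mathbb R^d$; $\nu$ a probability distribution on $\mathbb R^d$ with bounded density; $X_1,X_2,\dots$ i.i.d. $\sim\nu$; $G_n$ has vertices $1,\dots,n$, distinct $i,j$ adjacent iff $\|X_i-X_j\|\le r(n)$. $\chi_f(G)$ is the fractional chromatic number: the optimal value of $\min 1^Tx$ subject to $Ax\ge 1$, $x\ge0$, where $A$ is the vertex–stable-set incidence matrix of $G$. *)

(* Defs.v *)
From HB Require Import structures.
From mathcomp Require Import all_boot all_order all_algebra.
From mathcomp Require Import all_classical all_reals all_analysis.
Set Implicit Arguments. Unset Strict Implicit. Unset Printing Implicit Defensive.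
Import Order.TTheory GRing.Theory Num.Theory numFieldNormedType.Exports.
Local Open Scope classical_set_scope.
Local Open Scope ring_scope.

(* A simple graph on the finite type T is given by a relation e; only
   pairs of distinct vertices are relevant (loops are ignored). *)

Definition proper_coloringb (T : finType) (e : rel T) (k : nat)
    (c : {ffun T -> 'I_k}) : bool :=
  [forall x, forall y, ((x != y) && e x y) ==> (c x != c y)].

Lemma exists_proper_coloring (T : finType) (e : rel T) :
  exists k, [exists c : {ffun T -> 'I_k}, proper_coloringb e c].
Proof.
exists #|T|; apply/existsP; exists [ffun x => enum_rank x].
apply/forallP => x; apply/forallP => y; apply/implyP => /andP[xy _].
by rewrite !ffunE; apply: contra xy => /eqP/enum_rank_inj ->.
Qed.

Definition chromatic_number (T : finType) (e : rel T) : nat :=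
  ex_minn (exists_proper_coloring e).

Definition stableb (T : finType) (e : rel T) (S : {set T}) : bool :=
  [forall x in S, forall y in S, (x != y) ==> ~~ e x y].

(* feasible points of the fractional colouring LP  min 1^T x, A x >= 1, x >= 0,
   with variables indexed by the stable sets (values of x on non-stable
   sets are irrelevant) *)
Definition frac_coloring_feasible (R : realType) (T : finType) (e : rel T)
    (x : {set T} -> R) : Prop :=
  (forall S, stableb e S -> 0 <= x S) /\
  (forall v : T, 1 <= \sum_(S | stableb e S && (v \in S)) x S).

Definition frac_chromatic_number (R : realType) (T : finType) (e : rel T) : R :=
  inf [set \sum_(S | stableb e S) x S | x in @frac_coloring_feasible R T e].

(* ---------- R^d, represented as d.-tuple R (with its product = Borel
   sigma-algebra from the library) ---------- *)

Definition tsub (R : realType) (d : nat) (x y : d.-tuple R) : d.-tuple R :=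
  [tuple tnth x i - tnth y i | i < d].
Definition tadd (R : realType) (d : nat) (x y : d.-tuple R) : d.-tuple R :=
  [tuple tnth x i + tnth y i | i < d].
Definition tscale (R : realType) (d : nat) (a : R) (x : d.-tuple R) : d.-tuple R :=
  [tuple a * tnth x i | i < d].
Definition tzero (R : realType) (d : nat) : d.-tuple R := [tuple 0 | _ < d].

Definition is_norm (R : realType) (d : nat) (N : d.-tuple R -> R) : Prop :=
  (forall x, 0 <= N x) /\
  (forall x, N x = 0 -> x = tzero R d) /\
  (forall a x, N (tscale a x) = `|a| * N x) /\
  (forall x y, N (tadd x y) <= N x + N y).

(* Lebesgue integral of a nonnegative function over R^d, computed as the
   iterated one-dimensional Lebesgue integral (Fubini-Tonelli). *)
Fixpoint lebesgue_iint (R : realType) (d : nat) :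
    (d.-tuple R -> \bar R) -> \bar R :=
  match d return (d.-tuple R -> \bar R) -> \bar R with
  | 0 => fun g => g [tuple]
  | d'.+1 => fun g =>
      (\int[@lebesgue_measure R]_(t in [set: R])
         lebesgue_iint (fun u : d'.-tuple R => g (cons_tuple t u)))%E
  end.

Definition has_bounded_density (R : realType) (d : nat)
    (nu : set (d.-tuple R) -> \bar R) : Prop :=
  exists (f : d.-tuple R -> R) (M : R),
    measurable_fun [set: d.-tuple R] f /\
    (forall x, 0 <= f x <= M) /\
    (forall A : set (d.-tuple R), measurable A ->
       nu A = lebesgue_iint (fun x => (\1_A x * f x)%:E)).

Definition iid_with_law (dO : measure_display) (Omega : measurableType dO)
    (R : realType) (P : probability Omega R) (d : nat)
    (X : nat -> Omega -> d.-tuple R) (nu : set (d.-tuple R) -> \bar R) : Prop :=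
  (forall i, measurable_fun [set: Omega] (X i)) /\
  (forall i (A : set (d.-tuple R)), measurable A -> P (X i @^-1` A) = nu A) /\
  (forall (s : seq nat) (A : nat -> set (d.-tuple R)), uniq s ->
     (forall i, measurable (A i)) ->
     P (\bigcap_(i in [set i | i \in s]) (X i @^-1` A i)) =
     (\prod_(i <- s) P (X i @^-1` A i))%E).

Definition rgg_adj (R : realType) (d : nat) (N : d.-tuple R -> R)
    (pts : nat -> d.-tuple R) (r : R) (n : nat) : rel 'I_n :=
  fun i j => (i != j) && (N (tsub (pts i) (pts j)) <= r).
Arguments rgg_adj {R d} N pts r n.

(* Main.v *)
(* Fix eps = 1/q and let omega be the clique number of G_n, a lower bound for chi_f.

   Sparse case, D * omega <= log_2 n with D large: by the second moment method some cell
   of a suitable grid contains more than k points as soon as the connection radius exceeds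
   an explicit threshold, so omega <= k keeps the radius below it; a union bound then shows
   that no 2-ball of the graph contains more than k + 1 + k/q points. A graph with such
   balls is (k + 1 + k/q)-colourable, and even k-colourable if k < q.

   Dense case, log_2 n < D * omega: few points lie in any family of fine cells of small
   relative volume. Split the space into separated windows of bounded size relative to r. In
   a window the quadratic energy of the cell counts increases along nested grids, so at
   some level the counts are almost constant inside coarser cells. Dilate the stable sets of
   an optimal fractional colouring slightly, so that they stay stable after rounding to
   cells, and average over translations by less than a coarse cell: this covers almost
   every point and involves boundedly many types of stable sets, so that it can be rounded
   to a colouring with (1 + O(eps)) chi_f + O(1) colours, and chi_f >= omega absorbs O(1). *)

Require Import Defs.
From HB Require Import structures.
From mathcomp Require Import all_boot all_order all_algebra.
From mathcomp Require Import all_classical all_reals all_analysis.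
From mathcomp Require Import measurable_realfun zify ring lra.
Set Implicit Arguments. Unset Strict Implicit. Unset Printing Implicit Defensive.
Import Order.TTheory GRing.Theory Num.Theory numFieldNormedType.Exports.
Local Open Scope ring_scope.


(** * Colourings, cliques and fractional colourings *)

(** The radius may change regime with [n], so the split is made by the random clique number of [G_n]
    itself. In the sparse range the events do not mention [r]: they concern cells whose side is
    computed from [k] and the dyadic scale of [n], and the radius is controlled afterwards through
    the clique bound. One event then serves all [n] between consecutive powers of 2, and
    probabilities decaying like a small negative power of [n] are already summable. In the dense
    range the cells scale with [r n] and each [n] is treated separately. The tail bound is
    exponential in a threshold of order [log n], which is why the clique number is assumed to be at
    least of that order; its base can be made as small as desired through the relative volume of the
    exceptional cells. Hence every [D] is admissible there, and the sparse range fixes it. Errors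
    are compared with chi_f locally: a window of bounded size relative to [r] is covered by
    boundedly many cliques, so it holds at most a constant times chi_f points, and a small fraction
    of its points is a small fraction of chi_f. *)

Definition colorable (T : finType) (e : rel T) (D : {set T}) (k : nat) : Prop :=
  exists c : T -> nat, (forall x, x \in D -> (c x < k)%N) /\
    (forall x y, x \in D -> y \in D -> x != y -> e x y -> c x != c y).

Definition cliqueb (T : finType) (e : rel T) (K : {set T}) : bool :=
  [forall x in K, forall y in K, (x != y) ==> e x y].

Lemma colorable_sub (T : finType) (e : rel T) (D D' : {set T}) k :
  D' \subset D -> colorable e D k -> colorable e D' k.
Proof.
move=> /fintype.subsetP sD [c [ck cP]]; exists c; split=> [x /sD/ck //|x y /sD xD /sD yD].
exact: cP.
Qed.

Lemma colorable_le (T : finType) (e : rel T) (D : {set T}) k k' :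
  (k <= k')%N -> colorable e D k -> colorable e D k'.
Proof.
move=> kk' [c [ck cP]]; exists c; split=> // x /ck ckx; exact: leq_trans kk'.
Qed.

Lemma colorableU (T : finType) (e : rel T) (D1 D2 : {set T}) k1 k2 :
  colorable e D1 k1 -> colorable e D2 k2 -> colorable e (D1 :|: D2) (k1 + k2).
Proof.
move=> [c1 [c1k c1P]] [c2 [c2k c2P]].
exists (fun x => if x \in D1 then c1 x else (k1 + c2 x)%N); split=> [x|x y].
  rewrite inE; case: ifPn => [xD _|xD /= /c2k]; last by rewrite ltn_add2l.
  by apply: leq_trans (c1k _ xD) (leq_addr _ _).
rewrite !inE; case: ifPn => xD; case: ifPn => yD /= => xD2 yD2 xy exy.
- exact: c1P.
- by rewrite neq_ltn (leq_trans (c1k _ xD)) ?leq_addr.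
- by rewrite neq_ltn orbC (leq_trans (c1k _ yD)) ?leq_addr.
- by rewrite eqn_add2l; apply: c2P.
Qed.

Lemma colorable_bigcup (T I : finType) (e : rel T) (D : I -> {set T}) k :
  (forall i, colorable e (D i) k) -> colorable e (\bigcup_i D i) (#|I| * k).
Proof.
move=> Dk; rewrite cardE -big_enum /=.
elim: (enum I) => [|i s IH]; first by rewrite big_nil; exists (fun=> 0%N); split=> x; rewrite inE.
by rewrite big_cons /= mulSn; apply: colorableU.
Qed.

Lemma colorable_partition (T : finType) (K : eqType) (e : rel T) (D : {set T})
    (kappa : T -> K) k :
  (forall x y, x \in D -> y \in D -> kappa x != kappa y -> ~~ e x y) ->
  (forall a, colorable e [set x in D | kappa x == a] k) -> colorable e D k.
Proof.
move=> sep /choice[c cP]; exists (fun x => c (kappa x) x); split=> [x xD|x y xD yD xy exy].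
  by have [+ _] := cP (kappa x); apply; rewrite inE xD /=.
have [kxy|/(sep _ _ xD yD)] := eqVneq (kappa x) (kappa y); last by rewrite exy.
have [_ +] := cP (kappa y); rewrite kxy; apply => //; rewrite inE ?xD ?yD ?kxy //=.
Qed.

Lemma chromatic_number_le (T : finType) (e : rel T) k :
  colorable e [set: T] k -> (chromatic_number e <= k)%N.
Proof.
move=> [c [ck cP]]; rewrite /chromatic_number; case: ex_minnP => m _; apply.
have ck' x : (c x < k)%N by apply: ck.
apply/existsP; exists [ffun x => Ordinal (ck' x)].
apply/forallP => x; apply/forallP => y; apply/implyP => /andP[xy exy].
by rewrite !ffunE -val_eqE /=; apply: cP.
Qed.

Lemma chromatic_number_colorable (T : finType) (e : rel T) :
  colorable e [set: T] (chromatic_number e).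
Proof.
rewrite /chromatic_number; case: ex_minnP => k /existsP[c /forallP cP] _.
exists (fun x => c x : nat); split=> [x _ //|x y _ _ xy exy].
by have /forallP/(_ y) := cP x; rewrite xy exy.
Qed.

(** * Linear-programming bounds for the fractional chromatic number *)

Section FractionalChromaticNumber.
Context {R : realType} {T : finType} (e : rel T).
Implicit Types x : {set T} -> R.

Let total x : R := \sum_(S | stableb e S) x S.

Lemma clique_stable_card1 (K S : {set T}) :
  cliqueb e K -> stableb e S -> (#|K :&: S| <= 1)%N.
Proof.
move=> Kc Ss; rewrite leqNgt; apply/negP => /card_gt1P[u [v [+ + uv]]].
rewrite !inE => /andP[uK uS] /andP[vK vS].
have := Kc => /forall_inP/(_ u uK)/forall_inP/(_ v vK); rewrite uv /= => euv.
by have := Ss => /forall_inP/(_ u uS)/forall_inP/(_ v vS); rewrite uv euv.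
Qed.

(** Weak duality: sum the covering constraints over [K]; every stable set meets [K] at most once, so
    each [x S] is counted at most once. *)
Lemma clique_le_feasible x (K : {set T}) :
  frac_coloring_feasible e x -> cliqueb e K -> #|K|%:R <= total x.
Proof.
move=> [x0 xc] Kc; rewrite -sum1_card natr_sum.
apply: (@le_trans _ _ (\sum_(v in K) \sum_(S | stableb e S && (v \in S)) x S)).
  by apply: ler_sum => v _; apply: xc.
rewrite (exchange_big_dep (fun S => stableb e S)) /=; last by move=> v S _ /andP[].
apply: ler_sum => S Ss.
rewrite (eq_bigl (fun v => v \in K :&: S)); last by move=> v; rewrite Ss inE.
rewrite sumr_const -[leRHS]mulr1n ler_wpMn2l//; last exact: clique_stable_card1.
exact: x0.
Qed.

Lemma feasible_total_ge0 x : frac_coloring_feasible e x -> 0 <= total x.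
Proof. by move=> [x0 _]; apply: sumr_ge0 => S /x0. Qed.

Let totals := [set total x | x in @frac_coloring_feasible R T e]%classic.

Lemma frac_coloring_of_colorable k :
  colorable e [set: T] k -> exists2 x, frac_coloring_feasible e x & total x <= k%:R.
Proof.
move=> [c [ck cP]].
pose F (i : 'I_k) : {set T} := [set v | c v == i].
have Fs i : stableb e (F i).
  apply/forall_inP => u; rewrite inE => /eqP cu.
  apply/forall_inP => v; rewrite inE => /eqP cv; apply/implyP => uv.
  apply/negP => euv; have := cP u v; rewrite !inE cu cv eqxx => H.
  by have := H isT isT uv euv.
(* The weight of [S] is the number of colours with class [S], so coinciding (empty) classes need no
   separate treatment. *)
exists (fun S => \sum_(i < k | F i == S) 1).
  split=> [S _|v]; first exact: sumr_ge0.
  have cvk : (c v < k)%N by apply: ck.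
  rewrite (bigD1 (F (Ordinal cvk))) /=; last by rewrite Fs inE /=.
  rewrite (bigD1 (Ordinal cvk)) //= -addrA lerDl addr_ge0 ?sumr_ge0//.
  by move=> S _; apply: sumr_ge0.
rewrite /total (exchange_big_dep predT) //=.
rewrite -[X in _ <= X%:R]card_ord -sum1_card natr_sum; apply: ler_sum => i _.
by rewrite (eq_bigl (pred1 (F i))) ?big_pred1_eq// => S; rewrite /= eq_sym andb_idl// => /eqP ->.
Qed.

Lemma has_inf_totals : has_inf totals.
Proof.
split; last by exists 0 => _ [x xf <-]; apply: feasible_total_ge0.
have [x xf _] := frac_coloring_of_colorable (chromatic_number_colorable e).
by exists (total x), x.
Qed.

Lemma frac_chromatic_number_le_feasible x :
  frac_coloring_feasible e x -> frac_chromatic_number R e <= total x.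
Proof.
by move=> xf; apply: ge_inf; [exact: has_inf_totals.2|exists x].
Qed.

Lemma frac_chromatic_number_le :
  frac_chromatic_number R e <= (chromatic_number e)%:R.
Proof.
have [x xf] := frac_coloring_of_colorable (chromatic_number_colorable e).
by apply: le_trans; apply: frac_chromatic_number_le_feasible.
Qed.

Lemma clique_le_frac_chromatic_number (K : {set T}) :
  cliqueb e K -> #|K|%:R <= frac_chromatic_number R e.
Proof.
move=> Kc; apply: lb_le_inf; first exact: has_inf_totals.1.
by move=> _ [x xf <-]; apply: clique_le_feasible.
Qed.

(** Stands in for an optimal solution: it will be taken with slack 1, absorbed together with the
    other additive constants. *)
Lemma frac_chromatic_number_adherent eps : 0 < eps ->
  exists2 x, frac_coloring_feasible e x &
    total x <= frac_chromatic_number R e + eps.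
Proof.
move=> /inf_adherent/(_ has_inf_totals)[_ [x xf <-]] /ltW xe.
by exists x.
Qed.

End FractionalChromaticNumber.

(** * Degeneracy and greedy colouring *)

Section Greedy.
Context {T : finType} (e : rel T).

(** Greedy colouring along a degeneracy order: remove a vertex with fewer than [k] neighbours and
    colour the rest by induction; some colour is then free for it. *)
Lemma degenerate_colorable (D : {set T}) k :
  (forall x y, e x y = e y x) ->
  (forall D' : {set T}, D' \subset D -> D' != finset.set0 ->
     exists2 v, v \in D' & (#|[set u in D' | (u != v) && e v u]| < k)%N) ->
  colorable e D k.
Proof.
move=> esym; move: {2}#|D| (leqnn #|D|) => n; elim: n => [|n IH] in D *.
  rewrite leqn0 cards_eq0 => /eqP -> _.
  by exists (fun=> 0%N); split=> x; rewrite inE.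
move=> Dn deg; have [->|D0] := eqVneq D finset.set0.
  by exists (fun=> 0%N); split=> x; rewrite inE.
have [v vD degv] := deg D (fintype.subxx _) D0.
have [||c [ck cP]] := IH (D :\ v).
- by move: Dn; rewrite (cardsD1 v) vD.
- by move=> D' D'D; apply: deg; apply: fintype.subset_trans D'D (finset.subsetDl _ _).
have [j jk jP] : exists2 j, (j < k)%N &
    forall u, u \in D -> u != v -> e v u -> c u != j.
  pose f (u : T) : 'I_k.-1.+1 := inord (c u).
  have k0 : (0 < k)%N by apply: leq_ltn_trans degv.
  have : (0 < #|~: (f @: [set u in D | (u != v) && e v u])|)%N.
    rewrite cardsCs finset.setCK card_ord subn_gt0.
    apply: leq_ltn_trans (leq_imset_card _ _) _; apply: (leq_trans degv).
    by rewrite prednK.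
  move=> /card_gt0P[j]; rewrite inE => jN; exists j; first by rewrite -[X in (_ < X)%N]prednK.
  move=> u uD uv evu; apply: contra jN => /eqP cuj; apply/imsetP; exists u.
    by rewrite inE uD uv.
  by apply/val_inj => /=; rewrite inordK cuj.
exists (fun x => if x == v then j else c x); split=> [x xD|x y xD yD].
  by case: eqVneq => // xv; apply: ck; rewrite !inE xv.
case: (eqVneq x v) => [->|xv]; case: (eqVneq y v) => [->|yv] //.
- by move=> _ evy; rewrite eq_sym; apply: jP.
- by move=> _ exv; apply: jP => //; rewrite esym.
- by move=> xy exy; apply: cP; rewrite ?inE ?xv ?yv.
Qed.

(* For k < q: a vertex set all of whose members have k neighbours inside it, and whose
   2-balls contain at most k+1 vertices, must contain a (k+1)-clique: the closed
   neighbourhoods of adjacent vertices coincide. *)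
Lemma sparse_colorable k q :
  (forall x y, e x y = e y x) ->
  (forall K : {set T}, cliqueb e K -> (#|K| <= k)%N) ->
  (forall v, #|[set u | [|| u == v, e v u | [exists w, e v w && e w u]]]|
     <= k.+1 + k %/ q)%N ->
  colorable e [set: T] (if (k < q)%N then k else (k.+1 + k %/ q)%N).
Proof.
move=> esym cl ball; apply: degenerate_colorable => // D _ /set0Pn[v0 v0D].
apply: contrapT => noV.
have deg v : v \in D ->
    ((if (k < q)%N then k else k.+1 + k %/ q) <= #|[set u in D | (u != v) && e v u]|)%N.
  by move=> vD; rewrite leqNgt; apply/negP => h; apply: noV; exists v.
pose Nb v := v |: [set u in D | (u != v) && e v u].
have NbE v u : v \in D -> (u \in Nb v) = (u \in D) && ((u == v) || e v u).
  by move=> vD; rewrite !inE; have [->|] := eqVneq u v; rewrite ?vD.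
have cNb v : #|Nb v| = (#|[set u in D | (u != v) && e v u]|.+1)%N.
  by rewrite cardsU1 !inE eqxx /= andbF add1n.
have Nbball v u : v \in D -> u \in Nb v ->
    Nb u \subset [set w | [|| w == v, e v w | [exists z, e v z && e z w]]].
  move=> vD uN; have uD : u \in D by move: uN; rewrite NbE // => /andP[].
  apply/fintype.subsetP => w; rewrite NbE // inE => /andP[wD].
  move: uN; rewrite NbE // => /andP[_ /orP[/eqP ->|evu]] /orP[/eqP ->|h].
  - by rewrite eqxx.
  - by rewrite h orbT.
  - by rewrite evu orbT.
  - by apply/orP; right; apply/orP; right; apply/existsP; exists u; rewrite evu.
have v0N : v0 \in Nb v0 by rewrite !inE eqxx.
(* For [q <= k] the closed neighbourhood of [v0] in [D] alone exceeds the bound on its 2-ball. *)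
case: ifPn deg => kq deg; last first.
  have := leq_trans (subset_leq_card (Nbball _ _ v0D v0N)) (ball v0).
  by rewrite cNb; have := deg _ v0D; lia.
set B := [set w | [|| w == v0, e v0 w | [exists z, e v0 z && e z w]]] in Nbball *.
have cB : (#|B| <= k.+1)%N by have := ball v0; rewrite divn_small ?addn0.
have NbB u : u \in Nb v0 -> Nb u = B.
  move=> uN; apply/eqP; rewrite eqEcard Nbball //= cNb (leq_trans cB) // ltnS deg //.
  by move: uN; rewrite NbE // => /andP[].
have : cliqueb e B.
  apply/forall_inP => u; rewrite -(NbB _ v0N) => uN; apply/forall_inP => w wN.
  have uD : u \in D by move: uN; rewrite NbE // => /andP[].
  move: wN; rewrite (NbB _ v0N) -(NbB _ uN) NbE // => /andP[wD /orP[/eqP ->|->]].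
    by rewrite eqxx.
  by rewrite implybT.
move=> /cl; rewrite -(NbB _ v0N) cNb; have := deg _ v0D; lia.
Qed.

End Greedy.

(** * Rounding dilated fractional colourings in a window *)

(** A slot [(i, j)] is a colour class with at most one vertex in each cell of [sigma i]. Vertices
    sharing a cell receive distinct slots by rank, and the second hypothesis provides enough of
    them; vertices of one slot in different cells are non-adjacent by the first. *)
Lemma slot_colorable (T C I : finType) (e : rel T) (D : {set T}) (a : T -> C)
    (sigma : I -> {set C}) (k : I -> nat) :
  (forall i u v, u \in D -> v \in D -> a u \in sigma i -> a v \in sigma i ->
     a u != a v -> ~~ e u v) ->
  (forall c, (#|[set v in D | a v == c]| <= \sum_(i | c \in sigma i) k i)%N) ->
  colorable e D (\sum_i k i).
Proof.
move=> stab cov; pose slot : finType := {i : I & 'I_(k i)}.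
pose P c := [set s : slot | c \in sigma (tag s)]%SET.
have cardP c : #|P c| = (\sum_(i | c \in sigma i) k i)%N.
  rewrite -sum1_card (eq_bigl (fun s : slot => (c \in sigma (tag s)) && true)); last first.
    by move=> s; rewrite inE andbT.
  rewrite -(sig_big_dep (fun i => c \in sigma i) (fun i (_ : 'I_(k i)) => true) (fun _ _ => 1%N)).
  by apply: eq_bigr => i _; rewrite sum1_card card_ord.
pose fib c := enum [set v in D | a v == c].
pose ranks c := [seq (enum_rank s : nat) | s <- enum (P c)].
have ranks_uniq c : uniq (ranks c).
  rewrite map_inj_uniq ?enum_uniq// => s s' /val_inj; exact: enum_rank_inj.
have idx v : v \in D -> (index v (fib (a v)) < size (ranks (a v)))%N.
  move=> vD; rewrite size_map -cardE cardP (leq_trans _ (cov _))//.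
  by rewrite [X in (_ < X)%N]cardE index_mem mem_enum inE vD /=.
exists (fun v => nth 0%N (ranks (a v)) (index v (fib (a v)))); split=> [v vD|u v uD vD uv euv].
  have /mapP[s _ ->] := mem_nth 0%N (idx v vD).
  rewrite (leq_trans (ltn_ord _))// card_tagged sumnE big_map big_enum /=.
  by apply: eq_leq; apply: eq_bigr => i _; rewrite card_ord.
have [auv|auv] := eqVneq (a u) (a v).
  rewrite -auv nth_uniq ?ranks_uniq ?idx// -?auv ?idx//; last by rewrite auv idx.
  apply: contra uv => /eqP/(congr1 (nth u (fib (a u)))).
  by rewrite !nth_index ?mem_enum ?inE ?uD ?vD ?auv //= => ->.
apply/negP => /eqP eq.
have /mapP[s] := mem_nth 0%N (idx u uD); rewrite mem_enum inE eq => sP rs.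
have /mapP[s'] := mem_nth 0%N (idx v vD); rewrite mem_enum inE rs => s'P.
move=> /val_inj/enum_rank_inj ss'; subst s'.
by have := stab _ u v uD vD sP s'P auv; rewrite euv.
Qed.

(* Sets of grid cells obtained from stable sets of vertices: [a v] is the cell of
   [v] and [a' v] the cell of the dilated position of [v]. *)
Section DilatedCover.
Context {R : realType} {T : finType} (e : rel T) (D : {set T}).
Context {d K : nat} (a : T -> {ffun 'I_d -> 'I_K}) (a' : T -> 'I_d -> nat).
Context (b0 m : nat) (x : {set T} -> R).
Local Notation C := {ffun 'I_d -> 'I_K}.
Hypothesis m_gt0 : (0 < m)%N.
Hypothesis a'_bound : forall v i, v \in D -> (a v i <= a' v i <= a v i + b0)%N.
Hypothesis a'_inj : forall p q, p \in D -> q \in D -> p != q -> ~~ e p q ->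
  exists i, a' p i != a' q i.
Hypothesis a'_stable : forall u v p q, u \in D -> v \in D -> p \in D -> q \in D ->
  (forall i, (a u i + a' q i = a v i + a' p i)%N) -> p != q -> ~~ e p q -> ~~ e u v.
Hypothesis xfeas : frac_coloring_feasible e x.

(** The equation is in [nat], so positions that leave the grid are simply dropped. *)
Definition dilated_cells (S : {set T}) (t : {ffun 'I_d -> 'I_m}) : {set C} :=
  [set c : C | [exists p, (p \in S :&: D) && [forall i, c i == (a' p i + t i)%N :> nat]]]%SET.

Definition cell_stableb (s : {set C}) : bool :=
  [forall u in D, forall v in D,
     [&& a u \in s, a v \in s & a u != a v] ==> ~~ e u v].

(** Two such cells differ by [a' p - a' q] whatever [t] is, which is the situation of
    [a'_stable]. *)
Lemma dilated_cells_stable S t : stableb e S -> cell_stableb (dilated_cells S t).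
Proof.
move=> Ss; apply/forall_inP => u uD; apply/forall_inP => v vD.
apply/implyP => /and3P[]; rewrite !inE => /existsP[p /andP[]].
rewrite inE => /andP[pS pD] /forallP pu /existsP[q /andP[]].
rewrite inE => /andP[qS qD] /forallP qv auv.
have pq : p != q.
  apply: contra auv => /eqP pq; apply/eqP/ffunP => i; apply/val_inj.
  by rewrite /= (eqP (pu i)) (eqP (qv i)) pq.
apply: (a'_stable uD vD pD qD) => //.
  by move=> i; rewrite (eqP (pu i)) (eqP (qv i)); lia.
by have := Ss => /forall_inP/(_ p pS)/forall_inP/(_ q qS); rewrite pq.
Qed.

(** Push-forward of [x] under [dilated_cells], averaged over the translations [t]. The total mass is
    preserved, so passing to cells does not change the objective. *)
Definition cell_weight (s : {set C}) : R :=
  (m ^ d)%:R^-1 * \sum_t \sum_(S | stableb e S && (dilated_cells S t == s)) x S.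

Lemma cell_weight_ge0 s : 0 <= cell_weight s.
Proof.
rewrite mulr_ge0 ?invr_ge0// sumr_ge0// => t _; apply: sumr_ge0 => S /andP[Ss _].
exact: xfeas.1.
Qed.

Lemma sum_cell_weight : \sum_s cell_weight s = \sum_(S | stableb e S) x S.
Proof.
rewrite -big_distrr /= exchange_big /=.
rewrite (eq_bigr (fun=> \sum_(S | stableb e S) x S)); last first.
  by move=> t _; rewrite -(partition_big _ predT).
rewrite sumr_const card_ffun !card_ord -(mulr_natl (\sum_(S | _) _)) mulKf//.
by rewrite pnatr_eq0 expn_eq0 negb_and -lt0n m_gt0.
Qed.

(** Each counted [p] has exactly one translation taking [a' p] to [c], and contributes at least 1 to
    that term by its covering constraint. For a fixed translation no stable set is counted twice:
    two of its members are non-adjacent, so [a'_inj] keeps them from landing on the same cell. *)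
Lemma cell_weight_cover (L : {set T}) (c : C) : L \subset D ->
  (m ^ d)%:R^-1 * #|[set p in L | [forall i, (a p i + b0 <= c i < a p i + m)%N]]|%:R
  <= \sum_(s : {set C} | c \in s) cell_weight s :> R.
Proof.
move=> /fintype.subsetP LD; rewrite -big_distrr /= ler_wpM2l ?invr_ge0//.
rewrite exchange_big /=.
apply: (@le_trans _ _ (\sum_(t : {ffun 'I_d -> 'I_m}) \sum_(p in D | [forall i, c i == (a' p i + t i)%N :> nat]) 1)).
  rewrite (exchange_big_dep (mem D)) /=; last by move=> t p _ /andP[].
  rewrite -sum1_card natr_sum big_mkcond [leRHS]big_mkcond /=; apply: ler_sum => p _.
  rewrite inE; case: ifPn => [/andP[pL /forallP ap]|_]; last by case: ifP => // _; apply: sumr_ge0.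
  have pD := LD _ pL; rewrite pD.
  have tP i : (c i - a' p i < m)%N by have := ap i; have := a'_bound i pD; lia.
  rewrite (bigD1 [ffun i => Ordinal (tP i)]) ?lerDl ?sumr_ge0//=.
  apply/forallP => i; rewrite ffunE /=; have := ap i; have := a'_bound i pD; lia.
apply: ler_sum => t _.
rewrite [leRHS](_ : _ = \sum_(S | stableb e S && (c \in dilated_cells S t)) x S); last first.
  rewrite (partition_big (dilated_cells^~ t) (fun s : {set C} => c \in s)) /=; last by move=> S /andP[].
  apply: eq_bigr => s cs; apply: eq_bigl => S; case: (stableb e S) => //=.
  by have [->|] := eqVneq (dilated_cells S t) s; rewrite ?cs ?andbF.
apply: (@le_trans _ _ (\sum_(p in D | [forall i, c i == (a' p i + t i)%N :> nat])
   \sum_(S | stableb e S && (p \in S)) x S)).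
  by apply: ler_sum => p _; apply: xfeas.2.
rewrite (exchange_big_dep (fun S => stableb e S && (c \in dilated_cells S t))) /=; last first.
  move=> p S /andP[pD pc] /andP[-> pS] /=; rewrite /dilated_cells inE; apply/existsP; exists p.
  by rewrite inE pS pD.
apply: ler_sum => S /andP[Ss _].
rewrite sumr_const -[leRHS]mulr1n ler_wpMn2l//; first exact: xfeas.1.
rewrite leqNgt; apply/negP => /card_gt1P[p [q [+ + pq]]]; rewrite /in_mem /=.
move=> /andP[/andP[pD /forallP pc] /andP[_ pS]] /andP[/andP[qD /forallP qc] /andP[_ qS]].
have nepq : ~~ e p q.
  by have := Ss => /forall_inP/(_ p pS)/forall_inP/(_ q qS); rewrite pq.
have [i] := a'_inj pD qD pq nepq.
by have := eqP (pc i); rewrite (eqP (qc i)) => /addIn ->; rewrite eqxx.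
Qed.

(** [beta] is the share of each cell that [D'] receives. Cell sets are used as slots with their
    weight rounded up, and single cells fill what the averaged cover misses; rounding costs one
    colour per cell set and [c0.+1] per cell. *)
Lemma dilated_cover_colorable (L D' : {set T}) (beta : R) (c0 : nat) :
  L \subset D -> D' \subset D -> 0 <= beta ->
  (forall c, #|[set v in D' | a v == c]|%:R
     <= beta * #|[set v in D | a v == c]|%:R + c0%:R) ->
  exists2 k, colorable e D' k &
    k%:R <= beta * (\sum_(S | stableb e S) x S +
      \sum_c Num.max 0 (#|[set v in D | a v == c]|%:R - (m ^ d)%:R^-1 *
         #|[set p in L | [forall i, (a p i + b0 <= c i < a p i + m)%N]]|%:R))
      + (2 ^ #|{: C}| + #|{: C}| * c0.+1)%:R.
Proof.
move=> LD D'D beta0 cD'.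
pose res c : R := Num.max 0 (#|[set v in D | a v == c]|%:R - (m ^ d)%:R^-1 *
         #|[set p in L | [forall i, (a p i + b0 <= c i < a p i + m)%N]]|%:R).
pose kk (i : {set C} + C) : nat := match i with
  | inl s => (Num.truncn (beta * cell_weight s)).+1
  | inr c => ((Num.truncn (beta * res c)).+1 + c0)%N end.
pose sg (i : {set C} + C) : {set C} := match i with
  (* Unstable cell sets may be emptied: none is the [dilated_cells] of a stable set, so their weight
     is 0. *)
  | inl s => if cell_stableb s then s else finset.set0
  | inr c => [set c]%SET end.
have res0 c : 0 <= res c by rewrite /res le_max lexx.
exists (\sum_i kk i)%N.
  apply: (@slot_colorable _ _ _ _ _ a sg).
    move=> [s|c] u v uD vD /=; last by rewrite !inE => /eqP -> /eqP ->; rewrite eqxx.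
    case: ifPn; last by rewrite inE.
    move=> /forall_inP/(_ u)/=; rewrite (fintype.subsetP D'D)// => /(_ isT)/forall_inP/(_ v).
    by rewrite (fintype.subsetP D'D)// => /(_ isT)/implyP H us vs uv; apply: H; rewrite us vs.
  move=> c; rewrite -(ler_nat R) (le_trans (cD' c))//.
  rewrite big_sumType /= (big_pred1 c); last by move=> y; rewrite inE eq_sym.
  rewrite natrD natr_sum natrD addrA lerD2r.
  apply: (@le_trans _ _ (beta * \sum_(s : {set C} | c \in s) cell_weight s + beta * res c)).
    rewrite -mulrDr ler_wpM2l// -lerBlDl /res le_max; apply/orP; right.
    by rewrite lerB// cell_weight_cover.
  apply: lerD; last by apply/ltW; rewrite truncnS_gt.
  rewrite mulr_sumr [leRHS]big_mkcond [leLHS]big_mkcond /=; apply: ler_sum => s _.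
  case: ifPn => cs; last by case: ifP.
  have [st|st] := boolP (cell_stableb s); first by rewrite cs ltW// truncnS_gt.
  rewrite inE /cell_weight big1 ?mulr0// => t _; rewrite big_pred0// => S.
  apply/negbTE; rewrite negb_and; case: (boolP (stableb e S)) => //= Ss.
  by apply: contra st => /eqP <-; exact: dilated_cells_stable.
rewrite big_sumType /= natrD !natr_sum.
have trn (y : R) : 0 <= y -> (Num.truncn y).+1%:R <= y + 1.
  by move=> y0; rewrite -natr1 lerD2r truncn_le.
rewrite natrD mulrDr -sum_cell_weight addrACA; apply: lerD.
  apply: (@le_trans _ _ (\sum_(s : {set C}) (beta * cell_weight s + 1))).
    by apply: ler_sum => s _; apply: trn; rewrite mulr_ge0 ?cell_weight_ge0.
  rewrite big_split /= mulr_sumr lerD2l sumr_const.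
  by rewrite -cardsT -powersetT card_powerset cardsT.
apply: (@le_trans _ _ (\sum_(c : C) (beta * res c + c0.+1%:R))).
  by apply: ler_sum => c _; rewrite natrD -[c0.+1%:R]natr1 [c0%:R + 1]addrC addrA lerD2r trn ?mulr_ge0.
by rewrite big_split /= mulr_sumr lerD2l sumr_const natrM mulr_natl.
Qed.

End DilatedCover.

(** * Counting cells in boxes and blocks, and averages over blocks *)

Lemma leq_expnl a b d : (a <= b)%N -> (a ^ d <= b ^ d)%N.
Proof. by case: d => // d ab; rewrite leq_exp2r. Qed.

Lemma near_divn m b0 mu x y : (0 < m)%N -> (mu <= x %% m)%N ->
  (y + b0 <= x < y + mu)%N -> (y %/ m = x %/ m)%N.
Proof.
move=> m0 mux; have xE := divn_eq x m; have := ltn_pmod x m0.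
move: (x %/ m)%N (x %% m)%N xE mux => q z -> muz zm yx.
have -> : y = (q * m + (y - q * m))%N by lia.
by rewrite divnMDl// divn_small ?addn0//; lia.
Qed.

Section Boxes.
Context {d K : nat}.

Let card_interval (lo w : nat) : (#|[pred x : 'I_K | lo <= x < lo + w]| <= w)%N.
Proof.
rewrite cardE -(size_map val) -[X in (_ <= X)%N](size_iota lo w).
apply: uniq_leq_size; first by rewrite map_inj_uniq ?enum_uniq//; exact: val_inj.
by move=> _ /mapP[y + ->]; rewrite mem_enum inE mem_iota.
Qed.

Let card_interval_eq (lo w : nat) : (lo + w <= K)%N ->
  #|[pred x : 'I_K | (lo <= x < lo + w)%N]| = w.
Proof.
move=> lowK; have lt (j : 'I_w) : (lo + j < K)%N by have := ltn_ord j; lia.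
pose f (j : 'I_w) := Ordinal (lt j).
have finj : injective f by move=> i j /(congr1 val)/= /addnI/val_inj.
rewrite -[RHS]card_ord -(fintype.card_image finj); apply: eq_card => y; rewrite inE.
apply/idP/fintype.imageP => [/andP[ly yw]|[j _ ->]]; last by have := ltn_ord j; rewrite /=; lia.
have yl : (y - lo < w)%N by lia.
by exists (Ordinal yl) => //; apply/val_inj => /=; lia.
Qed.

Let card_box_prod (F : 'I_d -> pred 'I_K) :
  #|[set c : {ffun 'I_d -> 'I_K} | [forall i, F i (c i)]]| = (\prod_i #|F i|)%N.
Proof.
have -> : (\prod_i #|F i|)%N = foldr muln 1%N [seq #|F i| | i : 'I_d].
  by rewrite /image_mem foldrE big_map big_enum.
rewrite -card_family; apply: eq_card => c; rewrite inE.
by apply/forallP/familyP.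
Qed.

Lemma card_box_le (lo : 'I_d -> nat) (w : nat) :
  (#|[set c : {ffun 'I_d -> 'I_K} | [forall i, lo i <= c i < lo i + w]]| <= w ^ d)%N.
Proof.
rewrite (card_box_prod (fun i => [pred x : 'I_K | lo i <= x < lo i + w]%N)).
apply: (leq_trans (leq_prod (fun i _ => card_interval (lo i) w))).
by rewrite prod_nat_const card_ord.
Qed.

Lemma card_box (lo : 'I_d -> nat) (w : nat) : (forall i, (lo i + w <= K)%N) ->
  #|[set c : {ffun 'I_d -> 'I_K} | [forall i, (lo i <= c i < lo i + w)%N]]| = (w ^ d)%N.
Proof.
move=> lowK; rewrite (card_box_prod (fun i => [pred x : 'I_K | lo i <= x < lo i + w]%N)).
by under eq_bigr => i _ do rewrite card_interval_eq//; rewrite prod_nat_const card_ord.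
Qed.

End Boxes.

Section Parent.
Context {d K m : nat}.
Hypothesis m_gt0 : (0 < m)%N.
Local Notation C := {ffun 'I_d -> 'I_K}.
Local Notation C' := {ffun 'I_d -> 'I_(K * m)}.

Lemma parent_subproof (x : 'I_(K * m)) : (x %/ m < K)%N.
Proof. by rewrite ltn_divLR. Qed.

Definition parent (c : C') : C := [ffun i => Ordinal (parent_subproof (c i))].

Lemma card_parent (B : C) (b : nat) : (b <= m)%N ->
  #|[set c : C' | (parent c == B) && [forall i, (b <= c i %% m)%N]]| = ((m - b) ^ d)%N.
Proof.
move=> bm; rewrite -(@card_box d (K * m) (fun i => B i * m + b)%N (m - b)); last first.
  by move=> i; rewrite -addnA subnKC// -mulSnr leq_mul2r (ltn_ord (B i)) orbT.
apply: eq_card => c; rewrite !inE.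
apply/andP/forallP => [[/eqP <- /forallP bc] i|Bc].
  rewrite ffunE /=; have := bc i; have := ltn_pmod (c i) m_gt0.
  have := divn_eq (c i) m; move: (c i %/ m * m)%N (c i %% m)%N => y z ->; lia.
have BcE i : (c i %/ m = B i)%N /\ (b <= c i %% m)%N.
  have /andP[lo hi] : (B i * m + b <= c i < B i * m + b + (m - b))%N := Bc i.
  have hm : (c i - B i * m < m)%N by lia.
  have cE : (c i : nat) = (B i * m + (c i - B i * m))%N by lia.
  by rewrite cE divnMDl// modnMDl (divn_small hm) (modn_small hm) addn0; split=> //; lia.
split; first by apply/eqP/ffunP => i; apply/val_inj; rewrite ffunE /=; exact: (BcE i).1.
by apply/forallP => i; exact: (BcE i).2.
Qed.

Lemma card_parent_fiber (B : C) : #|[set c : C' | parent c == B]| = (m ^ d)%N.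
Proof.
rewrite -[in RHS](subn0 m) -(card_parent B (leq0n _)); apply: eq_card => c.
by rewrite !inE; case: eqP => //= _; apply/esym/forallP.
Qed.

End Parent.

Section LocalAverage.
Context {R : realType} {d K m : nat} (l : {ffun 'I_d -> 'I_(K * m)} -> R).
Hypothesis m_gt0 : (0 < m)%N.
Hypothesis l_ge0 : forall c, 0 <= l c.
Local Notation C := {ffun 'I_d -> 'I_K}.
Local Notation C' := {ffun 'I_d -> 'I_(K * m)}.

Definition block_mass (B : C) : R := \sum_(c | parent m_gt0 c == B) l c.
Definition block_average (c : C') : R := block_mass (parent m_gt0 c) / (m ^ d)%:R.

Let md_gt0 : 0 < (m ^ d)%:R :> R. Proof. by rewrite ltr0n expn_gt0 m_gt0. Qed.

Let block_average_ge0 c : 0 <= block_average c.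
Proof. by rewrite divr_ge0 ?(ltW md_gt0)// sumr_ge0. Qed.

Lemma sum_block_mass : \sum_B block_mass B = \sum_c l c.
Proof. by rewrite [RHS](partition_big (parent m_gt0) predT). Qed.

Lemma sum_parent (F : C -> R) : \sum_c F (parent m_gt0 c) = (m ^ d)%:R * \sum_B F B.
Proof.
rewrite (partition_big (parent m_gt0) predT) //= mulr_sumr; apply: eq_bigr => B _.
rewrite (eq_bigr (fun=> F B)); last by move=> c /eqP ->.
by rewrite sumr_const mulr_natl -(card_parent_fiber m_gt0 B); congr (_ *+ _); apply: eq_card => c; rewrite inE.
Qed.

Lemma sum_block_average : \sum_c block_average c = \sum_c l c.
Proof.
rewrite (sum_parent (fun B => block_mass B / _)) -mulr_suml sum_block_mass.
by rewrite mulrC divfK// gt_eqF.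
Qed.

(** Pythagoras: [block_average] is the orthogonal projection of [l] onto functions constant on
    blocks, and the subtracted term is its squared norm. *)
Lemma block_variance : \sum_c (l c - block_average c) ^+ 2 =
  \sum_c l c ^+ 2 - (m ^ d)%:R^-1 * \sum_B block_mass B ^+ 2.
Proof.
have cross : \sum_c l c * block_average c = (m ^ d)%:R^-1 * \sum_B block_mass B ^+ 2.
  rewrite (partition_big (parent m_gt0) predT) //= mulr_sumr; apply: eq_bigr => B _.
  rewrite (eq_bigr (fun c => l c * (block_mass B / (m ^ d)%:R))); last first.
    by move=> c /eqP cB; rewrite /block_average cB.
  by rewrite -mulr_suml -/(block_mass B) expr2; ring.
have sq : \sum_c block_average c ^+ 2 = (m ^ d)%:R^-1 * \sum_B block_mass B ^+ 2.
  rewrite (sum_parent (fun B => (block_mass B / (m ^ d)%:R) ^+ 2)) !mulr_sumr.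
  by apply: eq_bigr => B _; field; rewrite gt_eqF.
rewrite (eq_bigr (fun c => (l c ^+ 2 + block_average c ^+ 2) - 2 * (l c * block_average c))); last first.
  by move=> c _; ring.
rewrite big_split /= big_split /= sumrN -mulr_sumr cross sq; ring.
Qed.

(* The deficit of a sliding average of [l] over boxes of side [mu - b0] is controlled
   by the distance of [l] to its block averages, up to cells near block boundaries. *)
Lemma sliding_average_deficit (b0 mu : nat) : (b0 <= mu <= m)%N -> (0 < mu)%N ->
  \sum_c Num.max 0 (l c - (mu ^ d)%:R^-1 *
     \sum_(c' : C' | [forall i, (c' i + b0 <= c i < c' i + mu)%N]) l c') <=
  2 * \sum_c `|l c - block_average c| +
  (\sum_c l c) * ((1 - ((mu - b0) ^ d)%:R / (mu ^ d)%:R) + (1 - ((m - mu) ^ d)%:R / (m ^ d)%:R)).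
Proof.
move=> /andP[b0mu mum] mu_gt0; set u := block_average.
have mud_gt0 : 0 < (mu ^ d)%:R :> R by rewrite ltr0n expn_gt0 mu_gt0.
pose near (c' c : C') := [forall i, (c' i + b0 <= c i < c' i + mu)%N].
pose inner (c : C') := [forall i, (mu <= c i %% m)%N].
(* The four terms: the deviation at [c]; the mean deviation over the box; the loss from dividing by
   [mu ^ d] a box of only [(mu - b0) ^ d] cells; and the whole average when [c] is within [mu] of a
   lower face of its block. *)
have point c : Num.max 0 (l c - (mu ^ d)%:R^-1 * \sum_(c' | near c' c) l c') <=
    `|l c - u c| + (mu ^ d)%:R^-1 * (\sum_(c' | near c' c) `|l c' - u c'|)
    + u c * (1 - ((mu - b0) ^ d)%:R / (mu ^ d)%:R) + (if inner c then 0 else u c).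
  have fr0 : 0 <= 1 - ((mu - b0) ^ d)%:R / (mu ^ d)%:R :> R.
    by rewrite subr_ge0 ler_pdivrMr// mul1r ler_nat leq_expnl ?leq_subr.
  have t2 : 0 <= (mu ^ d)%:R^-1 * (\sum_(c' | near c' c) `|l c' - u c'|).
    by rewrite mulr_ge0 ?invr_ge0 ?sumr_ge0.
  have t3 := mulr_ge0 (block_average_ge0 c) fr0.
  have t4 : 0 <= (mu ^ d)%:R^-1 * (\sum_(c' | near c' c) l c').
    by rewrite mulr_ge0 ?invr_ge0 ?sumr_ge0.
  have nl := ler_norm (l c - u c); have n0 := normr_ge0 (l c - u c).
  have u0 := block_average_ge0 c; rewrite -/u in u0 t3.
  rewrite ge_max; apply/andP; split; first by case: ifP => _; rewrite ?addr0 ?addr_ge0.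
  case: ifPn => [/forallP inn|_]; last by rewrite lerBlDr; lra.
  have nearpar c' : near c' c -> parent m_gt0 c' = parent m_gt0 c.
    move=> /forallP nc; apply/ffunP => i; rewrite !ffunE; apply/val_inj => /=.
    exact: near_divn m_gt0 (inn i) (nc i).
  have card_near : #|[pred c' : C' | near c' c]| = ((mu - b0) ^ d)%N.
    have cmu i : (mu <= c i)%N by apply: leq_trans (inn i) (leq_mod _ _).
    rewrite -(@card_box d (K * m) (fun i => c i - mu + 1)%N (mu - b0)); last first.
      by move=> i; have := cmu i; have := ltn_ord (c i); clear -b0mu; lia.
    apply: eq_card => c'; rewrite !inE; apply: eq_forallb => i.
    by have := cmu i; clear -b0mu; lia.
  have sumu : \sum_(c' | near c' c) u c' = ((mu - b0) ^ d)%:R * u c.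
    rewrite (eq_bigr (fun=> u c)); last by move=> c' /nearpar; rewrite /u /block_average => ->.
    by rewrite sumr_const mulr_natl -card_near.
  have key : \sum_(c' | near c' c) u c' <=
      \sum_(c' | near c' c) l c' + \sum_(c' | near c' c) `|l c' - u c'|.
    rewrite -big_split /=; apply: ler_sum => c' _; rewrite -lerBlDl.
    by rewrite distrC ler_norm.
  have : (mu ^ d)%:R^-1 * (((mu - b0) ^ d)%:R * u c) <= (mu ^ d)%:R^-1 *
     (\sum_(c' | near c' c) l c' + \sum_(c' | near c' c) `|l c' - u c'|).
    by rewrite ler_wpM2l ?invr_ge0 ?(ltW mud_gt0)// -sumu.
  have -> : u c * (1 - ((mu - b0) ^ d)%:R / (mu ^ d)%:R) =
     u c - (mu ^ d)%:R^-1 * (((mu - b0) ^ d)%:R * u c) by ring.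
  rewrite mulrDr; lra.
apply: (le_trans (ler_sum _ (fun c _ => point c))).
rewrite !big_split /= -mulr_suml sum_block_average mulrDr addrA.
(* Double counting: a cell [c'] lies in the boxes of at most [(mu - b0) ^ d] cells [c]. *)
have dbl : (mu ^ d)%:R^-1 * (\sum_c \sum_(c' | near c' c) `|l c' - u c'|) <=
    \sum_c `|l c - u c|.
  rewrite (exchange_big_dep predT) //= mulr_sumr; apply: ler_sum => c' _.
  rewrite sumr_const -(mulr_natl `|l c' - u c'|) mulrA ler_piMl ?normr_ge0// mulrC ler_pdivrMr// mul1r ler_nat.
  have -> : #|[pred c | near c' c]| = #|[set c : C' | [forall i, (c' i + b0 <= c i < c' i + b0 + (mu - b0))%N]]|.
    by apply: eq_card => c; rewrite !inE; apply: eq_forallb => i; rewrite -addnA subnKC.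
  by apply: (leq_trans (card_box_le _ _)); rewrite leq_expnl ?leq_subr.
have outer : \sum_c (if inner c then 0 else u c) =
    (\sum_c l c) * (1 - ((m - mu) ^ d)%:R / (m ^ d)%:R).
  rewrite -sum_block_mass (partition_big (parent m_gt0) predT) //= mulr_suml.
  apply: eq_bigr => B _; rewrite (bigID inner) /= big1 ?add0r; last by move=> c /andP[_ ->].
  rewrite (eq_bigr (fun=> block_mass B / (m ^ d)%:R)); last first.
    by move=> c /andP[/eqP cB /negbTE ->]; rewrite /u /block_average cB.
  rewrite sumr_const -(mulr_natl (block_mass B / _)).
  have -> : #|[pred c | (parent m_gt0 c == B) && ~~ inner c]| = (m ^ d - (m - mu) ^ d)%N.
    rewrite -(card_parent_fiber m_gt0 B) -(card_parent m_gt0 B mum).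
    rewrite -(cardsID [set c : C' | inner c] [set c : C' | parent m_gt0 c == B]).
    rewrite -[LHS](addKn #|[set c : C' | (parent m_gt0 c == B) && inner c]|).
    by congr (_ + _ - _)%N; apply: eq_card => c; rewrite !inE// andbC.
  rewrite natrB ?leq_expnl ?leq_subr//; field; exact: lt0r_neq0.
rewrite outer -mulr_sumr; lra.
Qed.

End LocalAverage.

(** * Energy increments along nested grids *)

Lemma sqr_sum_le (R : realDomainType) (I : finType) (f : I -> R) :
  (\sum_i f i) ^+ 2 <= #|I|%:R * \sum_i f i ^+ 2.
Proof.
have -> : (\sum_i f i) ^+ 2 = \sum_i \sum_j f i * f j.
  by rewrite expr2 mulr_suml; apply: eq_bigr => i _; rewrite mulr_sumr.
rewrite -(ler_pM2l (ltr0Sn R 1)) [leLHS]mulr_sumr.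
have -> : 2%:R * (#|I|%:R * \sum_i f i ^+ 2) = \sum_i \sum_j (f i ^+ 2 + f j ^+ 2).
  under [RHS]eq_bigr => i _ do rewrite big_split /= sumr_const -mulr_natl.
  by rewrite big_split /= sumr_const -mulr_sumr -[_ *+ #|I|]mulr_natl; ring.
apply: ler_sum => i _; rewrite mulr_sumr; apply: ler_sum => j _.
by rewrite -subr_ge0 (_ : _ - _ = (f i - f j) ^+ 2) ?sqr_ge0//; ring.
Qed.

(** By iteration, so that [level_size K m j.+1] is convertible to [level_size K m j * m], the size
    that [parent] expects. *)
Definition level_size (K m j : nat) : nat := iter j (fun k => k * m)%N K.

Lemma level_sizeE K m j : level_size K m j = (K * m ^ j)%N.
Proof. by elim: j => [|j IH]; rewrite ?muln1//= IH -mulnA -expnSr. Qed.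

(* Nested grids [a j] refining by a factor [m]. The quadratic energies of the cell
   counts increase with the level and stay bounded, so at some level below [J] the
   counts are nearly constant inside the cells of the previous level. *)
Section Energy.
Context {R : realType} {T : finType} {d K m J : nat} (L : {set T}).
Hypothesis m_gt0 : (0 < m)%N.
Local Notation C j := {ffun 'I_d -> 'I_(level_size K m j)}.
Context (a : forall j, T -> C j).
Hypothesis a_parent : forall j p, p \in L -> parent m_gt0 (a j.+1 p) = a j p.

Definition cell_count j (c : C j) : R := #|[set p in L | a j p == c]|%:R.

Lemma sum_cell_count j : \sum_(c : C j) cell_count c = #|L|%:R :> R.
Proof.
rewrite -natr_sum; congr _%:R; rewrite -sum1_card (partition_big (a j) predT) //=.
by apply: eq_bigr => c _; rewrite -sum1_card; apply: eq_bigl => p; rewrite inE.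
Qed.

Lemma block_mass_cell_count j (B : C j) :
  block_mass (@cell_count j.+1) m_gt0 B = cell_count B.
Proof.
rewrite /block_mass /cell_count -natr_sum; congr _%:R.
rewrite -sum1_card (partition_big (a j.+1) (fun c => parent m_gt0 c == B)) /=; last first.
  by move=> p; rewrite inE => /andP[pL /eqP <-]; rewrite a_parent.
apply: eq_bigr => c /eqP cB; rewrite -sum1_card; apply: eq_bigl => p; rewrite !inE.
case: (boolP (p \in L)) => //= pL; case: eqVneq => [apc|_]; rewrite ?andbF//.
by rewrite andbT -(a_parent _ pL) apc cB eqxx.
Qed.

(** Squared L2 norm of the density that is constant on level-[j] cells; the factor is the reciprocal
    of a cell volume, level-0 cells having volume 1. *)
Definition energy j : R := ((m ^ d) ^ j)%:R * \sum_(c : C j) cell_count c ^+ 2.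

(** Cauchy-Schwarz over the cells of level [j.+1]; [block_variance] turns the sum of squares into an
    energy difference. *)
Lemma energy_increment j :
  (\sum_(c : C j.+1) `|cell_count c - block_average (@cell_count j.+1) m_gt0 c|) ^+ 2
  <= (K ^ d)%:R * (energy j.+1 - energy j).
Proof.
apply: (le_trans (sqr_sum_le _)).
under eq_bigr => c _ do rewrite real_normK ?num_real//.
rewrite block_variance; under [X in _ - _ * X]eq_bigr => B _ do rewrite block_mass_cell_count.
rewrite card_ffun !card_ord level_sizeE expnMn natrM -mulrA ler_wpM2l// /energy.
rewrite -expnM [(j.+1 * d)%N]mulnC expnM expnS natrM.
have m0 : (m ^ d)%:R != 0 :> R by rewrite pnatr_eq0 -lt0n expn_gt0 m_gt0.
by rewrite le_eqVlt; apply/orP; left; apply/eqP; field.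
Qed.

(** The increments telescope to at most the final energy, which [Theta] bounds; one of the [J]
    increments is at most their mean. *)
Lemma energy_pigeonhole (Theta : R) : (0 < J)%N -> (forall c, cell_count (c : C J) <= Theta) ->
  exists2 j, (j < J)%N &
   J%:R * (\sum_(c : C j.+1) `|cell_count c - block_average (@cell_count j.+1) m_gt0 c|) ^+ 2
   <= (K ^ d)%:R * (((m ^ d) ^ J)%:R * (Theta * #|L|%:R)).
Proof.
move=> J0 cT.
set f := fun j => (\sum_(c : C j.+1) `|cell_count c - block_average (@cell_count j.+1) m_gt0 c|) ^+ 2.
set Y := (K ^ d)%:R * (((m ^ d) ^ J)%:R * (Theta * #|L|%:R)).
have EJ : (K ^ d)%:R * energy J <= Y.
  rewrite ler_wpM2l// ler_wpM2l// -(sum_cell_count J) mulr_sumr; apply: ler_sum => c _.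
  by rewrite expr2 ler_wpM2r.
have sumf : \sum_(j < J) f j <= Y.
  apply: le_trans EJ; apply: (@le_trans _ _ (\sum_(j < J) (K ^ d)%:R * (energy j.+1 - energy j))).
    by apply: ler_sum => j _; exact: energy_increment.
  rewrite -mulr_sumr ler_wpM2l// -(big_mkord predT (fun j => energy j.+1 - energy j)).
  rewrite telescope_sumr// lerBlDr lerDl mulr_ge0// sumr_ge0// => c _; exact: sqr_ge0.
apply: contrapT => noj.
have big j : (j < J)%N -> Y < J%:R * f j.
  by move=> jJ; rewrite ltNge; apply/negP => h; apply: noj; exists j.
have : J%:R * \sum_(j < J) f j <= J%:R * Y by rewrite ler_wpM2l.
rewrite leNgt => /negP; apply; rewrite mulr_sumr.
rewrite (_ : J%:R * Y = \sum_(j < J) Y); last by rewrite sumr_const card_ord mulr_natl.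
by apply: ltr_sum => // [|j _]; [apply/hasP; exists (Ordinal J0); rewrite ?mem_index_enum|exact: big].
Qed.

End Energy.

Lemma total_residual_le (R : realFieldType) (eps p h s q : R) :
  h <= eps * p -> s <= eps * p -> q <= eps * p ->
  p + (h + (2 * s + q)) <= (1 + 4%:R * eps) * p.
Proof. by move=> *; lra. Qed.

Lemma max0D_le (R : realFieldType) (h l y : R) : 0 <= h ->
  Num.max 0 (h + l - y) <= h + Num.max 0 (l - y).
Proof.
by move=> h0; rewrite ge_max addr_ge0 ?le_max ?lexx//= -addrA lerD2l le_max lexx orbT.
Qed.

Section WindowColoring.
Context {R : realType} {T : finType} (e : rel T) (D : {set T}).
Context {d K m J : nat}.
Hypothesis m_gt0 : (0 < m)%N.
Local Notation C j := {ffun 'I_d -> 'I_(level_size K m j)}.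
Context (a : forall j, T -> C j) (a' : nat -> T -> 'I_d -> nat).
Context (b0 mu : nat) (x : {set T} -> R).
Hypothesis a_parent : forall (j : nat) p, p \in D -> parent m_gt0 (a j.+1 p) = a j p.
Hypothesis a'_bound : forall (j : nat) v i, v \in D -> (a j v i <= a' j v i <= a j v i + b0)%N.
Hypothesis a'_inj : forall (j : nat) p q, p \in D -> q \in D -> p != q -> ~~ e p q ->
  exists i, a' j p i != a' j q i.
Hypothesis a'_stable : forall (j : nat) u v p q, u \in D -> v \in D -> p \in D -> q \in D ->
  (forall i, (a j u i + a' j q i = a j v i + a' j p i)%N) ->
  p != q -> ~~ e p q -> ~~ e u v.
Hypothesis xfeas : frac_coloring_feasible e x.
Local Notation Phi := (\sum_(S | stableb e S) x S).

Let a_coarse j p q : (j <= J)%N -> p \in D -> q \in D -> a J p = a J q -> a j p = a j q.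
Proof.
move=> jJ pD qD; move: jJ; elim: J => [|n IH].
  by rewrite leqn0 => /eqP ->.
rewrite leq_eqVlt => /orP[/eqP ->//|/IH h ae]; apply: h.
by rewrite -(a_parent n pD) -(a_parent n qD) ae.
Qed.

Lemma card_fibers (U : {set T}) (E : finType) (f : T -> E) :
  \sum_c #|[set v in U | f v == c]|%:R = #|U|%:R :> R.
Proof.
rewrite -natr_sum -[in RHS]sum1_card [in RHS](partition_big f predT) //=; congr _%:R.
by apply: eq_bigr => c _; rewrite -sum1_card; apply: eq_bigl => p; rewrite inE.
Qed.

(** The energy bound needs a cap on cell counts, so vertices in overfull finest cells ([heavy]) are
    left out of the covering set [L] and paid for as residual. The budget is [eps * Phi] for them,
    as much for block boundaries, and twice as much for deviations from block averages. *)
Lemma window_colorable (D' : {set T}) (beta eps Lambda A : R) :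
  (b0 <= mu <= m)%N -> (0 < mu)%N -> (0 < J)%N ->
  D' \subset D -> 0 <= beta -> 0 <= eps -> 0 <= Lambda -> 0 <= A ->
  #|D|%:R <= A * Phi ->
  A * ((1 - ((mu - b0) ^ d)%:R / (mu ^ d)%:R) + (1 - ((m - mu) ^ d)%:R / (m ^ d)%:R)) <= eps ->
  (K ^ d)%:R * Lambda * A <= J%:R * eps ^+ 2 ->
  #|[set v in D | Lambda * Phi < ((m ^ d) ^ J)%:R * #|[set u in D | a J u == a J v]|%:R]|%:R
    <= eps * Phi ->
  (forall c, #|[set v in D' | a J v == c]|%:R
     <= beta * #|[set v in D | a J v == c]|%:R + 1) ->
  exists2 k, colorable e D' k &
    k%:R <= beta * ((1 + 4%:R * eps) * Phi)
      + (2 ^ #|{: C J}| + #|{: C J}| * #|{: C J}|.+1)%:R.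
Proof.
move=> b0mum mu_gt0 J_gt0 D'D beta0 eps0 Lambda0 A0 DA epsA JA heavyD cD'.
have Phi0 : 0 <= Phi := feasible_total_ge0 xfeas.
pose heavy := [set v in D |
  Lambda * Phi < ((m ^ d) ^ J)%:R * #|[set u in D | a J u == a J v]|%:R].
rewrite -/heavy in heavyD.
pose L := D :\: heavy.
have LD : L \subset D := finset.subsetDl _ _.
have md0 : 0 < ((m ^ d) ^ J)%:R :> R by rewrite ltr0n !expn_gt0 m_gt0.
have light (c : C J) : cell_count L a c <= Lambda * Phi / ((m ^ d) ^ J)%:R.
  rewrite /cell_count; have [[v]|noL] := pselect (exists v, v \in [set p in L | a J p == c]).
    rewrite !inE => /andP[/andP[+ vD] /eqP ac]; rewrite vD /= -leNgt => vl.
    rewrite ler_pdivlMr// mulrC (le_trans _ vl)// ler_pM2l// ler_nat subset_leq_card//.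
    by apply/fintype.subsetP => u; rewrite !inE -ac => /andP[/andP[_ ->] ->].
  rewrite (_ : [set p in L | a J p == c] = finset.set0) ?cards0 ?divr_ge0 ?mulr_ge0//.
  by apply/setP => v; rewrite [RHS]inE; apply/negP => vL; apply: noL; exists v.
have aL j p : p \in L -> parent m_gt0 (a j.+1 p) = a j p.
  by move=> /(fintype.subsetP LD); exact: a_parent.
have [j jJ L1] := energy_pigeonhole aL J_gt0 light.
set l : C j.+1 -> R := @cell_count _ _ _ _ _ L a j.+1.
set S1 := \sum_c `|l c - block_average l m_gt0 c|.
rewrite -/l -/S1 in L1.
have S1_le : S1 <= eps * Phi.
  have S10 : 0 <= S1 by apply: sumr_ge0.
  rewrite -(ler_pXn2r (n := 2)) ?nnegrE ?mulr_ge0//.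
  rewrite -(ler_pM2l (_ : 0 < J%:R)) ?ltr0n//.
  apply: (le_trans L1); rewrite exprMn [leRHS]mulrA.
  apply: (@le_trans _ _ ((K ^ d)%:R * Lambda * A * Phi ^+ 2)); last first.
    by rewrite ler_wpM2r ?sqr_ge0.
  have LA : #|L|%:R <= A * Phi by rewrite (le_trans _ DA)// ler_nat subset_leq_card.
  rewrite (_ : _ * _ = (K ^ d)%:R * (Lambda * Phi) * #|L|%:R); last first.
    by field; rewrite ?lt0r_neq0.
  rewrite (_ : _ * A * _ = (K ^ d)%:R * (Lambda * Phi) * (A * Phi)); last by ring.
  by rewrite ler_wpM2l// !mulr_ge0.
have card_le : (#|{: C j.+1}| <= #|{: C J}|)%N.
  rewrite !card_ffun !card_ord leq_expnl// !level_sizeE leq_mul2l leq_pexp2l ?orbT//.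
(* The good level [j] varies with the window, so balance is assumed at the finest level only;
   summing over finest cells costs an error 1 for each. *)
have fib (c : C j.+1) : #|[set v in D' | a j.+1 v == c]|%:R
    <= beta * #|[set v in D | a j.+1 v == c]|%:R + #|{: C J}|%:R :> R.
  rewrite -!(card_fibers _ (a J)) mulr_sumr.
  rewrite [#|{: C J}|%:R](_ : _ = \sum_(c' : C J) 1); last by rewrite sumr_const.
  rewrite -big_split /=.
  apply: ler_sum => c' _.
  have [[v]|no] := pselect (exists v, v \in [set v in [set v in D' | a j.+1 v == c] | a J v == c']); last first.
    rewrite (_ : [set v in _ | a J v == c'] = finset.set0) ?cards0 ?addr_ge0 ?mulr_ge0//.
    by apply/setP => v; rewrite [RHS]inE; apply/negP => vL; apply: no; exists v.
  rewrite !inE => /andP[/andP[vD' /eqP vc] /eqP vc'].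
  have vD := fintype.subsetP D'D _ vD'.
  rewrite (le_trans _ (le_trans (cD' c') _))//.
    by rewrite ler_nat subset_leq_card//; apply/fintype.subsetP => u; rewrite !inE => /andP[/andP[-> _] ->].
  rewrite lerD2r ler_wpM2l// ler_nat subset_leq_card//; apply/fintype.subsetP => u; rewrite !inE.
  move=> /andP[uD /eqP uc']; rewrite uD uc' eqxx andbT -vc; apply/eqP.
  by apply: (@a_coarse j.+1 u v) => //; rewrite uc' vc'.
have [k Dk kle] := dilated_cover_colorable mu_gt0 (@a'_bound j.+1) (@a'_inj j.+1)
  (@a'_stable j.+1) xfeas LD D'D beta0 fib.
exists k => //; apply: (le_trans kle); apply: lerD; last first.
  rewrite ler_nat leq_add ?leq_mul ?leq_pexp2l ?ltnS//.
rewrite ler_wpM2l//.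
have cov (c : C j.+1) : #|[set p in L | [forall i, (a j.+1 p i + b0 <= c i < a j.+1 p i + mu)%N]]|%:R =
    \sum_(c' : C j.+1 | [forall i, (c' i + b0 <= c i < c' i + mu)%N]) l c'.
  rewrite /l /cell_count -natr_sum; congr _%:R.
  rewrite -sum1_card (partition_big (a j.+1) (fun c' : C j.+1 => [forall i, (c' i + b0 <= c i < c' i + mu)%N])) /=; last first.
    by move=> p; rewrite inE => /andP[].
  apply: eq_bigr => c' nc'; rewrite -sum1_card; apply: eq_bigl => p.
  rewrite inE [in RHS]inE -andbA.
  by case: (p \in L) => //=; case: (eqVneq (a j.+1 p) c') => [->|_]; rewrite ?andbF// andbT nc'.
apply: (@le_trans _ _ (Phi + (#|heavy|%:R + (2 * S1 + (\sum_c l c) *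
   ((1 - ((mu - b0) ^ d)%:R / (mu ^ d)%:R) + (1 - ((m - mu) ^ d)%:R / (m ^ d)%:R)))))); last first.
  have : (\sum_c l c) * ((1 - ((mu - b0) ^ d)%:R / (mu ^ d)%:R) + (1 - ((m - mu) ^ d)%:R / (m ^ d)%:R)) <= eps * Phi.
    rewrite (sum_cell_count L a j.+1).
    apply: (@le_trans _ _ (A * Phi * ((1 - ((mu - b0) ^ d)%:R / (mu ^ d)%:R) + (1 - ((m - mu) ^ d)%:R / (m ^ d)%:R)))).
      rewrite ler_wpM2r//; last by rewrite (le_trans _ DA)// ler_nat subset_leq_card.
      have mud_gt0 : 0 < (mu ^ d)%:R :> R by rewrite ltr0n expn_gt0 mu_gt0.
      have md_gt0 : 0 < (m ^ d)%:R :> R by rewrite ltr0n expn_gt0 m_gt0.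
      by rewrite addr_ge0// subr_ge0 ler_pdivrMr// mul1r ler_nat leq_expnl ?leq_subr.
    by rewrite mulrAC ler_wpM2r.
  exact: total_residual_le heavyD S1_le.
rewrite lerD2l.
apply: (@le_trans _ _ (\sum_c (#|[set v in heavy | a j.+1 v == c]|%:R + Num.max 0 (l c - (mu ^ d)%:R^-1 *
     \sum_(c' : C j.+1 | [forall i, (c' i + b0 <= c i < c' i + mu)%N]) l c')))); last first.
  rewrite big_split /= card_fibers lerD2l; exact: sliding_average_deficit.
apply: ler_sum => c _; rewrite cov.
have -> : #|[set v in D | a j.+1 v == c]|%:R = #|[set v in heavy | a j.+1 v == c]|%:R + l c.
  rewrite /l /cell_count -natrD -(cardsID heavy); congr (_ + _)%:R.
    by apply: eq_card => v; rewrite !inE; case: (v \in D) => //=; rewrite ?andbF// andbC.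
  by apply: eq_card => v; rewrite !inE andbA.
exact: max0D_le.
Qed.

End WindowColoring.

(** * Rounding the points of a window to cells *)

Lemma truncn_divn (R : archiRealDomainType) (y : R) (m : nat) : (0 < m)%N -> 0 <= y ->
  (Num.truncn (y * m%:R) %/ m)%N = Num.truncn y.
Proof.
move=> m0 y0; apply/esym/truncn_def; have mR : 0 < m%:R :> R by rewrite ltr0n.
have /andP[lo hi] := truncn_itv (mulr_ge0 y0 (ltW mR)).
apply/andP; split.
  by rewrite -(ler_pM2r mR) -natrM (le_trans _ lo)// ler_nat leq_divM.
by rewrite -(ltr_pM2r mR) -natrM (lt_le_trans hi)// ler_nat -ltn_divLR.
Qed.

Lemma truncnD_le (R : archiRealDomainType) (x y : R) (b : nat) : 0 <= x -> 0 <= y -> y <= b%:R ->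
  (Num.truncn x <= Num.truncn (x + y) <= Num.truncn x + b)%N.
Proof.
move=> x0 y0 yb; rewrite le_truncn ?lerDl//= truncn_le_nat -addSn natrD.
by rewrite ltr_leD// truncnS_gt.
Qed.

Lemma truncn_eq_ltr1 (R : archiRealDomainType) (x y : R) : 0 <= x -> 0 <= y ->
  Num.truncn x = Num.truncn y -> `|x - y| < 1.
Proof.
move=> /truncn_itv/andP[xl xh] /truncn_itv/andP[yl yh] xy; rewrite xy -natr1 in xl xh.
by rewrite -natr1 in yh; rewrite ltr_norml; apply/andP; split; lra.
Qed.

Lemma truncn_dist (R : archiRealDomainType) (x y : R) : 0 <= x -> 0 <= y ->
  `|(x - y) - ((Num.truncn x)%:R - (Num.truncn y)%:R)| <= 1.
Proof.
move=> /truncn_itv/andP[xl xh] /truncn_itv/andP[yl yh]; rewrite -natr1 in xh.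
by rewrite -natr1 in yh; rewrite ler_norml; apply/andP; split; lra.
Qed.

Lemma add_double_ltF (R : realDomainType) (r y : R) : 0 < r -> 0 < y -> ~ (r + 2 * y < y).
Proof. by move=> *; lra. Qed.

Lemma dist_le2 (R : realDomainType) (x y z w x' y' z' w' : R) :
  z' + y' = w' + x' -> `|z - w - (z' - w')| <= 1 -> `|x - y - (x' - y')| <= 1 ->
  `|x - y - (z - w)| <= 2.
Proof.
by rewrite !ler_norml => eq0 /andP[h1 h2] /andP[h3 h4]; apply/andP; split; lra.
Qed.

Lemma tnth_tsub (R : realType) d (x y : d.-tuple R) i :
  tnth (tsub x y) i = tnth x i - tnth y i.
Proof. by rewrite tnth_mktuple. Qed.

Section GeometricWindow.
Context {R : realType} {T : finType} {d : nat} (N : d.-tuple R -> R).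
Context (C1 r g : R) (X : T -> d.-tuple R) (corner : 'I_d -> R) {K m J : nat}.
Hypotheses (C1_gt0 : 0 < C1) (r_gt0 : 0 < r) (g_gt0 : 0 < g).
Hypotheses (K_gt0 : (0 < K)%N) (m_gt0 : (0 < m)%N).
Hypothesis norm_perturb : forall (lambda b : R) (x y : d.-tuple R), 0 <= lambda ->
  (forall i, `|lambda * tnth x i - tnth y i| <= b) -> lambda * N x <= N y + C1 * b.
Hypothesis norm_small : forall (b : R) (x : d.-tuple R),
  (forall i, `|tnth x i| <= b) -> N x <= C1 * b.

Local Notation e := (fun u v => (u != v) && (N (tsub (X u) (X v)) <= r)).
Local Notation C j := {ffun 'I_d -> 'I_(level_size K m j)}.

Definition window : {set T} :=
  [set v | [forall i, 0 <= tnth (X v) i - corner i < K%:R * (g * r)]].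

Definition level_coord (j : nat) (v : T) (i : 'I_d) : R :=
  (tnth (X v) i - corner i) / (g * r) * (m ^ j)%:R.

(** Chosen so that [dilation j * r] is [2 * C1] times the side of a level-[j] cell: the gain in
    distance of a non-adjacent pair then absorbs two rounding errors of one side per coordinate. *)
Definition dilation (j : nat) : R := 2 * C1 * g / (m ^ j)%:R.

Lemma level_size_gt0 j : (0 < level_size K m j)%N.
Proof. by rewrite level_sizeE muln_gt0 K_gt0 expn_gt0 m_gt0. Qed.

(** The default of [insubd] concerns only vertices outside [window], where the value has no
    meaning. *)
Definition level_cell (j : nat) (v : T) : C j :=
  [ffun i => insubd (Ordinal (level_size_gt0 j)) (Num.truncn (level_coord j v i))].

Definition dilated_cell (j : nat) (v : T) (i : 'I_d) : nat :=
  Num.truncn ((1 + dilation j) * level_coord j v i).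

Let gr_gt0 : 0 < g * r. Proof. by rewrite mulr_gt0. Qed.
Let mj_gt0 j : 0 < (m ^ j)%:R :> R. Proof. by rewrite ltr0n expn_gt0 m_gt0. Qed.
Let dilation_ge0 j : 0 <= dilation j. Proof. by rewrite divr_ge0 ?mulr_ge0 ?ltW. Qed.

Let level_coord_ge0 j v i : v \in window -> 0 <= level_coord j v i.
Proof.
rewrite inE => /forallP/(_ i)/andP[vi _].
by rewrite mulr_ge0 ?(ltW (mj_gt0 j))// divr_ge0 ?(ltW gr_gt0).
Qed.

Let level_coord_lt j v i : v \in window -> level_coord j v i < (level_size K m j)%:R.
Proof.
rewrite inE => /forallP/(_ i)/andP[_ vi].
by rewrite level_sizeE natrM ltr_pM2r ?mj_gt0// ltr_pdivrMr.
Qed.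

Lemma level_cellE j v i : v \in window ->
  level_cell j v i = Num.truncn (level_coord j v i) :> nat.
Proof.
move=> vD; rewrite ffunE val_insubd truncn_lt_nat ?level_coord_ge0//.
by rewrite level_coord_lt.
Qed.

Lemma level_cell_parent j v : v \in window ->
  parent m_gt0 (level_cell j.+1 v) = level_cell j v.
Proof.
move=> vD; apply/ffunP => i; apply/val_inj; rewrite ffunE /= (@level_cellE j v i vD) (@level_cellE j.+1 v i vD).
rewrite -(truncn_divn m_gt0 (level_coord_ge0 j i vD)); congr (Num.truncn _ %/ _)%N.
by rewrite /level_coord expnSr natrM mulrA.
Qed.

(** The dilation shrinks by a factor [m] per level while coordinates grow by [m], so one [b0] serves
    all levels. *)
Lemma dilated_cell_bound (b0 : nat) j v i : 2 * C1 * g * K%:R <= b0%:R -> v \in window ->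
  (level_cell j v i <= dilated_cell j v i <= level_cell j v i + b0)%N.
Proof.
move=> b0P vD; rewrite level_cellE// /dilated_cell mulrDl mul1r.
have lc0 := level_coord_ge0 j i vD.
apply: truncnD_le => //; first by rewrite mulr_ge0.
apply: le_trans b0P; rewrite /dilation mulrAC ler_pdivrMr// -[leRHS]mulrA ler_wpM2l//.
  by rewrite !mulr_ge0 ?ltW.
by rewrite -natrM -level_sizeE ltW// level_coord_lt.
Qed.

Let coord_of_level j v i : tnth (X v) i - corner i = level_coord j v i * (g * r / (m ^ j)%:R).
Proof. by rewrite /level_coord; field; rewrite !lt0r_neq0. Qed.

Let side_gt0 j : 0 < g * r / (m ^ j)%:R. Proof. by rewrite divr_gt0. Qed.

(** Points with equal dilated cells are, once dilated, at norm distance at most [C1] cell sides,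
    while a dilated non-adjacent pair is more than [r] plus [2 * C1] sides apart. *)
Lemma dilated_cell_inj j p q : p \in window -> q \in window -> p != q -> ~~ e p q ->
  exists i, dilated_cell j p i != dilated_cell j q i.
Proof.
move=> pD qD pq; rewrite /= pq /= -ltNge => rpq; apply: contrapT => noi.
have eqi i : dilated_cell j p i = dilated_cell j q i.
  by apply/eqP; apply: contrapT => /negP h; apply: noi; exists i.
have : (1 + dilation j) * N (tsub (X p) (X q)) <= C1 * (g * r / (m ^ j)%:R).
  have := @norm_perturb (1 + dilation j) (g * r / (m ^ j)%:R) (tsub (X p) (X q)) (tzero R d).
  have N0 : N (tzero R d) <= 0.
    by rewrite -(mulr0 C1); apply: norm_small => i; rewrite tnth_mktuple normr0.
  move=> H; apply: (le_trans (H _ _)); rewrite ?addr_ge0//; last by rewrite gerDr.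
  move=> i; rewrite tnth_tsub [tnth (tzero _ _) _]tnth_mktuple subr0.
  have -> : tnth (X p) i - tnth (X q) i =
     (level_coord j p i - level_coord j q i) * (g * r / (m ^ j)%:R).
    by rewrite mulrBl -!coord_of_level; ring.
  rewrite mulrA normrM (gtr0_norm (side_gt0 j)) ler_piMl ?(ltW (side_gt0 j))//.
  rewrite mulrBr; apply/ltW/truncn_eq_ltr1; last exact: eqi.
    by rewrite mulr_ge0 ?addr_ge0 ?level_coord_ge0.
  by rewrite mulr_ge0 ?addr_ge0 ?level_coord_ge0.
have r2 : (1 + dilation j) * r < (1 + dilation j) * N (tsub (X p) (X q)).
  by rewrite ltr_pM2l// ltr_pwDl.
have dr : dilation j * r = 2 * (C1 * (g * r / (m ^ j)%:R)).
  by rewrite /dilation; field; rewrite lt0r_neq0.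
have s0 : 0 < C1 * (g * r / (m ^ j)%:R) by rewrite mulr_gt0.
by move=> /(lt_le_trans r2); rewrite mulrDl dr mul1r; exact: add_double_ltF.
Qed.

(** Rounding changes the difference of [u], [v] and the dilated difference of [p], [q] by at most
    one side per coordinate each: together [2 * C1] sides in norm, exactly what the dilation gains
    at distance [r]. *)
Lemma dilated_cell_stable j u v p q :
  u \in window -> v \in window -> p \in window -> q \in window ->
  (forall i, (level_cell j u i + dilated_cell j q i = level_cell j v i + dilated_cell j p i)%N) ->
  p != q -> ~~ e p q -> ~~ e u v.
Proof.
move=> uD vD pD qD cells pq; rewrite /= pq /= -ltNge => rpq.
apply/negP => /andP[_ ruv].
have H : (1 + dilation j) * N (tsub (X p) (X q)) <=
    N (tsub (X u) (X v)) + C1 * (2 * (g * r / (m ^ j)%:R)).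
  apply: norm_perturb => [|i]; first by rewrite addr_ge0.
  rewrite !tnth_tsub.
  have -> : tnth (X p) i - tnth (X q) i =
     (level_coord j p i - level_coord j q i) * (g * r / (m ^ j)%:R).
    by rewrite mulrBl -!coord_of_level; ring.
  have -> : tnth (X u) i - tnth (X v) i =
     (level_coord j u i - level_coord j v i) * (g * r / (m ^ j)%:R).
    by rewrite mulrBl -!coord_of_level; ring.
  rewrite mulrA -mulrBl normrM (gtr0_norm (side_gt0 j)) ler_pM2r// mulrBr.
  have := truncn_dist (mulr_ge0 (addr_ge0 ler01 (dilation_ge0 j)) (level_coord_ge0 j i pD))
    (mulr_ge0 (addr_ge0 ler01 (dilation_ge0 j)) (level_coord_ge0 j i qD)).
  have := truncn_dist (level_coord_ge0 j i uD) (level_coord_ge0 j i vD).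
  have := cells i; rewrite !level_cellE// /dilated_cell => /(congr1 (fun k => k%:R : R)).
  by rewrite !natrD; exact: dist_le2.
have r2 : (1 + dilation j) * r < (1 + dilation j) * N (tsub (X p) (X q)).
  by rewrite ltr_pM2l// ltr_pwDl.
have dr : dilation j * r = 2 * (C1 * (g * r / (m ^ j)%:R)).
  by rewrite /dilation; field; rewrite lt0r_neq0.
have := lt_le_trans r2 (le_trans H (lerD ruv (lexx _))); rewrite mulrDl dr mul1r.
by rewrite [C1 * (2 * _)]mulrCA ltxx.
Qed.

(** Cubes of side [r / C1] are cliques by [norm_small], so each holds at most the total weight of a
    fractional colouring; [f] numbers the cubes. *)
Lemma window_card_le (x : {set T} -> R) : frac_coloring_feasible e x ->
  #|window|%:R <= ((Num.truncn (K%:R * g * C1)).+1 ^ d)%:R * \sum_(S | stableb e S) x S.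
Proof.
move=> xf; pose A := (Num.truncn (K%:R * g * C1)).+1.
pose f (v : T) : {ffun 'I_d -> 'I_A} :=
  [ffun i => inord (Num.truncn ((tnth (X v) i - corner i) / r * C1))].
rewrite -(card_fibers window f).
apply: (@le_trans _ _ (\sum_(c : {ffun 'I_d -> 'I_A}) \sum_(S | stableb e S) x S)); last first.
  by rewrite sumr_const card_ffun !card_ord mulr_natl.
apply: ler_sum => c _; apply: clique_le_feasible => //.
have coordb v i : v \in window -> 0 <= (tnth (X v) i - corner i) / r * C1 < A%:R.
  rewrite inE => /forallP/(_ i)/andP[v0 vK]; rewrite mulr_ge0 ?divr_ge0 ?(ltW r_gt0) ?(ltW C1_gt0)//=.
  apply: lt_trans (truncnS_gt (K%:R * g * C1)).
  by rewrite ltr_pM2r// ltr_pdivrMr// -mulrA.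
apply/forall_inP => u; rewrite inE => /andP[uD /eqP uc].
apply/forall_inP => v; rewrite inE => /andP[vD /eqP vc].
apply/implyP => uv; rewrite /= uv /=.
have -> : r = C1 * (r / C1) by field; rewrite lt0r_neq0.
apply: norm_small => i; rewrite tnth_tsub.
have tr : Num.truncn ((tnth (X u) i - corner i) / r * C1) =
    Num.truncn ((tnth (X v) i - corner i) / r * C1).
  have := congr1 (fun c : {ffun 'I_d -> 'I_A} => val (c i)) (etrans uc (esym vc)).
  have /andP[u0 uA] := coordb _ i uD; have /andP[v0 vA] := coordb _ i vD.
  by rewrite /f !ffunE /= !inordK// truncn_lt_nat.
have /andP[u0 uA] := coordb _ i uD; have /andP[v0 vA] := coordb _ i vD.
have := truncn_eq_ltr1 u0 v0 tr.
rewrite -!mulrBl (_ : _ - _ - _ = tnth (X u) i - tnth (X v) i); last by ring.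
by rewrite -mulrA normrM [`|r^-1 * _|]gtr0_norm ?mulr_gt0 ?invr_gt0// -ltr_pdivlMr ?mulr_gt0 ?invr_gt0// div1r invfM invrK => /ltW.
Qed.

Lemma geometric_window_colorable (x : {set T} -> R) (D' : {set T}) (b0 mu : nat)
    (beta eps Lambda : R) :
  let A : R := ((Num.truncn (K%:R * g * C1)).+1 ^ d)%:R in
  let Phi := \sum_(S | stableb e S) x S in
  frac_coloring_feasible e x ->
  2 * C1 * g * K%:R <= b0%:R ->
  (b0 <= mu <= m)%N -> (0 < mu)%N -> (0 < J)%N ->
  D' \subset window -> 0 <= beta -> 0 <= eps -> 0 <= Lambda ->
  A * ((1 - ((mu - b0) ^ d)%:R / (mu ^ d)%:R) + (1 - ((m - mu) ^ d)%:R / (m ^ d)%:R)) <= eps ->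
  (K ^ d)%:R * Lambda * A <= J%:R * eps ^+ 2 ->
  #|[set v in window | Lambda * Phi <
     ((m ^ d) ^ J)%:R * #|[set u in window | level_cell J u == level_cell J v]|%:R]|%:R
    <= eps * Phi ->
  (forall c, #|[set v in D' | level_cell J v == c]|%:R
     <= beta * #|[set v in window | level_cell J v == c]|%:R + 1) ->
  exists2 k, colorable e D' k &
    k%:R <= beta * ((1 + 4%:R * eps) * Phi)
      + (2 ^ #|{: C J}| + #|{: C J}| * #|{: C J}|.+1)%:R.
Proof.
move=> A Phi xf b0P b0mu mu0 J0 D'D beta0 eps0 L0 epsA JA heavy cD'.
apply: (@window_colorable R T e window d K m J m_gt0 level_cell dilated_cell b0 mu x
  level_cell_parent (fun j v i => @dilated_cell_bound b0 j v i b0P)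
  dilated_cell_inj dilated_cell_stable xf D' beta eps Lambda A) => //.
exact: window_card_le.
Qed.

End GeometricWindow.

(** * From windows to the whole space *)

Lemma card_bigcup_le (I T : finType) (F : I -> {set T}) :
  (#|\bigcup_i F i| <= \sum_i #|F i|)%N.
Proof.
apply: (big_ind2 (fun (A : {set T}) n => #|A| <= n)%N) => [|A a B b Aa Bb|//].
  by rewrite cards0.
by rewrite (leq_trans (leq_card_setU _ _).1)// leq_add.
Qed.

Lemma round_robin (T : finType) (S : {set T}) (p q : nat) : (0 < p)%N ->
  (#|[set v in S | index v (enum S) %% p == q]| <= (#|S| %/ p).+1)%N.
Proof.
move=> p0; set U := [set v in S | _].
have UP v : v \in U -> (v \in S) /\ (index v (enum S) %% p = q)%N by rewrite inE => /andP[-> /eqP].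
have idx v : v \in S -> (index v (enum S) < #|S|)%N by move=> vS; rewrite [X in (_ < X)%N]cardE index_mem mem_enum.
pose f v : 'I_(#|S| %/ p).+1 := inord (index v (enum S) %/ p).
rewrite -[X in (_ <= X)%N]card_ord -(@card_in_imset _ _ f U) ?max_card// => u v /UP[uS uq] /UP[vS vq].
move=> /(congr1 val); rewrite /= !inordK ?ltnS ?leq_div2r// ?(ltnW (idx _ uS)) ?(ltnW (idx _ vS))// => uv.
have : index u (enum S) = index v (enum S).
  by rewrite (divn_eq (index u _) p) (divn_eq (index v _) p) uv uq vq.
by move/(congr1 (nth u (enum S))); rewrite !nth_index ?mem_enum.
Qed.

(** Vertices with the same label are dealt in turn to the indices that are good for this label. *)
Lemma balanced_assignment (T : finType) (Z : eqType) (z : T -> Z) (M b : nat)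
    (good : Z -> {set 'I_M}) : (0 < b)%N -> (forall c, (b <= #|good c|)%N) ->
  exists f : T -> 'I_M, (forall v, f v \in good (z v)) /\
    forall c s, (b * #|[set v | (z v == c) && (f v == s)]%SET| <= #|[set v | z v == c]%SET| + b)%N.
Proof.
move=> b0 bgood.
have good0 c : (0 < #|good c|)%N by apply: leq_trans (bgood c).
have /choice[s0 s0P] c : exists s, s \in good c by apply/card_gt0P.
pose f v := nth (s0 (z v)) (enum (good (z v)))
  (index v (enum [set u | z u == z v]%SET) %% #|good (z v)|).
exists f; split=> [v|c s]; first by rewrite /f -mem_enum mem_nth// -cardE ltn_pmod.
have sub : [set v | (z v == c) && (f v == s)]%SET \subset
    [set v in [set v | z v == c]%SET | (index v (enum [set v | z v == c]%SET) %% #|good c|)%N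
        == index s (enum (good c))].
  apply/fintype.subsetP => v; rewrite !inE => /andP[/eqP zv /eqP fv]; rewrite zv eqxx /=.
  by rewrite -fv /f zv index_uniq ?enum_uniq// -cardE ltn_pmod.
have := leq_trans (subset_leq_card sub) (round_robin _ _ (good0 c)).
set n := #|[set v | z v == c]%SET| => h.
apply: (@leq_trans (b * (n %/ #|good c|).+1)); first by rewrite leq_mul2l h orbT.
rewrite mulnS addnC leq_add2r (leq_trans _ (leq_divM n b))// mulnC leq_mul2r leq_div2l ?orbT//.
Qed.

(** For windows of length [M - 1] repeated with period [M] and shifted by [s], the unit cell [y]
    falls into a gap. *)
Definition gap_shift (M : nat) (s : 'I_M) (y : int) : bool :=
  ((y - s%:Z) %% M)%Z == M%:Z - 1.

(** The shifts are diagonal, so each coordinate rules out at most one of them. *)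
Lemma good_shifts_card (d M : nat) (zeta : 'I_d -> int) : (0 < M)%N ->
  (M - d <= #|[set s : 'I_M | [forall i, ~~ gap_shift s (zeta i)]]%SET|)%N.
Proof.
move=> M0; set U := finset _.
suff : (#|~: U| <= d)%N by have := cardsC U; rewrite card_ord; lia.
have sub : ~: U \subset \bigcup_i [set s : 'I_M | gap_shift s (zeta i)]%SET.
  apply/fintype.subsetP => s; rewrite !inE negb_forall => /existsP[i]; rewrite negbK => h.
  by apply/bigcupP; exists i => //; rewrite inE.
apply: (leq_trans (subset_leq_card sub)).
apply: (leq_trans (card_bigcup_le _)).
rewrite -[X in (_ <= X)%N]card_ord -sum1_card; apply: leq_sum => i _.
rewrite leqNgt; apply/negP => /card_gt1P[s [s' [+ + ss']]]; rewrite !inE /gap_shift => /eqP h /eqP h'.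
have : (s%:Z = s'%:Z %[mod M])%Z.
  have e1 := divz_eq (zeta i - s%:Z) M; have e2 := divz_eq (zeta i - s'%:Z) M.
  rewrite h in e1; rewrite h' in e2.
  set q := ((zeta i - s%:Z) %/ M)%Z in e1; set q' := ((zeta i - s'%:Z) %/ M)%Z in e2.
  have -> : s%:Z = (q' - q) * M%:Z + s'%:Z by rewrite mulrBl; lia.
  by rewrite modzMDl.
rewrite !modz_nat !modn_small// => /(congr1 absz)/= /val_inj /eqP.
by rewrite (negbTE ss').
Qed.

Lemma bernoulli_ge (R : realDomainType) (y : R) (d : nat) : 0 <= y <= 1 ->
  1 - d%:R * y <= (1 - y) ^+ d.
Proof.
move=> /andP[y0 y1]; elim: d => [|d IH]; first by rewrite expr0 mul0r subr0.
rewrite exprS; have := ler_wpM2l (_ : 0 <= 1 - y) IH; rewrite subr_ge0 => /(_ y1).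
apply: le_trans; rewrite -natr1.
have : 0 <= d%:R * y ^+ 2 :> R by rewrite mulr_ge0 ?sqr_ge0.
by rewrite expr2; lra.
Qed.

Lemma box_ratio_small (R : archiRealFieldType) (d b : nat) (eta : R) : 0 < eta ->
  exists m, [/\ (b <= m)%N, (0 < m)%N & 1 - ((m - b) ^ d)%:R / (m ^ d)%:R <= eta].
Proof.
move=> eta0; pose m := ((Num.truncn ((d * b)%:R / eta)).+1 + b)%N; exists m.
have m0 : (0 < m)%N by rewrite /m addSn.
have bm : (b <= m)%N by rewrite leq_addl.
split=> //; have mR : 0 < m%:R :> R by rewrite ltr0n.
have y01 : 0 <= (b%:R / m%:R : R) <= 1 by rewrite divr_ge0//= ler_pdivrMr// mul1r ler_nat.
have := @bernoulli_ge R _ d y01.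
rewrite (_ : 1 - b%:R / m%:R = (m - b)%:R / m%:R :> R); last first.
  by rewrite natrB// mulrBl divff ?lt0r_neq0.
rewrite expr_div_n -!natrX; move=> H; rewrite lerBlDl -lerBlDr (le_trans _ H)// lerB//.
rewrite mulrA -natrM ler_pdivrMr// mulrC -ler_pdivrMr//.
apply/ltW/(lt_le_trans (truncnS_gt _)); rewrite ler_nat; exact: leq_addr.
Qed.

Section Assembly.
Context {R : realType} {d : nat} (N : d.-tuple R -> R) (C1 C2 : R).
Hypotheses (C1_gt0 : 0 < C1) (C2_gt0 : 0 < C2).
Hypothesis norm_perturb : forall (lambda b : R) (x y : d.-tuple R), 0 <= lambda ->
  (forall i, `|lambda * tnth x i - tnth y i| <= b) -> lambda * N x <= N y + C1 * b.
Hypothesis norm_small : forall (b : R) (x : d.-tuple R),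
  (forall i, `|tnth x i| <= b) -> N x <= C1 * b.
Hypothesis norm_coord : forall (x : d.-tuple R) i, `|tnth x i| <= C2 * N x.

(* One colouring of all vertices from colourings of windows: the vertices are split
   among [M] diagonal shifts of a periodic family of separated windows. *)
Section Shifts.
Context {T : finType} (r : R) (X : T -> d.-tuple R) (K m J : nat).
Hypotheses (r_gt0 : 0 < r) (K_gt0 : (0 < K)%N) (m_gt0 : (0 < m)%N).
Local Notation e := (fun u v => (u != v) && (N (tsub (X u) (X v)) <= r)).
Local Notation M := K.+1.
Local Notation P := (level_size K m J).
(** Side of the finest cells. Windows are used with [g = C2], so unit cells have side [C2 * r], and
    by [norm_coord] a gap of one unit cell in some coordinate excludes adjacency. *)
Let s : R := C2 * r / (m ^ J)%:R.
Let s_gt0 : 0 < s. Proof. by rewrite divr_gt0 ?mulr_gt0// ltr0n expn_gt0 m_gt0. Qed.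

Definition fine_cell (v : T) : {ffun 'I_d -> int} := [ffun i => Num.floor (tnth (X v) i / s)].

Lemma fine_cell_itv v i :
  (fine_cell v i)%:~R * s <= tnth (X v) i < (fine_cell v i + 1)%:~R * s.
Proof. by rewrite ffunE -ler_pdivlMr// -ltr_pdivrMr// floor_itv. Qed.

Definition corner_of (w : 'I_d -> int) (i : 'I_d) : R := (w i)%:~R * s.

(** Corners lie on the grid of mesh [s], so the finest cells of every window belong to one global
    grid; balancing and the counting hypothesis can be stated without windows. *)
Lemma mem_window_fine_cell (w : 'I_d -> int) v (c : {ffun 'I_d -> 'I_P}) :
  (v \in window r C2 X (corner_of w) (K := K)) &&
    (level_cell r C2 X (corner_of w) K_gt0 m_gt0 J v == c) =
  [forall i, fine_cell v i == w i + (c i)%:Z].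
Proof.
have sE : (m ^ J)%:R * s = C2 * r by rewrite mulrC divfK// pnatr_eq0 -lt0n expn_gt0 m_gt0.
have mJ0 : 0 < (m ^ J)%:R :> R by rewrite ltr0n expn_gt0 m_gt0.
have lcE i : level_coord r C2 X (corner_of w) (m := m) J v i = tnth (X v) i / s - (w i)%:~R.
  by rewrite /level_coord -sE /corner_of; field; rewrite !lt0r_neq0.
apply/andP/forallP => [[vD /eqP <-] i|vc].
  rewrite (level_cellE r_gt0 C2_gt0 K_gt0 m_gt0 J i vD) lcE.
  have v0 : 0 <= tnth (X v) i / s - (w i)%:~R.
    move: vD; rewrite inE => /forallP/(_ i)/andP[+ _].
    by rewrite /corner_of !subr_ge0 ler_pdivlMr.
  rewrite ffunE; apply/eqP/floor_def; have /andP[lo hi] := truncn_itv v0.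
  by rewrite -natr1 in hi; rewrite !intrD -!pmulrn /=; apply/andP; split; lra.
have vD : v \in window r C2 X (corner_of w) (K := K).
  rewrite inE; apply/forallP => i; have /andP[lo hi] := fine_cell_itv v i.
  rewrite (eqP (vc i)) in lo hi; rewrite /corner_of subr_ge0; apply/andP; split.
    by rewrite (le_trans _ lo)// ler_pM2r// ler_int lerDl.
  rewrite ltrBlDr (lt_le_trans hi)// -sE mulrA -mulrDl ler_pM2r// -natrM -level_sizeE.
  by rewrite pmulrn -intrD ler_int -addrA addrC lerD2r; have := ltn_ord (c i); lia.
split=> //; apply/eqP/ffunP => i; apply/val_inj => /=.
rewrite (level_cellE r_gt0 C2_gt0 K_gt0 m_gt0 J i vD) lcE.
apply: truncn_def; have /andP[lo hi] := fine_cell_itv v i.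
move: lo hi; rewrite (eqP (vc i)) -ler_pdivlMr// -ltr_pdivrMr// !intrD -!pmulrn /=.
by rewrite -natr1 => lo hi; apply/andP; split; lra.
Qed.

(** In order: the unit cell containing a fine cell; the shifts that put it in no gap; the index of
    the window holding [v] under shift [t]; the corner of a window, counted in fine cells. *)
Let zeta (c : {ffun 'I_d -> int}) (i : 'I_d) : int := (c i %/ (m ^ J)%N)%Z.
Let good (c : {ffun 'I_d -> int}) : {set 'I_M} :=
  [set t : 'I_M | [forall i, ~~ gap_shift t (zeta c i)]]%SET.
Let kappa (t : 'I_M) (v : T) : {ffun 'I_d -> int} :=
  [ffun i => ((zeta (fine_cell v) i - t%:Z) %/ M)%Z].
Let base (t : 'I_M) (k : {ffun 'I_d -> int}) (i : 'I_d) : int :=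
  (k i * M%:Z + t%:Z) * (m ^ J)%N%:Z.

Let zeta_itv v i : (zeta (fine_cell v) i)%:~R * (C2 * r) <= tnth (X v) i <
  (zeta (fine_cell v) i + 1)%:~R * (C2 * r).
Proof.
have mJ : (m ^ J)%N%:Z != 0 by rewrite -lt0n expn_gt0 m_gt0.
have sE : C2 * r = (m ^ J)%N%:~R * s by rewrite /s [RHS]mulrC -pmulrn divfK// pnatr_eq0 -lt0n expn_gt0 m_gt0.
have /andP[lo hi] := fine_cell_itv v i.
have := divz_eq (fine_cell v i) (m ^ J)%N; have := modz_ge0 (fine_cell v i) mJ.
have := ltz_pmod (fine_cell v i) (_ : 0 < (m ^ J)%N%:Z); rewrite ltz_nat expn_gt0 m_gt0 => /(_ isT).
rewrite -/(zeta _ i); set q := zeta _ i; set y := (_ %% _)%Z => ylt y0 cE.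
rewrite sE (mulrA q%:~R) (mulrA (q + 1)%:~R) -!intrM; apply/andP; split.
  by rewrite (le_trans _ lo)// ler_pM2r// ler_int cE lerDl.
by rewrite (lt_le_trans hi)// ler_pM2r// ler_int cE mulrDl mul1r -addrA lerD2l; lia.
Qed.

Let good_decomp t v i : t \in good (fine_cell v) -> exists rho : nat,
  (rho < K)%N /\ zeta (fine_cell v) i = kappa t v i * M%:Z + t%:Z + rho%:Z.
Proof.
rewrite inE => /forallP/(_ i); rewrite /gap_shift ffunE.
set y := _ - _; have := divz_eq y M; have := modz_ge0 y (_ : M%:Z != 0) => /(_ isT).
have := ltz_pmod y (_ : 0 < M%:Z) => /(_ isT).
case: (y %% M)%Z => [rho|//] rM _ yE rneq; exists rho; split; first by lia.
by rewrite -addrA [t%:Z + _]addrC addrA -yE /y subrK.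
Qed.

Let good_window t v : t \in good (fine_cell v) ->
  v \in window r C2 X (corner_of (base t (kappa t v))) (K := K).
Proof.
move=> tg; rewrite inE; apply/forallP => i.
have [rho [rK zE]] := good_decomp i tg; have /andP[lo hi] := zeta_itv v i.
have -> : corner_of (base t (kappa t v)) i = (kappa t v i * M%:Z + t%:Z)%:~R * (C2 * r).
  rewrite /corner_of /base intrM -mulrA; congr (_ * _).
  by rewrite mulrC /s -pmulrn divfK// pnatr_eq0 -lt0n expn_gt0 m_gt0.
have C2r : 0 < C2 * r by rewrite mulr_gt0.
rewrite subr_ge0 ltrBlDr; apply/andP; split.
  by rewrite (le_trans _ lo)// ler_pM2r// ler_int zE lerDl.
rewrite (lt_le_trans hi)// -mulrDl ler_pM2r// pmulrn -intrD ler_int zE; lia.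
Qed.

(** In a coordinate where the window indices differ, a whole unit cell lies between the two
    points. *)
Let good_separated t u v : t \in good (fine_cell u) -> t \in good (fine_cell v) ->
  kappa t u != kappa t v -> ~~ e u v.
Proof.
have sep a b i : t \in good (fine_cell a) -> t \in good (fine_cell b) ->
    kappa t a i < kappa t b i -> C2 * r < tnth (X b) i - tnth (X a) i.
  move=> ag bg ab; have [ra [raK aE]] := good_decomp i ag; have [rb [rbK bE]] := good_decomp i bg.
  have /andP[_ ahi] := zeta_itv a i; have /andP[blo _] := zeta_itv b i.
  have C2r : 0 < C2 * r by rewrite mulr_gt0.
  have ab2 : zeta (fine_cell a) i + 2 <= zeta (fine_cell b) i.
    have : (kappa t a i + 1) * M%:Z <= kappa t b i * M%:Z by rewrite ler_pM2r// lezD1.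
    by rewrite aE bE mulrDl mul1r; move: (_ * _) (_ * _) => y z; lia.
  rewrite ltrBrDr; apply: (@lt_le_trans _ _ ((zeta (fine_cell a) i + 2)%:~R * (C2 * r))); last first.
    by rewrite (le_trans _ blo)// ler_pM2r// ler_int.
  by move: ahi; rewrite !intrD !mulrDl mul1r; move: (C2 * r) => y; lra.
move=> ug vg /eqP kuv; apply/negP => /andP[_ uvr].
have coord i : `|tnth (X u) i - tnth (X v) i| <= C2 * r.
  by rewrite -tnth_tsub (le_trans (norm_coord _ i))// ler_pM2l.
apply: kuv; apply/ffunP => i; have [kl|kl|//] := ltgtP (kappa t u i) (kappa t v i).
- have := sep _ _ _ ug vg kl; rewrite ltNge (le_trans _ (coord i))//.
  by rewrite distrC ler_norm.
- have := sep _ _ _ vg ug kl; rewrite ltNge (le_trans _ (coord i))//.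
  by rewrite ler_norm.
Qed.

Lemma shifts_colorable (x : {set T} -> R) (b0 mu : nat) (eps Lambda : R) :
  let A : R := ((Num.truncn (K%:R * C2 * C1)).+1 ^ d)%:R in
  let Phi := \sum_(S | stableb e S) x S in
  let C := {ffun 'I_d -> 'I_P} in
  frac_coloring_feasible e x -> (d < M)%N ->
  2 * C1 * C2 * K%:R <= b0%:R ->
  (b0 <= mu <= m)%N -> (0 < mu)%N -> (0 < J)%N ->
  0 <= eps -> 0 <= Lambda ->
  A * ((1 - ((mu - b0) ^ d)%:R / (mu ^ d)%:R) + (1 - ((m - mu) ^ d)%:R / (m ^ d)%:R)) <= eps ->
  (K ^ d)%:R * Lambda * A <= J%:R * eps ^+ 2 ->
  (forall (w : 'I_d -> int) (Q : {set C}),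
     #|Q|%:R * (Lambda * Phi) <= ((m ^ d) ^ J)%:R * (A * Phi) -> (Phi = 0 -> Q = finset.set0) ->
     #|[set v | [exists o in Q, forall i, fine_cell v i == w i + (o i)%:Z]]%SET|%:R <= eps * Phi) ->
  exists2 k, colorable e [set: T] k &
    k%:R <= M%:R / (M - d)%:R * ((1 + 4%:R * eps) * Phi)
      + (M * (2 ^ #|{: C}| + #|{: C}| * #|{: C}|.+1))%:R.
Proof.
move=> A Phi C xf dM b0P b0mu mu0 J0 eps0 L0 epsA JA heavy.
(* Every vertex has at least [M - d] good shifts, so each shift receives about a [beta] share of
   each fine cell, and the [M] shifts together cost [M / (M - d)] times one window. *)
set B := (2 ^ _ + _)%N; pose beta : R := (M - d)%:R^-1.
have Phi0 : 0 <= Phi := feasible_total_ge0 xf.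
have Md0 : (0 < M - d)%N by rewrite subn_gt0.
have [f [fgood fcard]] := @balanced_assignment T _ fine_cell M _ good Md0
  (fun c => good_shifts_card (zeta c) (ltn0Sn K)).
pose V t := [set v | f v == t]%SET.
have Vgood t v : v \in V t -> t \in good (fine_cell v) by rewrite inE => /eqP <-; exact: fgood.
pose bound := beta * ((1 + 4%:R * eps) * Phi) + B%:R.
have bound0 : 0 <= bound by rewrite !(addr_ge0, mulr_ge0)// invr_ge0.
(* Different windows of one shift are non-adjacent and reuse the same colours. *)
have VV t : colorable e (V t) (Num.truncn bound).
  apply: (@colorable_partition _ _ _ _ (kappa t)) => [u v /Vgood ug /Vgood vg|k].
    exact: good_separated.
  have sub : [set v in V t | kappa t v == k] \subset window r C2 X (corner_of (base t k)) (K := K).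
    by apply/fintype.subsetP => v; rewrite inE => /andP[/Vgood vg /eqP <-]; exact: good_window.
  have cellE (c : C) : [set v in window r C2 X (corner_of (base t k)) (K := K) |
      level_cell r C2 X (corner_of (base t k)) K_gt0 m_gt0 J v == c] =
      [set v | fine_cell v == [ffun i => base t k i + (c i)%:Z]]%SET.
    apply/setP => v; rewrite !inE -[RHS]/(_ == _).
    have := mem_window_fine_cell (base t k) v c; rewrite inE => ->.
    by apply/forallP/eqP => [h|-> i]; [apply/ffunP => i; rewrite [RHS]ffunE; exact/eqP|rewrite ffunE].
  have beta0 : 0 <= beta by rewrite invr_ge0.
  have wA := window_card_le C2 (corner_of (base t k)) (K := K) C1_gt0 r_gt0 norm_small xf.
  have [||k' ck k'le] := @geometric_window_colorable R T d N C1 r C2 X (corner_of (base t k)) K m J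
    C1_gt0 r_gt0 C2_gt0 K_gt0 m_gt0 norm_perturb norm_small x _ b0 mu beta eps Lambda
    xf b0P b0mu mu0 J0 sub beta0 eps0 L0 epsA JA.
  - pose cnt (c : C) := #|[set u in window r C2 X (corner_of (base t k)) (K := K) |
      level_cell r C2 X (corner_of (base t k)) K_gt0 m_gt0 J u == c]|.
    (* Markov: the window has at most [A * Phi] vertices, which bounds the number of heavy cells.
       For [Phi = 0] this says nothing, whence the separate condition that [Q] be empty. *)
    pose Q := [set c : C | Lambda * Phi < ((m ^ d) ^ J)%:R * (cnt c)%:R]%SET.
    apply: le_trans (heavy (base t k) Q _ _).
    + rewrite ler_nat subset_leq_card//; apply/fintype.subsetP => v; rewrite inE => /andP[vW vQ].
      rewrite inE; apply/existsP; exists (level_cell r C2 X (corner_of (base t k)) K_gt0 m_gt0 J v).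
      by rewrite inE vQ /= -mem_window_fine_cell vW eqxx.
    + apply: (@le_trans _ _ (\sum_(c in Q) ((m ^ d) ^ J)%:R * (cnt c)%:R)).
        rewrite mulr_natl -sumr_const; apply: ler_sum => c; rewrite inE; exact: ltW.
      rewrite -mulr_sumr ler_wpM2l// (le_trans _ wA)//.
      rewrite -(card_fibers _ (level_cell r C2 X (corner_of (base t k)) K_gt0 m_gt0 J)).
      by rewrite [leLHS]big_mkcond /=; apply: ler_sum => c _; case: ifP.
    + move=> Phi_eq0; apply/setP => c; rewrite [RHS]inE; apply/negP; rewrite inE Phi_eq0 mulr0 => h.
      have : (0 < cnt c)%N.
        by rewrite lt0n; apply/negP => /eqP c0; move: h; rewrite c0 mulr0 ltxx.
      move=> /card_gt0P[v _]; have := @clique_le_feasible R T e x [set v]%SET xf.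
      rewrite cards1 -/Phi Phi_eq0 ler10 => /(_ _)/negP; apply => //.
      apply/forall_inP => u; rewrite inE => /eqP ->; apply/forall_inP => w; rewrite inE => /eqP ->.
      by rewrite eqxx.
  - move=> c; rewrite cellE; set n := #|[set v | fine_cell v == _]%SET|.
    rewrite -(ler_pM2l (_ : 0 < (M - d)%:R)) ?ltr0n// mulrDr mulr1 /beta mulVKf; last first.
      by rewrite pnatr_eq0 -lt0n.
    rewrite -natrM -natrD ler_nat.
    apply: leq_trans (fcard [ffun i => base t k i + (c i)%:Z] t); rewrite leq_mul2l; apply/orP; right.
    rewrite subset_leq_card//; apply/fintype.subsetP => v; rewrite !inE.
    move=> /andP[/andP[vt vk] vc].
    have : v \in [set v in window r C2 X (corner_of (base t k)) (K := K) |
      level_cell r C2 X (corner_of (base t k)) K_gt0 m_gt0 J v == c].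
      by rewrite inE vc andbT (fintype.subsetP sub)// !inE vt.
    by rewrite cellE inE => ->.
  by apply: colorable_le ck; rewrite truncn_ge_nat.
have := colorable_bigcup VV; rewrite card_ord => ck; exists (M * Num.truncn bound)%N.
  by apply: colorable_sub ck; apply/fintype.subsetP => v _; apply/bigcupP; exists (f v); rewrite ?inE.
rewrite !natrM -mulrA -mulrDr ler_wpM2l//.
by rewrite truncn_le.
Qed.

End Shifts.

(** [L] is fixed by [eps] before [theta] is given, since [theta] will have to be small against
    [L ^+ d]; [P] and [B] come last and depend neither on the points nor on [r]. *)
Lemma dense_colorable (eps : R) : 0 < eps -> exists L : R, 0 < L /\
  forall theta : R, 0 < theta -> exists P B : nat, (0 < P)%N /\
  forall (T : finType) (X : T -> d.-tuple R) (r : R) (x : {set T} -> R) (t : nat),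
  let e := fun u v => (u != v) && (N (tsub (X u) (X v)) <= r) in
  let Phi := \sum_(S | stableb e S) x S in
  0 < r -> frac_coloring_feasible e x -> t%:R <= eps * Phi ->
  (forall (w : 'I_d -> int) (Q : {set {ffun 'I_d -> 'I_P}}),
    #|Q|%:R <= theta * (P ^ d)%:R ->
    (#|[set v | [exists o in Q, forall i,
        (Num.floor (tnth (X v) i / (L * r / P%:R)) == w i + (o i)%:Z)%R]]%SET| <= t)%N) ->
  exists2 k, colorable e [set: T] k & k%:R <= (1 + eps) * ((1 + 4%:R * eps) * Phi) + B%:R.
Proof.
move=> eps0; pose K := (d + (Num.truncn (d%:R / eps)).+1)%N.
have K0 : (0 < K)%N by rewrite /K addnS.
have dM : (d < K.+1)%N by rewrite ltnS leq_addr.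
have ratio : K.+1%:R / (K.+1 - d)%:R <= 1 + eps.
  rewrite ler_pdivrMr ?ltr0n ?subn_gt0//.
  have -> : K.+1%:R = (K.+1 - d)%:R + d%:R :> R by rewrite -natrD subnK// ltnW.
  rewrite mulrDl mul1r lerD2l mulrC -ler_pdivrMr// (le_trans (ltW (truncnS_gt _)))//.
  by rewrite ler_nat /K -addnS addKn.
exists (K%:R * C2); split; first by rewrite mulr_gt0// ltr0n.
move=> theta theta0.
pose A : R := ((Num.truncn (K%:R * C2 * C1)).+1 ^ d)%:R.
have A0 : 0 < A by rewrite ltr0n expn_gt0.
pose b0 := (Num.truncn (2 * C1 * C2 * K%:R)).+1.
have eta0 : 0 < eps / (2 * A) by rewrite divr_gt0 ?mulr_gt0.
(* [b0] bounds the displacement by dilation; [mu] is large against [b0] and [m] against [mu], each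
   step losing at most half of [eps / A]. *)
have [mu [b0mu mu0 muP]] := box_ratio_small d b0 eta0.
have [m [mum m0 mP]] := box_ratio_small d mu eta0.
(* With this value Markov's bound on the number of heavy cells becomes [theta * (m ^ d) ^ J], at
   most [theta * P ^ d]; [J] then meets the energy condition. *)
pose Lambda := A / theta.
pose J := (Num.truncn ((K ^ d)%:R * Lambda * A / eps ^+ 2)).+1.
pose P := level_size K m J.
pose C := {ffun 'I_d -> 'I_P}.
exists P, (K.+1 * (2 ^ #|{: C}| + #|{: C}| * #|{: C}|.+1))%N.
split; first exact: level_size_gt0.
move=> T X r x t e Phi r0 xf tPhi count.
have [|||||k ck kle] := @shifts_colorable T r X K m J r0 K0 m0 x b0 mu eps Lambda
   xf dM (ltW (truncnS_gt _)) _ mu0 isT (ltW eps0).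
- by rewrite b0mu.
- by rewrite divr_ge0// ltW.
- rewrite -/A -ler_pdivlMl// (le_trans (lerD muP mP))//.
  by rewrite le_eqVlt; apply/orP; left; apply/eqP; field; rewrite lt0r_neq0.
- by rewrite -/A -ler_pdivrMr ?exprn_gt0// ltW// truncnS_gt.
- move=> w Q QA Q0; apply: le_trans tPhi; rewrite ler_nat.
  apply: leq_trans (count w Q _); last first.
    have [->|[c cQ]] := set_0Vmem Q; first by rewrite cards0 mulr_ge0 ?(ltW theta0).
    have Phi0 : 0 < Phi.
      rewrite lt_neqAle (feasible_total_ge0 xf) andbT eq_sym; apply/negP => /eqP/Q0 Qe.
      by move: cQ; rewrite Qe inE.
    move: QA; rewrite -/A /Lambda -/Phi mulrA [_ * (A * Phi)]mulrA ler_pM2r//.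
    rewrite mulrCA [leRHS]mulrC ler_pM2l// ler_pdivrMr// mulrC => QP.
    rewrite (le_trans QP)// ler_pM2l// ler_nat /P level_sizeE expnMn -!expnM [(d * J)%N]mulnC.
    by rewrite leq_pmull// expn_gt0 K0.
  rewrite subset_leq_card//; apply/fintype.subsetP => v; rewrite !inE => /existsP[c /andP[cQ /forallP vc]].
  apply/existsP; exists c; rewrite cQ; apply/forallP => i; rewrite -(eqP (vc i)) ffunE.
  have -> : K%:R * C2 * r / P%:R = C2 * r / (m ^ J)%:R; last exact: eqxx.
  rewrite /P level_sizeE natrM; field.
  by rewrite !pnatr_eq0 -!lt0n expn_gt0 m0 K0.
exists k => //; apply: (le_trans kle); rewrite lerD2r ler_wpM2r//.
by rewrite mulr_ge0 ?(feasible_total_ge0 xf)// addr_ge0// mulr_ge0// ltW.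
Qed.

End Assembly.

Local Open Scope classical_set_scope.
Local Open Scope ring_scope.

(** * Norms and bounded densities *)

Section NormEquivalence.
Context {R : realType} {d : nat} (N : d.-tuple R -> R).
Hypothesis Nnorm : is_norm N.

Let N0 : N (tzero R d) = 0.
Proof.
have [_ [_ [NZ _]]] := Nnorm; rewrite -[RHS](mul0r (N (tzero R d))) -[in RHS](normr0 R) -NZ.
by congr N; apply/eq_from_tnth => i; rewrite !tnth_mktuple mul0r.
Qed.

Definition tbasis (k : 'I_d) : d.-tuple R := [tuple (i == k)%:R | i < d].

Lemma norm_le_sum (x : d.-tuple R) : N x <= \sum_i `|tnth x i| * N (tbasis i).
Proof.
have [_ [_ [NZ ND]]] := Nnorm.
pose trunc k : d.-tuple R := [tuple if (i < k)%N then tnth x i else 0 | i < d].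
have H k : (k <= d)%N -> N (trunc k) <= \sum_(i < d | (i < k)%N) `|tnth x i| * N (tbasis i).
  elim: k => [_|k IH kd].
    have -> : trunc 0%N = tzero R d by apply/eq_from_tnth => i; rewrite !tnth_mktuple.
    by rewrite big_pred0 ?N0.
  pose kk := Ordinal kd.
  have -> : trunc k.+1 = tadd (trunc k) (tscale (tnth x kk) (tbasis kk)).
    apply/eq_from_tnth => i; rewrite !tnth_mktuple ltnS leq_eqVlt -[(i == kk)]/(i == k :> nat).
    have [ik|_] := eqVneq (i : nat) k; last by rewrite mulr0 addr0.
    by rewrite ik ltnn mulr1 add0r; congr tnth; apply/val_inj.
  rewrite (le_trans (ND _ _))// NZ (bigD1 kk) ?ltnSn//= addrC lerD2r (le_trans (IH (ltnW kd)))//.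
  rewrite le_eqVlt; apply/orP; left; apply/eqP/eq_bigl => i.
  by rewrite ltnS -val_eqE /= [(i < k)%N]ltn_neqAle andbC.
have xE : trunc d = x by apply/eq_from_tnth => i; rewrite tnth_mktuple ltn_ord.
rewrite -[in leLHS]xE.
by rewrite (le_trans (H d _))// (eq_bigl predT)// => i; rewrite ltn_ord.
Qed.

Let C : R := 1 + \sum_i N (tbasis i).

Let sumN_ge0 : 0 <= \sum_i N (tbasis i).
Proof. by apply: sumr_ge0 => i _; exact: Nnorm.1. Qed.

Let C_gt0 : 0 < C. Proof. by rewrite ltr_pwDl. Qed.

Lemma norm_small_sum (b : R) (x : d.-tuple R) : 0 <= b ->
  (forall i, `|tnth x i| <= b) -> N x <= C * b.
Proof.
move=> b0 xb; rewrite (le_trans (norm_le_sum x))// mulrDl mul1r.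
apply: (@le_trans _ _ (\sum_i N (tbasis i) * b)); last by rewrite -mulr_suml lerDr.
by apply: ler_sum => i _; rewrite mulrC ler_wpM2l//; exact: Nnorm.1.
Qed.

Lemma norm_perturb_sum (lambda b : R) (x y : d.-tuple R) : 0 <= b -> 0 <= lambda ->
  (forall i, `|lambda * tnth x i - tnth y i| <= b) -> lambda * N x <= N y + C * b.
Proof.
have [_ [_ [NZ ND]]] := Nnorm; move=> b0 l0 xyb.
rewrite -[in leLHS](ger0_norm l0) -NZ.
have -> : tscale lambda x = tadd y (tsub (tscale lambda x) y).
  by apply/eq_from_tnth => i; rewrite !tnth_mktuple addrC subrK.
rewrite (le_trans (ND _ _))// lerD2l norm_small_sum// => i.
by rewrite !tnth_mktuple.
Qed.

Let rowN (v : 'rV[R]_d) : R := N [tuple v ord0 i | i < d].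

Let rV_coord_le (v : 'rV[R]_d) i : `|v ord0 i| <= `|v|.
Proof.
rewrite [leRHS]/Num.Def.normr /= mx_normrE.
by apply: (le_bigmax_cond 0 (fun ij => `|v ij.1 ij.2|) (j := (ord0, i))).
Qed.

Let rowN_continuous : continuous rowN.
Proof.
move=> v; apply/(@cvgrPdist_lt R R _ (nbhs v) (nbhs_filter v)) => eps eps0; apply/nbhs_ballP; exists (eps / C) => [|u] /=.
  by rewrite divr_gt0.
rewrite -ball_normE /= => uv.
have H (a b : 'rV[R]_d) : `|a - b| < eps / C -> rowN a - rowN b < eps.
  move=> ab; rewrite ltrBlDl (@le_lt_trans _ _ (rowN b + C * `|a - b|))//; last first.
    by rewrite ltrD2l mulrC -ltr_pdivlMr.
  rewrite -[leLHS]mul1r; apply: norm_perturb_sum => // i; rewrite !tnth_mktuple mul1r.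
  by rewrite (le_trans _ (rV_coord_le (a - b) i))// !mxE.
rewrite ltr_norml; apply/andP; split; last exact: H.
by rewrite ltrNl opprB H// distrC.
Qed.

(** Equivalence of norms: [N] is continuous, hence has a positive minimum on the unit sphere of the
    sup norm. Row vectors supply the topology and the compactness. *)
Lemma norm_coord_bound : (0 < d)%N ->
  exists2 C2 : R, 0 < C2 & forall (x : d.-tuple R) i, `|tnth x i| <= C2 * N x.
Proof.
have [Nge0 [Neq0 [NZ ND]]] := Nnorm => d0.
pose S : set 'rV[R]_d := [set v | `|v| = 1]%classic.
have Sne : S !=set0.
  pose i0 : 'I_d := Ordinal d0.
  exists (delta_mx ord0 i0); rewrite /S /=; apply/le_anti/andP; split; last first.
    by have := rV_coord_le (delta_mx ord0 i0) i0; rewrite mxE !eqxx normr1.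
  rewrite [leLHS]/Num.Def.normr /= mx_normrE; apply: bigmax_le => // -[i j] _ /=.
  by rewrite mxE; case: (_ && _); rewrite ?normr1 ?normr0.
have Scpt : compact S.
  apply: bounded_closed_compact.
    by exists 1; split=> // y y1 v /= ->; exact: ltW.
  by apply: (closed_comp (f := fun v : 'rV[R]_d => `|v|) (D := [set 1]%classic)) => [v _|];
    [exact: norm_continuous|exact: closed_eq].
have [c cS cmin] := EVT_min_rV Sne Scpt (continuous_subspaceT rowN_continuous).
have c0 : 0 < rowN c.
  rewrite lt_neqAle Nge0 andbT eq_sym; apply/negP => /eqP/Neq0 ceq0.
  move: cS; rewrite inE /S /= => c1; have : `|c| = 0.
    rewrite (_ : c = 0) ?normr0//; apply/rowP => i; rewrite mxE.
    by have := congr1 (fun t => tnth t i) ceq0; rewrite !tnth_mktuple.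
  by rewrite c1 => /eqP; rewrite oner_eq0.
exists (rowN c)^-1 => [|x i]; first by rewrite invr_gt0.
pose v : 'rV[R]_d := \row_j tnth x j.
have xv : x = [tuple v ord0 j | j < d] by apply/eq_from_tnth => j; rewrite tnth_mktuple mxE.
apply: (@le_trans _ _ `|v|); first by have := rV_coord_le v i; rewrite mxE.
have [->|v0] := eqVneq `|v| 0; first by rewrite mulr_ge0 ?invr_ge0 ?Nge0.
rewrite mulrC ler_pdivlMr// mulrC.
have vS : `|v|^-1 *: v \in S.
  by rewrite inE /S /= normrZ normfV normr_id mulVf.
have -> : N x = `|v| * rowN (`|v|^-1 *: v).
  rewrite -[X in X * _](normr_id v) -NZ; congr N; apply/eq_from_tnth => j.
  by rewrite !tnth_mktuple !mxE mulrA divff// mul1r.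
by rewrite mulrC ler_wpM2l// cmin.
Qed.

End NormEquivalence.

(** The inner iterated integrals come without a measurability proof. A nonnegative integral is a
    supremum over simple functions below the integrand, hence monotone for arbitrary functions. *)
Lemma le_integral_nomeas (d : measure_display) (T : measurableType d) (R : realType)
    (mu : {measure set T -> \bar R}) (f g : T -> \bar R) :
  (forall x, 0 <= f x)%E -> (forall x, f x <= g x)%E ->
  (\int[mu]_x f x <= \int[mu]_x g x)%E.
Proof.
move=> f0 fg; have g0 x : (0 <= g x)%E := le_trans (f0 x) (fg x).
rewrite !ge0_integralTE//; apply: le_ereal_sup => _ [h hf <-].
by exists h => // x; exact: le_trans (fg x).
Qed.

Section Density.
Context {R : realType}.

Lemma lebesgue_iint_ge0 d (g : d.-tuple R -> \bar R) :
  (forall x, 0 <= g x)%E -> (0 <= lebesgue_iint g)%E.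
Proof.
elim: d g => [|d IH] g g0 /=; first exact: g0.
by apply: integral_ge0 => t _; apply: IH => u; exact: g0.
Qed.

Lemma lebesgue_iint0 d (g : d.-tuple R -> \bar R) :
  (forall x, g x = 0)%E -> lebesgue_iint g = 0%E.
Proof.
elim: d g => [|d IH] g g0 /=; first exact: g0.
by apply: integral0_eq => t _; apply: IH => u; exact: g0.
Qed.

Definition box d (a : 'I_d -> R) (s : R) : set (d.-tuple R) :=
  [set x | forall i, a i <= tnth x i < a i + s].

Lemma lebesgue_iint_box d (g : d.-tuple R -> \bar R) (a : 'I_d -> R) (s M : R) :
  0 <= s -> 0 <= M -> (forall x, 0 <= g x <= M%:E)%E ->
  (forall x, ~ box a s x -> g x = 0%E) ->
  (lebesgue_iint g <= (M * s ^+ d)%:E)%E.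
Proof.
move=> s0 M0; elim: d g a => [|d IH] g a gM gbox /=.
  by rewrite expr0 mulr1; have /andP[] := gM [tuple].
have inner t : (lebesgue_iint (fun u : d.-tuple R => g (cons_tuple t u)) <=
    (M * s ^+ d)%:E * (\1_`[a ord0, a ord0 + s[ t)%:E)%E.
  rewrite indicE; case: (boolP (t \in `[a ord0, a ord0 + s[%classic)) => ta; last first.
    rewrite mule0 lebesgue_iint0// => u; apply: gbox => /(_ ord0).
    by rewrite tnth0 => tb; move/negP: ta; apply; rewrite inE /= in_itv.
  rewrite mule1; apply: (IH _ (fun i => a (lift ord0 i))) => [u|u ub]; first exact: gM.
  apply: gbox => tb; apply: ub => i; have := tb (lift ord0 i).
  by rewrite (tnth_nth 0) /= -tnth_nth.
have iint0 t : (0 <= lebesgue_iint (fun u : d.-tuple R => g (cons_tuple t u)))%E.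
  by apply: lebesgue_iint_ge0 => u; have /andP[] := gM (cons_tuple t u).
apply: (le_trans (le_integral_nomeas lebesgue_measure iint0 inner)).
rewrite ge0_integralZl//=; last 2 first.
- by apply/measurable_EFinP; exact: measurable_indic.
- by rewrite lee_fin mulr_ge0// exprn_ge0.
have lm : lebesgue_measure (`[a ord0, a ord0 + s[%classic : set R) = s%:E.
  rewrite lebesgue_measure_itv /= lte_fin ltrDl; case: ifPn => [_|].
    by rewrite -EFinB addrAC subrr add0r.
  by rewrite lt_neqAle s0 andbT negbK => /eqP <-.
by rewrite integral_indic// setIT [X in (_ * X)%E]lm -EFinM lee_fin -mulrA exprSr.
Qed.

Lemma measurable_box d (a : 'I_d -> R) (s : R) : measurable (box a s).
Proof.
have -> : box a s = \bigcap_(i in [set: 'I_d]) ((fun x : d.-tuple R => tnth x i) @^-1` `[a i, a i + s[).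
  apply/seteqP; split=> x /= xa i; first by move=> _; rewrite /= in_itv /=; exact: xa.
  by have := xa i Logic.I; rewrite /= in_itv.
apply: fin_bigcap_measurable => // i _; rewrite -[X in measurable X]setTI.
exact: (measurable_tnth i).
Qed.

(** From here on the density enters only through this bound on cubes. *)
Lemma bounded_density_box d (nu : set (d.-tuple R) -> \bar R) : has_bounded_density nu ->
  exists2 M : R, 0 <= M & forall a s, 0 <= s -> (nu (box a s) <= (M * s ^+ d)%:E)%E.
Proof.
move=> [f [M [_ [fM nuE]]]].
have M0 : 0 <= M by have /andP[f0 /(le_trans f0)] := fM (tzero R d).
exists M => // a s s0; rewrite nuE; last exact: measurable_box.
apply: (@lebesgue_iint_box _ _ a) => // x.
  have /andP[fx0 fxM] := fM x; rewrite indicE lee_fin lee_fin.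
  by case: (_ \in _); rewrite ?mul1r ?mul0r ?fx0 ?fxM ?lexx.
by move=> xb; rewrite indicE (memNset xb) /= mul0r.
Qed.

End Density.

(** * Moment and union bounds *)

Section UnionBounds.
Context {dO : measure_display} {Omega : measurableType dO} {R : realType}.
Context (P : probability Omega R).

(** The conclusion gives a measurable cover, so that bad events quantified over positions or
    colourings never have to be shown measurable. *)
Lemma union_bound (I : finType) (Q : pred I) (E : I -> set Omega) (f : I -> R) :
  (forall i, Q i -> measurable (E i)) -> (forall i, Q i -> (P (E i) <= (f i)%:E)%E) ->
  exists F, [/\ measurable F, (P F <= (\sum_(i | Q i) f i)%:E)%E &
    forall i w, Q i -> E i w -> F w].
Proof.
move=> mE PE; exists (\big[setU/set0]_(i | Q i) E i); split; last first.
- by move=> i w Qi Ei; rewrite (bigD1 i)//; left.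
- suff [] : measurable (\big[setU/set0]_(i | Q i) E i) /\
    (P (\big[setU/set0]_(i | Q i) E i) <= (\sum_(i | Q i) f i)%:E)%E by [].
  apply: (big_rec2 (fun (F : set Omega) y => measurable F /\ (P F <= y%:E)%E)).
    by rewrite measure0.
  move=> i F y Qi [mF PF]; split; first by apply: measurableU => //; exact: mE.
  apply: (le_trans (measureU2 _ _ _)) => //; first exact: mE.
  by rewrite EFinD leeD// PE.
- exact: bigsetU_measurable.
Qed.

(** The sets [G c] are disjoint, so their weights sum to at most 1 and countably many events cost
    only the factor [a]. *)
Lemma countable_union_bound (C : countType) d (T : measurableType d) (mu : probability T R)
    (E : C -> set Omega) (G : C -> set T) (a : R) : 0 <= a ->
  (forall c, measurable (E c)) -> (forall c, measurable (G c)) ->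
  (forall c c' x, G c x -> G c' x -> c = c') ->
  (forall c, (P (E c) <= a%:E * mu (G c))%E) ->
  exists F, [/\ measurable F, (P F <= a%:E)%E & forall c w, E c w -> F w].
Proof.
move=> a0 mE mG dG EG.
pose E' n := if @pickle_inv C n is Some c then E c else set0.
pose G' n := if @pickle_inv C n is Some c then G c else set0.
have mE' n : measurable (E' n) by rewrite /E'; case: (@pickle_inv C n).
have mG' n : measurable (G' n) by rewrite /G'; case: (@pickle_inv C n).
have EG' n : (P (E' n) <= a%:E * mu (G' n))%E.
  by rewrite /E' /G'; case: (@pickle_inv C n) => // ; rewrite !measure0 mule0.
exists (\bigcup_n E' n); split.
- exact: bigcupT_measurable.
- apply: (le_trans (@measure_sigma_subadditive _ _ _ P _ _ mE' (bigcupT_measurable _ mE') (@subset_refl _ _))).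
  apply: (le_trans (lee_nneseries _ (fun n _ => EG' n))) => //.
  rewrite nneseriesZl; last by move=> n _; exact: measure_ge0.
  rewrite -measure_semi_bigcup//; last exact: bigcupT_measurable.
    rewrite -[leRHS]mule1 lee_wpmul2l ?lee_fin// probability_le1//.
    exact: bigcupT_measurable.
  apply/trivIsetP => m n _ _ mn; rewrite /G'.
  case Em : (@pickle_inv C m) => [c|]; last by rewrite set0I.
  case En : (@pickle_inv C n) => [c'|]; last by rewrite setI0.
  apply/seteqP; split=> x // [Gc Gc']; exfalso; move/eqP: mn; apply.
  have cc' := dG _ _ _ Gc Gc'; have := @pickle_invK C m; have := @pickle_invK C n.
  by rewrite Em En /= cc' => -> ->.
- move=> c w Ec; exists (pickle c) => //; rewrite /E' pickleK_inv//.
Qed.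

Lemma sum_indic_le (I J : finType) (alpha : I -> R) (beta : J -> R)
    (B : I -> set Omega) (C : J -> set Omega) (p : I -> R) (q : J -> R) :
  (forall i, 0 <= alpha i) -> (forall j, 0 <= beta j) ->
  (forall i, measurable (B i)) -> (forall j, measurable (C j)) ->
  (forall i, P (B i) = (p i)%:E) -> (forall j, P (C j) = (q j)%:E) ->
  (forall w, \sum_i alpha i * \1_(B i) w <= \sum_j beta j * \1_(C j) w) ->
  \sum_i alpha i * p i <= \sum_j beta j * q j.
Proof.
move=> a0 b0 mB mC pB qC h.
have int (K : finType) (gam : K -> R) (D : K -> set Omega) (s : K -> R) :
    (forall k, 0 <= gam k) -> (forall k, measurable (D k)) -> (forall k, P (D k) = (s k)%:E) ->
    measurable_fun [set: Omega] (fun w => (\sum_k gam k * \1_(D k) w)%:E) /\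
    (\int[P]_w (\sum_k gam k * \1_(D k) w)%:E = (\sum_k gam k * s k)%:E)%E.
  move=> g0 mD sD.
  have mf k : measurable_fun [set: Omega] (fun w => (gam k * \1_(D k) w)%:E).
    apply/measurable_EFinP; apply: measurable_funM; first exact: measurable_cst.
    exact: measurable_indic.
  split.
    apply/measurable_EFinP; apply: measurable_sum => k.
    by apply: measurable_funM; [exact: measurable_cst|exact: measurable_indic].
  under eq_integral => w _ do rewrite -sumEFin.
  rewrite ge0_integral_sum//; last first.
    by move=> k w _; rewrite lee_fin mulr_ge0// indicE.
  rewrite -sumEFin; apply: eq_bigr => k _.
  under eq_integral => w _ do rewrite EFinM.
  rewrite ge0_integralZl//; last 2 first.
  - by apply/measurable_EFinP; exact: measurable_indic.
  - by rewrite lee_fin.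
  by rewrite integral_indic// setIT [X in (_ * X)%E]sD.
have [mL iL] := int _ alpha B p a0 mB pB; have [mR iR] := int _ beta C q b0 mC qC.
rewrite -lee_fin -iL -iR; apply: ge0_le_integral => //.
- by move=> w _; rewrite lee_fin sumr_ge0// => i _; rewrite mulr_ge0// indicE.
- by move=> w _; rewrite lee_fin h.
Qed.

(** Chebyshev for the number [Z] of events that occur, by integrating
    [2 mu Z + mu^2 1_F <= Z^2 + mu^2]: this is [(Z - mu)^2 >= 0] off [F] and an equality on [F],
    where [Z = 0]. *)
Lemma second_moment_bound (I : finType) (A : I -> set Omega) (p : I -> R)
    (q : I * I -> R) : (forall i, measurable (A i)) ->
  (forall i, P (A i) = (p i)%:E) ->
  (forall ij, (P (A ij.1 `&` A ij.2) <= (q ij)%:E)%E) ->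
  0 < \sum_i p i ->
  exists F, [/\ measurable F,
    (P F <= ((\sum_ij q ij - (\sum_i p i) ^+ 2) / (\sum_i p i) ^+ 2)%:E)%E &
    forall w, (forall i, ~ A i w) -> F w].
Proof.
move=> mA pA qA mu0; set mu := \sum_i p i.
pose F := ~` (\big[setU/set0]_i A i).
have mF : measurable F by apply: measurableC; exact: bigsetU_measurable.
exists F; split=> //; last first.
  move=> w nA; apply: (big_ind (fun U : set Omega => ~ U w)) => // U V nU nV []//.
have fF : P F = (fine (P F))%:E by rewrite fineK// fin_num_measure.
pose q' ij := fine (P (A ij.1 `&` A ij.2)).
have mAA ij : measurable (A ij.1 `&` A ij.2) by exact: measurableI.
have qE ij : P (A ij.1 `&` A ij.2) = (q' ij)%:E by rewrite fineK// fin_num_measure.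
have Aw i w : A i w -> ~ F w.
  by move=> Ai; apply; rewrite (bigD1 i)//=; left.
have := @sum_indic_le (I + 'I_1)%type ((I * I) + 'I_1)%type
  (fun o => if o is inl _ then 2 * mu else mu ^+ 2)
  (fun o => if o is inl _ then 1 else mu ^+ 2)
  (fun o => if o is inl i then A i else F)
  (fun o => if o is inl ij then A ij.1 `&` A ij.2 else setT)
  (fun o => if o is inl i then p i else fine (P F))
  (fun o => if o is inl ij then q' ij else 1).
rewrite !big_sumType /= !big_ord1 -mulr_sumr -/mu => H.
have {}H : 2 * mu * mu + mu ^+ 2 * fine (P F) <= \sum_ij 1 * q' ij + mu ^+ 2 * 1.
  apply: H.
  - by case=> [i|_]; rewrite ?mulr_ge0 ?sqr_ge0// ltW.
  - by case=> [ij|_]; rewrite ?sqr_ge0.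
  - by case.
  - by case=> [ij|_].
  - by case.
  - by case=> [ij|_] //; rewrite probability_setT.
  move=> w; rewrite !big_sumType /= !big_ord1.
  have -> : \sum_(ij : I * I) 1 * \1_(A ij.1 `&` A ij.2) w = (\sum_i \1_(A i) w) ^+ 2 :> R.
    rewrite expr2 big_distrlr /= pair_big /=; apply: eq_bigr => -[i j] _.
    by rewrite mul1r indicI.
  rewrite -mulr_sumr; set z := \sum_i _; rewrite [\1_setT w]indicE in_setT mulr1.
  have [Fw|nFw] := pselect (F w).
    have -> : z = 0.
      by apply: big1 => i _; rewrite indicE memNset// => /Aw.
    by rewrite mulr0 add0r expr0n add0r indicE mem_set// mulr1.
  rewrite [\1_F w]indicE memNset// mulr0 addr0 -subr_ge0.
  by rewrite (_ : _ - _ = (z - mu) ^+ 2) ?sqr_ge0//; ring.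
rewrite fF lee_fin ler_pdivlMr ?exprn_gt0//.
have qq' : \sum_ij 1 * q' ij <= \sum_ij q ij.
  by apply: ler_sum => ij _; rewrite mul1r -lee_fin -qE.
move: (\sum_ij 1 * q' ij) (\sum_ij q ij) (fine _) qq' H => a b c ab.
by rewrite expr2; lra.
Qed.

End UnionBounds.

Lemma subset_of_card (T : finType) (B : {set T}) (t : nat) : (t <= #|B|)%N ->
  exists2 J : {set T}, J \subset B & #|J| = t.
Proof.
move=> tB; exists [set x in take t (enum B)].
  by apply/fintype.subsetP => x; rewrite inE => /mem_take; rewrite mem_enum.
by rewrite cardsE (card_uniqP _) ?take_uniq ?enum_uniq// size_takel// -cardE.
Qed.

(** * Independent points: translated patterns and crowded cells *)

Section Iid.
Context {R : realType} {d : nat} (nu : probability (d.-tuple R) R).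
Context {dO : measure_display} {Omega : measurableType dO} (P : probability Omega R).
Context (X : nat -> Omega -> d.-tuple R).
Hypothesis iid : iid_with_law P X nu.
Local Notation Zd := {ffun 'I_d -> int}.

Lemma iid_inter (js : seq nat) (A : nat -> set (d.-tuple R)) :
  uniq js -> (forall j, measurable (A j)) ->
  measurable (\bigcap_(j in [set j | j \in js]) X j @^-1` A j) /\
  P (\bigcap_(j in [set j | j \in js]) X j @^-1` A j) = (\prod_(j <- js) fine (nu (A j)))%:E.
Proof.
have [mX [lawX indep]] := iid; move=> ujs mA; split.
  apply: fin_bigcap_measurable => [|j _]; first exact: finite_seq.
  by rewrite -[X in measurable X]setTI; exact: mX.
rewrite indep// -prodEFin; apply: eq_bigr => j _.
by rewrite lawX// fineK// fin_num_measure.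
Qed.

Definition gridcell (s : R) (c : Zd) : set (d.-tuple R) := box (fun i => (c i)%:~R * s) s.

Lemma mem_gridcell s (c : Zd) x : 0 < s ->
  gridcell s c x <-> forall i, Num.floor (tnth x i / s) = c i.
Proof.
move=> s0; split=> H i.
  apply: floor_def; have /andP[lo hi] := H i; rewrite ler_pdivlMr// lo /=.
  by rewrite ltr_pdivrMr// intrD mulrDl mul1r.
rewrite -H -[X in _ < _ + X]mul1r -mulrDl -[1]/(1%:~R) -intrD.
by rewrite -ler_pdivlMr// -ltr_pdivrMr// floor_itv.
Qed.

Lemma measurable_gridcell s c : measurable (gridcell s c).
Proof. exact: measurable_box. Qed.

Section Pattern.
Context {M : R} (M_ge0 : 0 <= M).
Hypothesis density : forall a s, 0 <= s -> (nu (box a s) <= (M * s ^+ d)%:E)%E.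
Context {K : nat} (Q : {set {ffun 'I_d -> 'I_K}}) (s : R).
Hypothesis s_gt0 : 0 < s.
Local Notation C := {ffun 'I_d -> 'I_K}.

Definition shift_cell (w : 'I_d -> int) (q : C) : Zd := [ffun i => w i + (q i)%:Z].

Definition in_pattern (w : 'I_d -> int) (x : d.-tuple R) : bool :=
  [exists q in Q, forall i, Num.floor (tnth x i / s) == w i + (q i)%:Z].

Definition pattern (w : 'I_d -> int) : set (d.-tuple R) := [set x | in_pattern w x].

Let patternE w : pattern w = \big[setU/set0]_(q in Q) gridcell s (shift_cell w q).
Proof.
apply/seteqP; split=> x.
  move=> /existsP[q /andP[qQ /forallP xq]]; rewrite (bigD1 q)//; left.
  by apply/(mem_gridcell _ _ s_gt0) => i; rewrite ffunE; exact/eqP.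
apply: (big_ind (fun U : set _ => U x -> pattern w x)) => // [U V HU HV [/HU|/HV]//|q qQ].
move=> /(mem_gridcell _ _ s_gt0) xq; apply/existsP; exists q; rewrite qQ.
by apply/forallP => i; rewrite xq ffunE.
Qed.

Lemma measurable_pattern w : measurable (pattern w).
Proof. by rewrite patternE; apply: bigsetU_measurable => q _; exact: measurable_gridcell. Qed.

Lemma pattern_le w : fine (nu (pattern w)) <= #|Q|%:R * (M * s ^+ d).
Proof.
have [|F [mF Fle QF]] := @union_bound _ _ _ nu _ (mem Q)
    (fun q => gridcell s (shift_cell w q)) (fun=> M * s ^+ d) (fun q _ => measurable_gridcell _ _).
  by move=> q _; apply: density; exact: ltW.
rewrite -lee_fin fineK ?fin_num_measure//; last exact: measurable_pattern.
rewrite mulr_natl -sumr_const (le_trans _ Fle)// le_measure ?inE//.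
  exact: measurable_pattern.
move=> x /existsP[q /andP[qQ /forallP xq]]; apply: (QF q) => //.
by apply/(mem_gridcell _ _ s_gt0) => i; rewrite ffunE; exact/eqP.
Qed.

(* Points in a common translate of the pattern are charged to the cell of one of
   them: the sum over cells of that point's probability is 1, so the infinitely many
   positions [w] cost nothing. *)
Lemma pattern_union_bound (n t : nat) : (0 < t)%N ->
  exists F, [/\ measurable F,
    (P F <= ('C(n, t)%:R * (#|Q|%:R * (#|Q|%:R * (M * s ^+ d)) ^+ t.-1))%:E)%E &
    forall om, ~ F om -> forall w : 'I_d -> int,
      (#|[set j : 'I_n | in_pattern w (X j om)]%SET| < t)%N].
Proof.
move=> t0; set p := #|Q|%:R * (M * s ^+ d).
have p0 : 0 <= p by rewrite !mulr_ge0// exprn_ge0// ltW.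
pose j0 (J : {set 'I_n}) : nat := if [pick j in J] is Some j then j else 0.
have j0P (J : {set 'I_n}) : (0 < #|J|)%N -> exists2 j, j \in J & j0 J = j.
  rewrite /j0; case: pickP => [j jJ _|J0]; first by exists j.
  by rewrite card_gt0 => /set0Pn[j]; rewrite J0.
(* The charged index [j0 J] occupies cell [c], at place [q] of the pattern; this fixes the translate
   in which the other points must lie. *)
pose A (J : {set 'I_n}) (q : C) (c : Zd) (j : nat) :=
  if j == j0 J then gridcell s c else pattern (fun i => c i - (q i)%:Z).
pose js (J : {set 'I_n}) : seq nat := map val (enum J).
pose E J q c := \bigcap_(j in [set j | j \in js J]) X j @^-1` A J q c j.
have mA J q c j : measurable (A J q c j).
  by rewrite /A; case: ifP => _; [exact: measurable_gridcell|exact: measurable_pattern].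
have ujs J : uniq (js J) by rewrite map_inj_uniq ?enum_uniq//; exact: val_inj.
have step (Jq : {set 'I_n} * C) : #|Jq.1| = t -> exists F, [/\ measurable F,
    (P F <= (p ^+ t.-1)%:E)%E & forall c om, E Jq.1 Jq.2 c om -> F om].
  case: Jq => J q /= Jt.
  apply: (@countable_union_bound _ _ _ _ _ _ _ nu (E J q) (gridcell s)); first exact: exprn_ge0.
  - by move=> c; have [] := iid_inter (ujs J) (mA J q c).
  - exact: measurable_gridcell.
  - move=> c c' x /(mem_gridcell _ _ s_gt0) xc /(mem_gridcell _ _ s_gt0) xc'.
    by apply/ffunP => i; rewrite -xc -xc'.
  - move=> c; have [_ ->] := iid_inter (ujs J) (mA J q c).
    have cfin : nu (gridcell s c) = (fine (nu (gridcell s c)))%:E.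
      by rewrite fineK// fin_num_measure//; exact: measurable_gridcell.
    rewrite cfin -EFinM lee_fin big_map big_enum /=.
    have [|j jJ j0j] := j0P J; first by rewrite Jt.
    rewrite (bigD1 j)//= {1}/A j0j eqxx mulrC ler_wpM2r ?fine_ge0//.
    rewrite (eq_bigr (fun=> fine (nu (pattern (fun i => c i - (q i)%:Z))))); last first.
      move=> i /andP[_ ij]; rewrite /A j0j ifF//.
      by apply/negbTE; apply: contra ij => /eqP/val_inj ->.
    rewrite prodr_const (_ : #|_| = t.-1); last first.
      by rewrite -Jt (cardsD1 j J) jJ add1n /=; apply: eq_card => i; rewrite !inE andbC.
    by rewrite lerXn2r ?nnegrE ?fine_ge0// pattern_le.
have /choice[F FP] (Jq : {set 'I_n} * C) : exists F, #|Jq.1| = t -> [/\ measurable F,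
    (P F <= (p ^+ t.-1)%:E)%E & forall c om, E Jq.1 Jq.2 c om -> F om].
  have [/step[F HF]|Jt] := pselect (#|Jq.1| = t); first by exists F.
  by exists set0.
have [||F' [mF' F'le F'P]] := @union_bound _ _ _ P _
    (fun Jq : {set 'I_n} * C => (#|Jq.1| == t) && (Jq.2 \in Q)) F (fun=> p ^+ t.-1).
- by move=> Jq /andP[/eqP/FP[]].
- by move=> Jq /andP[/eqP/FP[]].
exists F'; split=> //.
  apply: (le_trans F'le); rewrite lee_fin -(pair_big (fun J : {set 'I_n} => #|J| == t) (mem Q)
    (fun _ _ => p ^+ t.-1)) /= sumr_const sumr_const -(mulr_natl (p ^+ t.-1)) -(mulr_natl (_ * _)).
  have -> : 'C(n, t) = #|[pred J : {set 'I_n} | #|J| == t]|.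
    by rewrite -[X in 'C(X, t)](card_ord n) -card_draws cardsE.
  exact: lexx.
move=> om nF' w; rewrite ltnNge; apply/negP => /subset_of_card[J JB Jt]; apply: nF'.
have [|j jJ j0j] := j0P J; first by rewrite Jt.
have := fintype.subsetP JB _ jJ; rewrite inE => /existsP[q /andP[qQ /forallP jq]].
apply: (F'P (J, q)); first by rewrite /= Jt eqxx.
have [_ _ H] := FP (J, q) Jt; apply: (H (shift_cell w q)) => /= k /= /mapP[i].
rewrite mem_enum => iJ -> /=; rewrite /A; case: ifPn => [|_].
  rewrite j0j => /eqP/val_inj ->; apply/(mem_gridcell _ _ s_gt0) => l.
  by rewrite ffunE; exact/eqP.
have := fintype.subsetP JB _ iJ; rewrite inE /pattern /=; congr (is_true (in_pattern _ _)).
by apply/funext => l; rewrite ffunE addrK.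
Qed.

End Pattern.

(* Second moment method: the index set is cut into [K] blocks of length [b], and we
   count the pairs of a cell and a choice of one index per block falling into it. *)
Section CrowdedCell.
Context {S : finType} (cell : S -> Zd) (s : R) {K b : nat}.
Hypothesis s_gt0 : 0 < s.
Hypothesis cell_inj : injective cell.
Local Notation F := {ffun 'I_K -> 'I_b}.
Let p (c : S) : R := fine (nu (gridcell s (cell c))).
Let p_ge0 c : 0 <= p c. Proof. exact: fine_ge0. Qed.

Let idx (k : 'I_K) (i : 'I_b) : nat := (k * b + i)%N.

Let idx_inj k k' i i' : idx k i = idx k' i' -> k = k' /\ i = i'.
Proof.
move=> /[dup] /(congr1 (divn^~ b)) + /(congr1 (modn^~ b)).
have b0 : (0 < b)%N by apply: leq_ltn_trans (ltn_ord i).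
rewrite /idx !divnMDl// !modnMDl !divn_small ?modn_small// !addn0 => /val_inj -> /val_inj ->.
by [].
Qed.

Let idxs (f : F) : seq nat := [seq idx k (f k) | k <- enum 'I_K].

Let mem_idxs k i f : (idx k i \in idxs f) = (i == f k).
Proof.
apply/mapP/eqP => [[k' _ /idx_inj[-> ->]]//|->]; exists k => //; exact: mem_enum.
Qed.

Let uniq_idxs f : uniq (idxs f).
Proof. by rewrite map_inj_uniq ?enum_uniq// => k k' /idx_inj[]. Qed.

Let A (cf : S * F) : set Omega :=
  \bigcap_(j in [set j | j \in idxs cf.2]) X j @^-1` gridcell s (cell cf.1).

Let measurable_A cf : measurable (A cf).
Proof. by have [] := iid_inter (uniq_idxs cf.2) (fun=> measurable_gridcell s (cell cf.1)). Qed.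

Let prob_A cf : P (A cf) = (p cf.1 ^+ K)%:E.
Proof.
have [_ ->] := iid_inter (uniq_idxs cf.2) (fun=> measurable_gridcell s (cell cf.1)).
by rewrite big_map big_enum prodr_const card_ord.
Qed.

(** Factor of one block in the joint probability: the two choices concern either the same point,
    which lies in one cell only, or two independent points. *)
Let g (c c' : S) (i i' : 'I_b) : R :=
  if i == i' then (if c == c' then p c else 0) else p c * p c'.

Let g_ge0 c c' i i' : 0 <= g c c' i i'.
Proof. by rewrite /g; do 2?case: ifP; rewrite ?mulr_ge0. Qed.

Let prob_A2 (cf : (S * F) * (S * F)) :
  (P (A cf.1 `&` A cf.2) <= (\prod_k g cf.1.1 cf.2.1 (cf.1.2 k) (cf.2.2 k))%:E)%E.
Proof.
case: cf => -[c f] [c' f'] /=.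
have [agree|noagree] := pselect (c != c' /\ exists k, f k = f' k).
  rewrite (_ : A (c, f) `&` A (c', f') = set0) ?measure0 ?lee_fin ?prodr_ge0//.
  apply/seteqP; split=> om // [Ac Ac']; have [cc' [k fk]] := agree.
  have /(mem_gridcell _ _ s_gt0) xc : gridcell s (cell c) (X (idx k (f k)) om).
    by apply: Ac => /=; rewrite mem_idxs.
  have /(mem_gridcell _ _ s_gt0) xc' : gridcell s (cell c') (X (idx k (f k)) om).
    by apply: Ac' => /=; rewrite mem_idxs fk.
  by move/eqP: cc'; apply; apply: cell_inj; apply/ffunP => i; rewrite -xc -xc'.
pose js := [seq idx k i | k <- enum 'I_K, i <- undup [:: f k; f' k]].
have ujs : uniq js.
  apply: allpairs_uniq_dep => [|k _|]; rewrite ?enum_uniq ?undup_uniq//.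
  by move=> [k i] [k' i'] _ _ /= /idx_inj[-> ->].
pose B j := if j \in idxs f then gridcell s (cell c) else gridcell s (cell c').
have mB j : measurable (B j) by rewrite /B; case: ifP => _; exact: measurable_gridcell.
have [mAB PAB] := iid_inter ujs mB.
have sub : A (c, f) `&` A (c', f') `<=` \bigcap_(j in [set j | j \in js]) X j @^-1` B j.
  move=> om [Af Af'] j /= /allpairsPdep[k [i [_ + ->]]].
  rewrite mem_undup !inE /B mem_idxs => ki; case: ifPn => [/eqP ->|nif].
    by apply: Af => /=; rewrite mem_idxs.
  by move: ki; rewrite (negbTE nif) => /eqP ->; apply: Af' => /=; rewrite mem_idxs.
apply: (le_trans (le_measure P _ _ sub)); rewrite ?inE//; first exact: measurableI.
rewrite [leLHS]PAB lee_fin big_allpairs_dep big_enum /=.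
rewrite le_eqVlt; apply/orP; left; apply/eqP/eq_bigr => k _.
have Bf : fine (nu (B (idx k (f k)))) = p c by rewrite /B mem_idxs eqxx.
rewrite /g; case: eqVneq => [ff|nff].
  have -> : c == c'.
    by apply: contrapT => /negP cc'; apply: noagree; split=> //; exists k.
  by rewrite /= inE ff eqxx /= big_seq1 -ff.
rewrite /= inE (negbTE nff) /= !big_cons big_nil mulr1 Bf; congr (_ * _).
by rewrite /B mem_idxs eq_sym (negbTE nff).
Qed.

Let sum_g c c' : \sum_i \sum_i' g c c' i i' <=
  (if c == c' then b%:R * p c else 0) + (b%:R * p c) * (b%:R * p c').
Proof.
have row (i : 'I_b) : \sum_i' g c c' i i' <= (if c == c' then p c else 0) + b%:R * (p c * p c').
  rewrite (bigD1 i)//= {1}/g eqxx lerD2l.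
  rewrite (eq_bigr (fun=> p c * p c')) => [|i' ii']; last by rewrite /g eq_sym (negbTE ii').
  rewrite sumr_const mulr_natl ler_wpMn2l ?mulr_ge0//.
  by rewrite (leq_trans (max_card _))// card_ord.
apply: (le_trans (ler_sum _ (fun i _ => row i))).
rewrite sumr_const card_ord -[leLHS]mulr_natl mulrDr.
have -> : b%:R * (b%:R * (p c * p c')) = b%:R * p c * (b%:R * p c') by ring.
by rewrite lerD2r; case: ifP; rewrite ?mulr0.
Qed.

(** With one index per block, sums over choices factor into [K]-th powers, for the second moment as
    for the first, and overlaps need not be counted. *)
Lemma crowded_cell (n : nat) (D : R) : (K * b <= n)%N ->
  (forall c, b%:R * p c <= D) -> 0 < \sum_c (b%:R * p c) ^+ K ->
  exists E, [/\ measurable E,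
    (P E <= ((1 + D) ^+ K / \sum_c (b%:R * p c) ^+ K)%:E)%E &
    forall om, ~ E om -> exists c,
      (K <= #|[set j : 'I_n | [forall i, Num.floor (tnth (X j om) i / s) == cell c i]]%SET|)%N].
Proof.
move=> Kbn bD; set mu := \sum_c _ => mu0.
have muE : \sum_(cf : S * F) p cf.1 ^+ K = mu.
  rewrite -(pair_bigA _ (fun c (f : F) => p c ^+ K)) /=; apply: eq_bigr => c _.
  by rewrite sumr_const card_ffun !card_ord exprMn -natrX mulr_natl.
have [|E [mE PE EP]] := second_moment_bound measurable_A prob_A prob_A2.
  by rewrite muE.
exists E; split=> //; last first.
  move=> om nE; have [[c f] Acf] : exists cf, A cf om.
    by apply: contrapT => noA; apply: nE; apply: EP => cf Acf; apply: noA; exists cf.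
  exists c.
  have ltn k : (idx k (f k) < n)%N.
    apply: leq_trans Kbn; apply: (@leq_trans (k.+1 * b)); last by rewrite leq_mul2r ltn_ord orbT.
    by rewrite mulSnr ltn_add2l.
  rewrite -[X in (X <= _)%N]card_ord -(@card_imset _ _ (fun k : 'I_K => Ordinal (ltn k))); last first.
    by move=> k k' /(congr1 val)/= /idx_inj[].
  apply/subset_leq_card/fintype.subsetP => _ /imsetP[k _ ->]; rewrite inE.
  have /(mem_gridcell _ _ s_gt0) xc : gridcell s (cell c) (X (idx k (f k)) om).
    by apply: Acf => /=; rewrite mem_idxs.
  by apply/forallP => i; rewrite xc.
apply: (le_trans PE); rewrite lee_fin muE.
rewrite ler_pdivrMr ?exprn_gt0//.
have -> : (1 + D) ^+ K / mu * mu ^+ 2 = (1 + D) ^+ K * mu.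
  by rewrite expr2 mulrA divfK ?lt0r_neq0.
rewrite lerBlDr expr2.
have D0 c : 0 <= b%:R * p c by rewrite mulr_ge0.
have pairs : \sum_(ij : (S * F) * (S * F)) \prod_k g ij.1.1 ij.2.1 (ij.1.2 k) (ij.2.2 k) =
    \sum_c \sum_c' (\sum_i \sum_i' g c c' i i') ^+ K.
  rewrite -(pair_bigA _ (fun cf cf' : S * F => \prod_k g cf.1 cf'.1 (cf.2 k) (cf'.2 k))) /=.
  rewrite -(pair_bigA _ (fun (c : S) (f : F) => \sum_(cf' : S * F) \prod_k g c cf'.1 (f k) (cf'.2 k))) /=.
  apply: eq_bigr => c _.
  under eq_bigr => f _ do rewrite -(pair_bigA _ (fun (c' : S) (f' : F) => \prod_k g c c' (f k) (f' k))) /=.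
  rewrite exchange_big /=; apply: eq_bigr => c' _.
  rewrite -[in RHS](card_ord K) -prodr_const bigA_distr_bigA /=; apply: eq_bigr => f _.
  by rewrite bigA_distr_bigA.
(* The products for all pairs of cells sum to [mu ^+ 2], which cancels; the diagonal excess is at
   most [(1 + D) ^+ K * mu], since [b p + (b p)^2 <= (1 + D) b p]. *)
rewrite pairs; apply: (@le_trans _ _ (\sum_c \sum_c' ((if c == c' then (1 + D) ^+ K * (b%:R * p c) ^+ K else 0)
   + (b%:R * p c) ^+ K * (b%:R * p c') ^+ K))).
  apply: ler_sum => c _; apply: ler_sum => c' _.
  apply: (@le_trans _ _ (((if c == c' then b%:R * p c else 0) + (b%:R * p c) * (b%:R * p c')) ^+ K)).
    rewrite lerXn2r ?nnegrE ?sum_g// ?sumr_ge0// => [i _|]; first by rewrite sumr_ge0.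
    by rewrite addr_ge0 ?mulr_ge0//; case: ifP.
  case: eqVneq => [<-|_]; last by rewrite !add0r exprMn.
  rewrite -[X in X + _]mulr1 -mulrDr exprMn mulrC.
  rewrite (le_trans _ (ler_wpDr _ (lexx _)))// ?mulr_ge0 ?exprn_ge0//.
  by rewrite ler_wpM2r ?exprn_ge0// lerXn2r ?nnegrE ?lerD2l// addr_ge0// (le_trans (D0 c)).
under eq_bigr => c _ do rewrite big_split /= -big_mkcond /= (big_pred1 c)//= -mulr_sumr -/mu.
by rewrite big_split /= -mulr_sumr -mulr_suml -/mu.
Qed.

End CrowdedCell.

End Iid.

(** * A fixed cube carrying most of the mass *)

Section BoundedBox.
Context {R : realType} {d : nat} (nu : probability (d.-tuple R) R).

Definition centered_box (b : nat) : set (d.-tuple R) := box (fun=> - b%:R) (2 * b%:R).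

Lemma mem_centered_box b x : centered_box b x <-> forall i, - b%:R <= tnth x i < b%:R.
Proof.
by split=> H i; have := H i; rewrite (_ : - b%:R + 2 * b%:R = b%:R :> R)//; ring.
Qed.

(** Continuity from below. The value [8^-1] makes the union bound over at most [2 ^ n] index sets,
    each of at least three quarters of the indices, come out below [2 ^- n]. *)
Lemma centered_box_large : exists b : nat, fine (nu (~` centered_box b)) <= 8%:R^-1.
Proof.
have mB b : measurable (centered_box b) by exact: measurable_box.
have UB : \bigcup_b centered_box b = setT.
  apply/seteqP; split=> // x _.
  pose b := \max_(i < d) (Num.truncn `|tnth x i|).+1; exists b => //.
  apply/mem_centered_box => i.
  have : `|tnth x i| < b%:R.
    by apply: (lt_le_trans (truncnS_gt _)); rewrite ler_nat /b (leq_bigmax i).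
  by rewrite ltr_norml => /andP[/ltW -> ->].
have [b Bb] : exists b, ((7%:R / 8%:R)%:E < nu (centered_box b))%E.
  apply: contrapT => noB.
  have Ble b : (nu (centered_box b) <= (7%:R / 8%:R)%:E)%E.
    by rewrite leNgt; apply/negP => h; apply: noB; exists b.
  have mono : nondecreasing_seq centered_box.
    move=> b b' bb'; apply/subsetPset => x /mem_centered_box xb; apply/mem_centered_box => i.
    have /andP[lo hi] := xb i; rewrite (lt_le_trans hi) ?ler_nat// andbT.
    by rewrite (le_trans _ lo)// lerN2 ler_nat.
  have cv : nu (centered_box b) @[b --> \oo] --> nu (\bigcup_b centered_box b).
    by apply: nondecreasing_cvg_mu => //; exact: bigcupT_measurable.
  have : ((1 : R)%:E <= (7%:R / 8%:R)%:E)%E.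
    rewrite -(probability_setT nu) -UB -(cvg_lim _ cv)//; apply: lime_le; first exact: cvgP cv.
    exact: nearW.
  by rewrite lee_fin ler_pdivlMr// mul1r ler_nat ltnn.
exists b; rewrite -lee_fin fineK ?fin_num_measure//; last exact: measurableC.
rewrite probability_setC// -[nu _]fineK ?fin_num_measure// -EFinB lee_fin.
by move: Bb; rewrite -[nu _]fineK ?fin_num_measure// lte_fin; lra.
Qed.

Context {dO : measure_display} {Omega : measurableType dO} (P : probability Omega R).
Context (X : nat -> Omega -> d.-tuple R).
Hypothesis iid : iid_with_law P X nu.

Lemma many_in_centered_box : exists b : nat, forall n, exists F, [/\ measurable F,
    (P F <= (2%:R ^- n)%:E)%E &
    forall om, ~ F om ->
      (n <= 4 * #|[set j : 'I_n | [forall i, (- b%:R <= tnth (X j om) i < b%:R)%R]]%SET|)%N].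
Proof.
have [b nub] := centered_box_large; exists b => n.
pose B := ~` centered_box b; pose t := (n - n %/ 4)%N.
have mB : measurable B by apply: measurableC; exact: measurable_box.
pose E (J : {set 'I_n}) := \bigcap_(j in [set j | j \in map val (enum J)]) X j @^-1` B.
have uJ (J : {set 'I_n}) : uniq (map val (enum J)).
  by rewrite map_inj_uniq ?enum_uniq//; exact: val_inj.
have [||F [mF FP FE]] := @union_bound _ _ _ P _ (fun J : {set 'I_n} => #|J| == t) E (fun=> 8%:R ^- t).
- by move=> J _; have [] := iid_inter iid (uJ J) (fun=> mB).
- move=> J /eqP <-; have [_ ->] := iid_inter iid (uJ J) (fun=> mB).
  rewrite lee_fin big_map big_enum prodr_const -exprVn lerXn2r// nnegrE ?fine_ge0//.
exists F; split=> //.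
  apply: (le_trans FP); rewrite lee_fin sumr_const.
  rewrite -[leLHS]mulr_natl ler_pdivrMr ?exprn_gt0// mulrC ler_pdivlMr ?exprn_gt0//.
  apply: (@le_trans _ _ ((2 ^ n)%:R * 2%:R ^+ n)).
    rewrite ler_wpM2r ?exprn_ge0// ler_nat (leq_trans (max_card _))//.
    by rewrite -cardsT -powersetT card_powerset cardsT card_ord.
  rewrite -natrX -natrX -natrM ler_nat -expnD (_ : 8 = 2 ^ 3)%N// -expnM leq_exp2l//.
  by rewrite /t; lia.
move=> om nF; rewrite leqNgt; apply/negP => few; apply: nF.
set G := [set j : 'I_n | _]%SET in few.
have : (t <= #|~: G|)%N by have := cardsC G; rewrite card_ord /t; lia.
move=> /subset_of_card[J JG Jt]; apply: (FE J); first by rewrite Jt.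
move=> /= j /mapP[i]; rewrite mem_enum => iJ -> /mem_centered_box Xb.
have := fintype.subsetP JG _ iJ; rewrite !inE => /negP; apply.
by apply/forallP => k; exact: Xb.
Qed.

End BoundedBox.

(** Stated for events with measurable covers and for bounded partial sums, the form in which the
    estimates arrive. *)
Lemma borel_cantelli_cover {dO : measure_display} {Omega : measurableType dO}
    {R : realType} (P : probability Omega R) (A : nat -> set Omega) (f : nat -> R) (c : R) :
  (forall n, exists F, [/\ measurable F, (P F <= (f n)%:E)%E & A n `<=` F]) ->
  (forall n, \sum_(i < n) f i <= c) ->
  {ae P, forall om, exists n0, forall n, (n0 <= n)%N -> ~ A n om}.
Proof.
move=> /choice[F FP] fc.
have mF n : measurable (F n) by have [] := FP n.
have PF n : (P (F n) <= (f n)%:E)%E by have [] := FP n.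
exists (lim_sup_set F); split.
- by apply: bigcapT_measurable => n; exact: bigcup_measurable.
- apply: lim_sup_set_cvg0 => //; apply: (@le_lt_trans _ _ c%:E); last by rewrite ltry.
  apply: lime_le; first by apply: is_cvg_nneseries => n _ _; exact: measure_ge0.
  apply: nearW => n; rewrite (le_trans (lee_sum _ (fun i _ => PF i)))// sumEFin lee_fin.
  by rewrite big_mkord.
- move=> om nex; apply: contrapT => nlim; apply: nex.
  have [n0 n0P] : exists n0, forall n, (n0 <= n)%N -> ~ F n om.
    apply: contrapT => no; apply: nlim => n _.
    apply: contrapT => nU; apply: no; exists n => k nk Fk; apply: nU.
    by exists k.
  by exists n0 => n nn An; apply: (n0P n nn); have [_ _] := FP n; apply.
Qed.

(** * The dense case *)

(** A crude Stirling bound: all [t] factors of the falling factorial of [2 * t] exceed [t], and it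
    equals [t!] times a central binomial coefficient. *)
Lemma expn_le_fact (t : nat) : (t.+1 ^ t <= 4 ^ t * t`!)%N.
Proof.
have h : (t.+1 ^ t <= (2 * t) ^_ t)%N.
  rewrite ffact_prod -[X in (_ ^ X <= _)%N]card_ord -prod_nat_const leq_prod// => i _.
  by have := ltn_ord i; lia.
rewrite (leq_trans h)// -bin_ffact leq_mul2r; apply/orP; right.
have -> : (4 ^ t = 2 ^ (2 * t))%N by rewrite expnM.
have tt : (t < (2 * t).+1)%N by lia.
rewrite -[2%N]/(1 + 1)%N expnDn (bigD1 (Ordinal tt))//= !exp1n !muln1 leq_addr//.
Qed.

Lemma bin_le_expn (n t : nat) : ('C(n, t) * t`! <= n ^ t)%N.
Proof.
rewrite bin_ffact ffact_prod -[X in (_ <= _ ^ X)%N](card_ord t) -prod_nat_const leq_prod// => i _.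
exact: leq_subr.
Qed.

(** One point costs [n], and every further one about [n p / (t + 1)] up to the factor 4: geometric
    decay once the threshold is a large multiple of the mean. *)
Lemma bin_expX_le (R : realFieldType) (n t : nat) (p th : R) : 0 <= p -> 0 <= th ->
  n%:R * p <= th * t.+1%:R -> 'C(n, t.+1)%:R * p ^+ t <= n%:R * (4%:R * th) ^+ t.
Proof.
move=> p0 th0 np.
have f0 : 0 < t.+1`!%:R :> R by rewrite ltr0n fact_gt0.
rewrite -(ler_pM2l f0) mulrA -natrM mulnC.
apply: (@le_trans _ _ ((n ^ t.+1)%:R * p ^+ t)).
  by rewrite ler_wpM2r ?exprn_ge0// ler_nat bin_le_expn.
rewrite expnS natrM -mulrA natrX -exprMn.
rewrite [leRHS]mulrCA ler_wpM2l//.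
apply: (@le_trans _ _ ((th * t.+1%:R) ^+ t)).
  by rewrite lerXn2r ?nnegrE ?mulr_ge0.
rewrite !exprMn [4%:R ^+ t * _]mulrC [leRHS]mulrCA ler_wpM2l ?exprn_ge0//.
rewrite -!natrX -natrM ler_nat (leq_trans (expn_le_fact t))// mulnC leq_mul2r factS.
by rewrite leq_pmull ?orbT.
Qed.

Lemma inv_square_sum_le (R : realFieldType) (n : nat) :
  \sum_(i < n) (i.+1 * i.+2)%:R^-1 <= 1 :> R.
Proof.
suff -> : \sum_(i < n) (i.+1 * i.+2)%:R^-1 = 1 - n.+1%:R^-1 :> R by rewrite gerBl invr_ge0.
elim: n => [|n IH]; first by rewrite big_ord0 invr1 subrr.
rewrite big_ord_recr /= IH natrM -[n.+2%:R]natr1; field.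
by rewrite [1 + n%:R]addrC !natr1 !pnatr_eq0.
Qed.

(** The power of 2 is at most [16 / n^4], and [(n + 1)(n + 2) <= 6 n^2]; hence 96, and a right-hand
    side whose sum telescopes. *)
Lemma trunc_log_inv_le (R : realFieldType) (n : nat) : (0 < n)%N ->
  n%:R * 2%:R ^- (4 * trunc_log 2 n) <= 96%:R / (n.+1 * n.+2)%:R :> R.
Proof.
move=> n0; set i := trunc_log 2 n.
have ni : (n < 2 ^ i.+1)%N by apply: trunc_log_ltn.
have i0 : 0 < 2%:R ^+ (4 * i) :> R by rewrite exprn_gt0.
rewrite ler_pdivrMr// mulrAC ler_pdivlMr ?ltr0n// -natrX -!natrM ler_nat.
have h : (n ^ 4 <= 16 * 2 ^ (4 * i))%N.
  rewrite (_ : 16 = 2 ^ 4)%N// -expnD -mulnS mulnC expnM leq_exp2r//; exact: ltnW.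
have q : (n * (n.+1 * n.+2) <= 6 * n ^ 4)%N.
  have : (n.+1 * n.+2 <= 6 * n ^ 2)%N by rewrite -mulnn; nia.
  have : (n ^ 3 <= n ^ 4)%N by rewrite leq_pexp2l.
  have -> : (n ^ 3 = n * n ^ 2)%N by rewrite expnS.
  by move: (n ^ 4)%N (n ^ 2)%N => a b; nia.
by rewrite (leq_trans q)//; move: h; lia.
Qed.

Section Dense.
Context {R : realType} {d : nat} (N : d.-tuple R -> R) (C1 C2 M : R).
Hypotheses (C1_gt0 : 0 < C1) (C2_gt0 : 0 < C2) (M_ge0 : 0 <= M).
Hypothesis norm_perturb : forall (lambda b : R) (x y : d.-tuple R), 0 <= lambda ->
  (forall i, `|lambda * tnth x i - tnth y i| <= b) -> lambda * N x <= N y + C1 * b.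
Hypothesis norm_small : forall (b : R) (x : d.-tuple R),
  (forall i, `|tnth x i| <= b) -> N x <= C1 * b.
Hypothesis norm_coord : forall (x : d.-tuple R) i, `|tnth x i| <= C2 * N x.
Context (nu : probability (d.-tuple R) R).
Hypothesis density : forall a s, 0 <= s -> (nu (box a s) <= (M * s ^+ d)%:E)%E.
Context {dO : measure_display} {Omega : measurableType dO} (P : probability Omega R).
Context (X : nat -> Omega -> d.-tuple R) (r : nat -> R).
Hypothesis iid : iid_with_law P X nu.
Hypotheses (r_gt0 : forall n, 0 < r n) (r_to0 : r @ \oo --> 0).

Local Notation G n om := (rgg_adj N (fun i => X i om) (r n) n).

(** A fixed cube holds a quarter of the points and is covered by order [r n ^- d] cliques. *)
Lemma feasible_ge_scale (b n : nat) (om : Omega) (x : {set 'I_n} -> R) : r n <= 1 ->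
  (n <= 4 * #|[set j : 'I_n | [forall i, (- b%:R <= tnth (X j om) i < b%:R)%R]]%SET|)%N ->
  frac_coloring_feasible (G n om) x ->
  (4%:R * (2 * b%:R * C1 + 1) ^+ d)^-1 * (n%:R * r n ^+ d) <= \sum_(S | stableb (G n om) S) x S.
Proof.
move=> r1 nB xf; have rn := r_gt0 n.
(* With [K = 1] and [g = 2 * b / r n] the whole cube is a single window. *)
have := window_card_le (2 * b%:R / r n) (fun=> - b%:R) (K := 1) C1_gt0 rn norm_small xf.
set Phi := \sum_(S | _) x S; set W := window _ _ _ _ => WP.
have BW : [set j : 'I_n | [forall i, (- b%:R <= tnth (X j om) i < b%:R)%R]]%SET = W.
  apply/setP => j; rewrite !inE; apply: eq_forallb => i.
  rewrite divfK ?lt0r_neq0// mul1r opprK; apply/andP/andP => -[h1 h2]; split; lra.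
rewrite BW in nB.
have Phi0 : 0 <= Phi := feasible_total_ge0 xf.
have side : (Num.truncn (1%:R * (2 * b%:R / r n) * C1)).+1%:R <= (2 * b%:R * C1 + 1) / r n.
  rewrite -[leLHS]natr1 [leRHS]mulrDl lerD//; last by rewrite ler_pdivlMr// mul1r.
  rewrite mul1r (_ : 2 * b%:R * C1 / r n = 2 * b%:R / r n * C1); last by rewrite mulrAC.
  by rewrite truncn_le mulr_ge0 ?divr_ge0 ?mulr_ge0 ?(ltW rn)// ltW.
have q0 : 0 < 2 * b%:R * C1 + 1 by rewrite ltr_wpDl// !mulr_ge0// ltW.
rewrite mulrC ler_pdivrMr ?mulr_gt0 ?exprn_gt0//.
apply: (@le_trans _ _ (4%:R * #|W|%:R * r n ^+ d)).
  by rewrite ler_wpM2r ?exprn_ge0 ?(ltW rn)// -natrM ler_nat.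
set A := Num.truncn _ in WP side.
have Aq : (A.+1 ^ d)%:R * r n ^+ d <= (2 * b%:R * C1 + 1) ^+ d.
  rewrite natrX -exprMn lerXn2r ?nnegrE ?mulr_ge0 ?(ltW rn) ?(ltW q0)//.
  by rewrite -ler_pdivlMr.
apply: (@le_trans _ _ ((A.+1 ^ d)%:R * r n ^+ d * (4%:R * Phi))).
  rewrite (_ : _ * (4%:R * Phi) = 4%:R * ((A.+1 ^ d)%:R * Phi) * r n ^+ d); last by ring.
  by rewrite ler_wpM2r ?exprn_ge0 ?(ltW rn)// ler_wpM2l.
rewrite [leRHS](_ : _ = (2 * b%:R * C1 + 1) ^+ d * (4%:R * Phi)); last by ring.
by rewrite ler_wpM2r ?mulr_ge0.
Qed.

Lemma dense_ae (eps : R) (D : nat) : 0 < eps -> (0 < D)%N ->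
  {ae P, forall om, exists n0, forall n, (n0 <= n)%N -> forall K : {set 'I_n},
    cliqueb (G n om) K -> (trunc_log 2 n <= D * #|K|)%N ->
    (chromatic_number (G n om))%:R <=
      ((1 + eps) * (1 + 4%:R * eps) + eps) * frac_chromatic_number R (G n om)}.
Proof.
move=> eps0 D0.
have [b HB] := many_in_centered_box iid.
have [L [L0 HL]] := dense_colorable C1_gt0 C2_gt0 norm_perturb norm_small norm_coord eps0.
pose c : R := (4%:R * (2 * b%:R * C1 + 1) ^+ d)^-1.
have c0 : 0 < c by rewrite invr_gt0 mulr_gt0// exprn_gt0// ltr_wpDl// !mulr_ge0// ltW.
(* Large enough for [4 * trunc_log 2 n <= E * (t n).+1], so that a tail [2 ^- (E * t n)] is of order
   [n ^- 4]. *)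
pose E := (Num.truncn (4%:R * D%:R / eps)).+1.
(* A pattern of relative volume [theta] holds on average at most [theta * Z * (t n).+1] points;
   [theta] is then chosen to bring [4 * (theta * Z)], the base in [bin_expX_le], below [2 ^- E]. *)
pose Z := M * L ^+ d / (c * eps).
have Z0 : 0 <= Z by rewrite divr_ge0 ?mulr_ge0 ?exprn_ge0 ?(ltW L0) ?(ltW c0) ?(ltW eps0).
pose theta := (4%:R * (Z + 1) * 2%:R ^+ E)^-1.
have theta0 : 0 < theta by rewrite invr_gt0 !mulr_gt0 ?exprn_gt0 ?(ltr_wpDl Z0 ltr01).
have [Pn [B [Pn0 Hdet]]] := HL theta theta0.
pose lam n : R := n%:R * r n ^+ d.
have lam0 n : 0 <= lam n by rewrite mulr_ge0// exprn_ge0// ltW.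
(* A fraction [eps] of two lower bounds for fractional colourings: the clique bound of the dense
   range, which makes the tail summable, and that of [feasible_ge_scale], which dominates the
   mean. *)
pose t n := Num.truncn (eps * Num.max ((trunc_log 2 n)%:R / D%:R) (c * lam n)).
pose s n := L * r n / Pn%:R.
have s0 n : 0 < s n by rewrite divr_gt0 ?mulr_gt0// ltr0n.
pose C := {ffun 'I_d -> 'I_Pn}.
pose A1 n := [set om | exists (w : 'I_d -> int) (Q : {set C}),
  #|Q|%:R <= theta * (Pn ^ d)%:R /\
  (t n < #|[set j : 'I_n | in_pattern Q (s n) w (X j om)]%SET|)%N].
pose A2 n := [set om : Omega |
  (4 * #|[set j : 'I_n | [forall i, (- b%:R <= tnth (X j om) i < b%:R)%R]]%SET| < n)%N].
pose f n : R := (Pn ^ d * 2 ^ E)%:R * 96%:R / (n.+1 * n.+2)%:R.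
have perQ n (Q : {set C}) : #|Q|%:R <= theta * (Pn ^ d)%:R -> exists F, [/\ measurable F,
    (P F <= (f n)%:E)%E & forall om, ~ F om -> forall w,
    (#|[set j : 'I_n | in_pattern Q (s n) w (X j om)]%SET| <= t n)%N].
  move=> Qth; have [F [mF PF FQ]] := pattern_union_bound iid M_ge0 density Q (s0 n) n (ltn0Sn (t n)).
  exists F; split=> //; apply: (le_trans PF); rewrite lee_fin /= mulrCA.
  set p := #|Q|%:R * (M * _).
  have p0 : 0 <= p by rewrite !mulr_ge0// exprn_ge0// ltW.
  have [->|n0] := posnP n.
    by rewrite bin0n mul0r mulr0 /f divr_ge0 ?mulr_ge0.
  have tlt : eps * Num.max ((trunc_log 2 n)%:R / D%:R) (c * lam n) < (t n).+1%:R by exact: truncnS_gt.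
  have np : n%:R * p <= theta * Z * (t n).+1%:R.
    apply: (@le_trans _ _ (theta * (M * L ^+ d) * lam n)).
      have -> : theta * (M * L ^+ d) * lam n = n%:R * (theta * (Pn ^ d)%:R * (M * s n ^+ d)).
        by rewrite /lam /s !exprMn exprVn natrX; field; rewrite expf_neq0// pnatr_eq0 -lt0n.
      by rewrite ler_wpM2l// ler_wpM2r// mulr_ge0// exprn_ge0// ltW.
    have lamle : lam n <= (t n).+1%:R / (c * eps).
      rewrite ler_pdivlMr ?mulr_gt0// mulrA mulrC (le_trans _ (ltW tlt))// ler_pM2l//.
      by rewrite mulrC le_max lexx orbT.
    rewrite (_ : theta * Z * _ = theta * (M * L ^+ d) * ((t n).+1%:R / (c * eps))).
      by rewrite ler_wpM2l// !mulr_ge0 ?exprn_ge0 ?(ltW theta0) ?(ltW L0).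
    by rewrite /Z; ring.
  have th4 : 4%:R * (theta * Z) <= 2%:R ^- E.
    have -> : 4%:R * (theta * Z) = Z / (Z + 1) * 2%:R ^- E.
      by rewrite /theta; field; rewrite !lt0r_neq0 ?(ltr_wpDl Z0 ltr01) ?exprn_gt0.
    rewrite ler_piMl ?invr_ge0 ?exprn_ge0// ler_pdivrMr ?ltr_wpDl// mul1r lerDl.
    exact: ler01.
  have Et : (4 * trunc_log 2 n <= E * (t n).+1)%N.
    rewrite -(ler_nat R) !natrM.
    apply: (@le_trans _ _ (4%:R * D%:R / eps * (eps * ((trunc_log 2 n)%:R / D%:R)))).
      rewrite le_eqVlt; apply/orP; left; apply/eqP; field.
      by rewrite (lt0r_neq0 eps0) pnatr_eq0 -lt0n D0.
    apply: ler_pM; last by rewrite ltW// (le_lt_trans _ tlt)// ler_pM2l// le_max lexx.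
    - by rewrite divr_ge0 ?(ltW eps0).
    - by rewrite mulr_ge0 ?divr_ge0 ?(ltW eps0).
    - exact/ltW/truncnS_gt.
  have := bin_expX_le p0 (mulr_ge0 (ltW theta0) Z0) np.
  move=> /(ler_wpM2l (ler0n R #|Q|)) H; apply: (le_trans H).
  have cQ : #|Q|%:R <= (Pn ^ d)%:R :> R.
    by rewrite ler_nat (leq_trans (max_card _))// card_ffun !card_ord.
  have th0 : 0 <= 4%:R * (theta * Z) by rewrite mulr_ge0// mulr_ge0// ltW.
  have -> : f n = (Pn ^ d)%:R * (2%:R ^+ E * (96%:R / (n.+1 * n.+2)%:R)).
    by rewrite /f [(Pn ^ d * _)%:R]natrM [(2 ^ E)%:R]natrX !mulrA.
  apply: ler_pM => //; first by rewrite mulr_ge0// exprn_ge0.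
  apply: (@le_trans _ _ (n%:R * (2%:R ^+ E * 2%:R ^- (4 * trunc_log 2 n)))).
    rewrite ler_wpM2l//; apply: (@le_trans _ _ ((2%:R ^- E) ^+ t n)).
      by rewrite lerXn2r ?nnegrE ?invr_ge0 ?exprn_ge0.
    rewrite exprVn -exprM ler_pdivlMr ?exprn_gt0// mulrC ler_pdivrMr ?exprn_gt0//.
    by rewrite -exprD -mulnS ler_eXn2l ?ltr1n.
  by rewrite mulrCA ler_wpM2l ?exprn_ge0// trunc_log_inv_le.
have cover1 n : exists F, [/\ measurable F, (P F <= ((2 ^ #|{: C}|)%:R * f n)%:E)%E & A1 n `<=` F].
  have /choice[F FP] (Q : {set C}) : exists F, #|Q|%:R <= theta * (Pn ^ d)%:R -> [/\ measurable F,
      (P F <= (f n)%:E)%E & forall om, ~ F om -> forall w,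
      (#|[set j : 'I_n | in_pattern Q (s n) w (X j om)]%SET| <= t n)%N].
    have [/perQ|Qth] := pselect (#|Q|%:R <= theta * (Pn ^ d)%:R); last by exists set0.
    by move=> /(_ n)[F HF]; exists F.
  have [||F' [mF' PF' FF']] := @union_bound _ _ _ P _
      (fun Q : {set C} => #|Q|%:R <= theta * (Pn ^ d)%:R) F (fun=> f n).
  - by move=> Q /FP[].
  - by move=> Q /FP[].
  exists F'; split=> //.
    apply: (le_trans PF'); rewrite lee_fin sumr_const -[leLHS]mulr_natl ler_wpM2r//.
      by rewrite /f divr_ge0 ?mulr_ge0.
    by rewrite ler_nat (leq_trans (max_card _))// -cardsT -powersetT card_powerset cardsT.
  move=> om [w [Q [Qth few]]]; apply: (FF' Q) => //; apply: contrapT => nF.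
  have [_ _ /(_ _ nF w)] := FP Q Qth.
  by rewrite leqNgt few.
have cover2 n : exists F, [/\ measurable F, (P F <= (2%:R ^- n)%:E)%E & A2 n `<=` F].
  have [F [mF PF FB]] := HB n; exists F; split=> // om; rewrite /A2 /= ltnNge => /negP nB.
  by apply: contrapT => /FB.
have sum1 n : \sum_(i < n) (2 ^ #|{: C}|)%:R * f i <= (2 ^ #|{: C}|)%:R * ((Pn ^ d * 2 ^ E)%:R * 96%:R).
  rewrite -mulr_sumr ler_wpM2l// -mulr_sumr -[leRHS]mulr1 ler_wpM2l ?mulr_ge0//.
  exact: inv_square_sum_le.
have sum2 n : \sum_(i < n) 2%:R ^- i <= 2%:R :> R.
  suff -> : \sum_(i < n) 2%:R ^- i = 2%:R - 2%:R * 2%:R ^- n :> R.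
    by rewrite gerBl mulr_ge0// invr_ge0 exprn_ge0.
  elim: n => [|n IH]; first by rewrite big_ord0 expr0 invr1 mulr1 subrr.
  rewrite big_ord_recr /= IH exprS invfM mulrA divff//; lra.
have ae1 := borel_cantelli_cover cover1 sum1; have ae2 := borel_cantelli_cover cover2 sum2.
have [n1 n1P] : exists n1, forall n, (n1 <= n)%N -> r n <= 1.
  have /(@cvgrPdist_lt _ R _ _ _ r 0)/(_ 1 ltr01)[n1 _ n1P] := r_to0.
  exists n1 => n /n1P /=; rewrite sub0r normrN => /ltW; apply: le_trans; exact: ler_norm.
pose a := (1 + eps) * (1 + 4%:R * eps).
have a0 : 0 <= a by rewrite mulr_ge0 ?addr_ge0 ?mulr_ge0 ?(ltW eps0).
(* From [2 ^ i0] on, [eps * #|K|] is at least [a + B], where [a] pays for the slack 1 of the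
   fractional colouring. *)
pose i0 := (Num.truncn (D%:R * (a + B%:R) / eps)).+1.
move: ae1 ae2; apply: filterS2 => om [m1 H1] [m2 H2].
exists (maxn (maxn m1 m2) (maxn n1 (2 ^ i0))) => n.
rewrite !geq_max => /andP[/andP[nm1 nm2] /andP[nn1 ni0]] K Kc iK.
have [x xf xle] := @frac_chromatic_number_adherent R _ (G n om) 1 ltr01.
set Phi := \sum_(S | _) x S in xle; set chif := frac_chromatic_number _ _ in xle *.
have KD : (trunc_log 2 n)%:R / D%:R <= #|K|%:R :> R.
  by rewrite ler_pdivrMr ?ltr0n// -natrM ler_nat mulnC.
have tPhi : (t n)%:R <= eps * Phi.
  apply: (@le_trans _ _ (eps * Num.max ((trunc_log 2 n)%:R / D%:R) (c * lam n))).
    by rewrite truncn_le mulr_ge0 ?(ltW eps0)// le_max divr_ge0.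
  rewrite ler_pM2l// ge_max (le_trans KD) ?(clique_le_feasible xf Kc)//=.
  apply: feasible_ge_scale => //; first exact: n1P.
  by rewrite leqNgt; apply/negP; exact: H2.
have [|k ck kle] := Hdet _ (fun i : 'I_n => X i om) (r n) x (t n) (r_gt0 n) xf tPhi.
  by move=> w Q Qth; rewrite leqNgt; apply/negP => few; apply: (H1 n nm1); exists w, Q.
have chi_k : (chromatic_number (G n om))%:R <= k%:R :> R.
  by rewrite ler_nat; exact: chromatic_number_le.
apply: (le_trans chi_k); apply: (le_trans kle); rewrite mulrA -/a -/Phi.
have i0n : (i0 <= trunc_log 2 n)%N by apply: trunc_log_max.
have aB : a + B%:R <= eps * chif.
  apply: (@le_trans _ _ (eps * #|K|%:R)); last first.
    by rewrite ler_pM2l// clique_le_frac_chromatic_number.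
  rewrite mulrC -ler_pdivrMr// (le_trans _ KD)// ler_pdivlMr ?ltr0n//.
  rewrite mulrC mulrA (le_trans (ltW (truncnS_gt _)))// ler_nat.
  exact: i0n.
have := ler_wpM2l a0 xle; move: aB; rewrite mulrDl mulrDr mulr1 -/a.
move: (eps * chif) (a * Phi) (a * chif) => u v w; lra.
Qed.

End Dense.

(** * The sparse case *)

Lemma root_exists (R : realType) (z : R) (k : nat) : 0 <= z -> (0 < k)%N ->
  exists2 y : R, 0 <= y & y ^+ k = z.
Proof.
move=> z0 k0; exists (z `^ k%:R^-1); first exact: powR_ge0.
by rewrite -powR_mulrn ?powR_ge0// -powRrM mulVf ?powRr1// pnatr_eq0 -lt0n.
Qed.

Lemma expr_tangent (R : realDomainType) (p x : R) (k : nat) : 0 <= p -> 0 <= x ->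
  k.+1%:R * x ^+ k * p - k%:R * x ^+ k.+1 <= p ^+ k.+1.
Proof.
move=> p0 x0; elim: k => [|k IH].
  by rewrite expr0 expr1 mul0r subr0 !mul1r expr1.
have := ler_wpM2l p0 IH; rewrite -exprS; apply: le_trans.
rewrite -subr_ge0 (_ : _ - _ = k.+1%:R * x ^+ k * (p - x) ^+ 2).
  by rewrite mulr_ge0 ?sqr_ge0// mulr_ge0// exprn_ge0.
by rewrite !exprS -[k.+2%:R]natr1 -[k.+1%:R]natr1; ring.
Qed.

(** Power mean inequality, by summing the tangent lines of the power at [1 / (2 * #|S|)]. *)
Lemma power_mean_le (R : realFieldType) (S : finType) (p : S -> R) (k : nat) :
  (forall c, 0 <= p c) -> 1 <= 2%:R * \sum_c p c ->
  (2%:R * #|S|%:R) ^- k / 2%:R <= \sum_c p c ^+ k.+1.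
Proof.
move=> p0 sum_p; have S0 : 0 < #|S|%:R :> R.
  rewrite ltr0n lt0n; apply/negP => /eqP/card0_eq S0.
  have p_eq0 : \sum_c p c = 0 by apply: big1 => c _; have := S0 c; rewrite inE.
  by move: sum_p; rewrite p_eq0 mulr0 ler10.
pose x := (2%:R * #|S|%:R : R)^-1.
have x0 : 0 < x by rewrite invr_gt0 mulr_gt0.
apply: (@le_trans _ _ (\sum_c (k.+1%:R * x ^+ k * p c - k%:R * x ^+ k.+1))); last first.
  by apply: ler_sum => c _; apply: expr_tangent => //; exact: ltW.
rewrite sumrB -mulr_sumr sumr_const -[_ *+ #|_|]mulr_natl -exprVn -/x.
have -> : #|S|%:R * (k%:R * x ^+ k.+1) = k%:R * x ^+ k / 2%:R.
  by rewrite exprS /x; field; rewrite !lt0r_neq0 ?mulr_gt0 ?exprn_gt0.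
rewrite -subr_ge0 (_ : _ - _ = k.+1%:R * (x ^+ k * (2%:R * (\sum_c p c) - 1)) / 2%:R).
  by rewrite divr_ge0// mulr_ge0// mulr_ge0 ?exprn_ge0 ?(ltW x0)// subr_ge0.
by rewrite -[k.+1%:R]natr1; field.
Qed.

Lemma sum_succ_geometric_le (R : realFieldType) (x : R) (n : nat) : 0 <= x -> x < 1 ->
  \sum_(i < n) i.+1%:R * x ^+ i <= (1 - x) ^- 2.
Proof.
move=> x0 x1; have y0 : 0 < 1 - x by rewrite subr_gt0.
rewrite -[leRHS]mul1r ler_pdivlMr ?exprn_gt0//.
suff -> : (\sum_(i < n) i.+1%:R * x ^+ i) * (1 - x) ^+ 2 =
    1 - x ^+ n * (n%:R * (1 - x) + 1).
  by rewrite gerBl mulr_ge0 ?exprn_ge0// addr_ge0// mulr_ge0// ltW.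
elim: n => [|n IH]; first by rewrite big_ord0 expr0 !mul0r add0r mul1r subrr.
by rewrite big_ord_recr /= mulrDl IH [x ^+ n.+1]exprS -[n.+1%:R]natr1; ring.
Qed.

Section CrowdedGridCell.
Context {R : realType} {d : nat} (nu : probability (d.-tuple R) R) (M : R).
Hypothesis density : forall a s, 0 <= s -> (nu (box a s) <= (M * s ^+ d)%:E)%E.
Context {dO : measure_display} {Omega : measurableType dO} (P : probability Omega R).
Context (X : nat -> Omega -> d.-tuple R).
Hypothesis iid : iid_with_law P X nu.

(** At most [A * s ^- d] cells cover a cube carrying at least half of the mass. By the power mean
    inequality the expected number of block-wise [(k + 1)]-tuples in a common cell is at least
    [low], and the second moment bound divides by it. *)
Lemma crowded_grid_cell : exists2 A : R, 1 <= A &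
  forall (s D : R) (k n : nat), 0 < s -> s <= 1 -> (k < n)%N ->
  n%:R / k.+1%:R * (M * s ^+ d) <= D ->
  exists E, [/\ measurable E,
    (P E <= ((1 + D) ^+ k.+1 * (4%:R * k.+1%:R * (4%:R * A) ^+ k) /
               (n%:R * (n%:R * s ^+ d / k.+1%:R) ^+ k))%:E)%E &
    forall om, ~ E om -> exists c : {ffun 'I_d -> int},
      (k < #|[set j : 'I_n | [forall i, Num.floor (tnth (X j om) i / s) == c i]]%SET|)%N].
Proof.
have [b nub] := centered_box_large nu.
(* The grid has [2 * a0] cells per side, and [2 * a0 * s <= 2 * b + 2] because [s <= 1]. *)
pose A : R := (2 * b%:R + 2) ^+ d; exists A.
  by rewrite exprn_ege1// (@le_trans _ _ 2)//; [rewrite ler1n|rewrite lerDr mulr_ge0].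
move=> s D k n s0 s1 kn nD.
pose a0 := (Num.truncn (b%:R / s)).+1.
pose S := {ffun 'I_d -> 'I_(2 * a0)}.
pose cell (c : S) : {ffun 'I_d -> int} := [ffun i => (c i)%:Z - a0%:Z].
have cell_inj : injective cell.
  move=> c c' /ffunP cc'; apply/ffunP => i; apply/val_inj.
  by have := cc' i; rewrite !ffunE => /addIr [].
pose p c := fine (nu (gridcell s (cell c))).
have p0 c : 0 <= p c by exact: fine_ge0.
have nuE c : nu (gridcell s (cell c)) = (p c)%:E.
  by rewrite fineK// fin_num_measure//; exact: measurable_gridcell.
have ple c : p c <= M * s ^+ d by rewrite -lee_fin -nuE; apply: density; exact: ltW.
have sum_p : 1 <= 2%:R * \sum_c p c.
  have [||F [mF Fp SF]] := @union_bound _ _ _ nu S predT (fun c => gridcell s (cell c)) p.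
  - by move=> c _; exact: measurable_gridcell.
  - by move=> c _; rewrite nuE.
  have sub : centered_box b `<=` F.
    move=> x /mem_centered_box xb.
    have xs i : - a0%:R <= tnth x i / s < a0%:R.
      have /andP[lo hi] := xb i; have bs := truncnS_gt (b%:R / s).
      rewrite (lt_trans _ bs) ?ltr_pM2r ?invr_gt0// andbT lerNl -mulNr (le_trans _ (ltW bs))//.
      by rewrite ler_pM2r ?invr_gt0// lerNl.
    have /choice[m mP] i : exists m : 'I_(2 * a0), Num.floor (tnth x i / s) = m%:Z - a0%:Z.
      have /andP[lo hi] := xs i.
      have : - a0%:Z <= Num.floor (tnth x i / s) by rewrite floor_ge_int intrN -pmulrn.
      have : Num.floor (tnth x i / s) < a0%:Z by rewrite floor_lt_int -pmulrn.
      move: (Num.floor _) => z za az; have lt : (absz (z + a0%:Z)%R < 2 * a0)%N by lia.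
      by exists (Ordinal lt) => /=; lia.
    apply: (SF (finfun m : S) x isT); apply/(mem_gridcell _ _ s0) => i.
    by rewrite !ffunE mP.
  have : (nu (centered_box b) <= (\sum_c p c)%:E)%E.
    by apply: le_trans Fp; rewrite le_measure ?inE//; exact: measurable_box.
  have mb : measurable (@centered_box R d b) by exact: measurable_box.
  have nub' : (nu (~` centered_box b) <= (8%:R^-1)%:E)%E.
    by rewrite -[nu _]fineK ?lee_fin// fin_num_measure//; exact: measurableC.
  move: nub'; rewrite probability_setC// -[nu _]fineK ?fin_num_measure// -EFinB !lee_fin.
  move: (fine _) (\sum_c p c) => u v; lra.
have cardS : #|S|%:R * s ^+ d <= A.
  rewrite card_ffun !card_ord natrX -exprMn lerXn2r ?nnegrE ?mulr_ge0 ?addr_ge0 ?(ltW s0)//.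
  rewrite natrM -mulrA -[2 * b%:R + 2](_ : 2 * (b%:R + 1) = _); last by rewrite mulrDr mulr1.
  rewrite ler_pM2l// -ler_pdivlMr// /a0 -natr1 mulrDl lerD//.
    by rewrite truncn_le divr_ge0// ltW.
  by rewrite ler_pdivlMr// mul1r.
pose bb := (n %/ k.+1)%N.
have kR : 0 < k.+1%:R :> R by rewrite ltr0n.
have bbD c : bb%:R * p c <= D.
  apply: le_trans nD; apply: ler_pM => //.
  by rewrite ler_pdivlMr// -natrM ler_nat leq_divM.
have n0 : 0 < n%:R :> R by rewrite ltr0n (leq_trans _ kn).
have bb_ge : n%:R / (2%:R * k.+1%:R) <= bb%:R :> R.
  rewrite ler_pdivrMr ?mulr_gt0// -!natrM ler_nat /bb.
  have := divn_eq n k.+1; have := ltn_pmod n (ltn0Sn k).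
  have : (0 < n %/ k.+1)%N by rewrite divn_gt0.
  by move: (n %/ k.+1)%N (n %% k.+1)%N => u v; nia.
have A0 : 0 < A by rewrite exprn_gt0// ltr_wpDl// mulr_ge0.
have sd : 0 < s ^+ d by rewrite exprn_gt0.
have S0 : 0 < #|S|%:R :> R.
  by rewrite ltr0n card_ffun !card_ord expn_gt0 muln_gt0.
pose low := n%:R * (n%:R * s ^+ d / k.+1%:R) ^+ k / (4%:R * k.+1%:R * (4%:R * A) ^+ k).
have low0 : 0 < low by rewrite divr_gt0 ?mulr_gt0 ?exprn_gt0 ?divr_gt0 ?mulr_gt0.
have mu_ge : low <= \sum_c (bb%:R * p c) ^+ k.+1.
  under eq_bigr => c _ do rewrite exprMn; rewrite -mulr_sumr.
  apply: (@le_trans _ _ ((n%:R / (2%:R * k.+1%:R)) ^+ k.+1 * ((s ^+ d / (2%:R * A)) ^+ k / 2%:R))).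
    rewrite /low [in leRHS]exprS le_eqVlt; apply/orP; left; apply/eqP.
    rewrite !(exprMn, exprVn, invfM) (_ : 4%:R ^+ k = 2%:R ^+ k * 2%:R ^+ k :> R); last first.
      by rewrite -exprMn -natrM.
    by field; rewrite !(expf_neq0, lt0r_neq0)// ?exprn_gt0.
  apply: ler_pM.
  - by rewrite exprn_ge0// divr_ge0// mulr_ge0.
  - by rewrite divr_ge0// exprn_ge0// divr_ge0 ?(ltW sd)// mulr_ge0// ltW.
  - by rewrite lerXn2r ?nnegrE// divr_ge0// mulr_ge0.
  apply: le_trans (power_mean_le k p0 sum_p); rewrite ler_wpM2r// -exprVn lerXn2r ?nnegrE//.
    by rewrite divr_ge0 ?(ltW sd)// mulr_ge0// ltW.
  rewrite ler_pdivrMr ?mulr_gt0// ler_pdivlMl ?mulr_gt0//.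
  by rewrite -mulrA ler_pM2l.
have [|||E [mE PE EP]] := @crowded_cell R d nu dO Omega P X iid S cell s k.+1 bb s0 cell_inj n D.
- by rewrite mulnC leq_divM.
- exact: bbD.
- exact: lt_le_trans mu_ge.
exists E; split=> //; last by move=> om /EP[c cP]; exists (cell c).
apply: (le_trans PE); rewrite lee_fin.
have D0 : 0 <= D by apply: le_trans nD; rewrite mulr_ge0 ?divr_ge0// (le_trans (p0 [ffun=> ord0]) (ple _)).
rewrite (_ : _ / (n%:R * _) = (1 + D) ^+ k.+1 / low).
  by rewrite ler_pM2l ?exprn_gt0 ?ltr_pwDl// lef_pV2 ?posrE ?(lt_le_trans low0).
by rewrite /low invf_div !mulrA.
Qed.

End CrowdedGridCell.

(* [y] fixes the cell side by s^d = (k + 1) y / 2^i. It is chosen so that the expected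
   number of (k+1)-tuples of points in a common cell is a small power of 2^i, while the
   expected number of (k+2+k/q)-tuples is a small negative one. *)
Lemma sparse_scale (R : realType) (h : R) (q i k : nat) :
  1 < h -> h ^+ (2 * (2 * q).+1) = 2 -> (0 < q)%N -> (0 < k)%N ->
  exists y : R, [/\ 0 < y, y <= 1, 2%:R ^+ i * y ^+ k = h ^+ (2 * i) &
    2%:R ^+ i * y ^+ (k.+1 + k %/ q) <= h ^- (2 * i)].
Proof.
move=> h1 h2 q0 k0; have h0 : 0 < h by apply: lt_trans h1.
have hX n : 0 < h ^+ n by rewrite exprn_gt0.
(* Since [2 = h ^ (4q + 2)], this makes [2 ^ i * y ^ k] equal to [h ^ (2i)]. *)
have [|y y0 yk] := @root_exists R (h ^- (4 * q * i)) k _ k0; first by rewrite invr_ge0 ltW.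
have y1 : y <= 1.
  by rewrite -(ler_pXn2r k0) ?nnegrE// expr1n yk invf_le1 ?hX// exprn_ege1// ltW.
exists y; split=> //.
- rewrite lt0r y0 andbT; apply: contraTneq isT => yE; move: (hX (4 * q * i)%N).
  by rewrite -invr_gt0 -yk yE expr0n; case: (k) k0 => //= _ _; rewrite ltxx.
- rewrite yk -h2 -exprM ; apply/eqP; rewrite eq_sym -subr_eq0 -(inj_eq (mulIf (lt0r_neq0 (hX (4 * q * i)%N)))) mul0r.
  rewrite mulrBl mulfVK ?lt0r_neq0// -exprD subr_eq0; apply/eqP; congr (_ ^+ _); lia.
rewrite -(ler_pXn2r q0) ?nnegrE ?mulr_ge0 ?invr_ge0 ?exprn_ge0 ?(ltW h0)//.
rewrite exprMn exprVn -h2 -!exprM.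
(* Raised to the power [q], the exponent of [y] is at least [k * q.+1] as [q * (k %/ q) + q >= k];
   with exactly [k * q.+1] both sides are the same power of [h]. *)
have le : y ^+ ((k.+1 + k %/ q) * q) <= y ^+ (k * q.+1).
  apply: ler_wiXn2l => //.
  have := divn_eq k q; have := ltn_pmod k q0.
  by move: (k %/ q)%N (k %% q)%N => u v; nia.
apply: (le_trans (ler_wpM2l (ltW (hX _)) le)).
rewrite [y ^+ _]exprM yk exprVn -[(h ^+ (4 * q * i)) ^+ _]exprM ler_pdivrMr// mulrC ler_pdivlMr//.
by rewrite -exprD ler_eXn2l//; nia.
Qed.

Lemma exists_expr_ge (R : realType) (h z : R) : 1 < h -> exists D, z <= h ^+ D.
Proof.
move=> h1; have h0 : 0 < h - 1 by rewrite subr_gt0.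
have bern n : n%:R * (h - 1) <= h ^+ n.
  elim: n => [|n IH]; first by rewrite mul0r expr0.
  rewrite exprS -[n.+1%:R]natr1 (_ : h * _ = h ^+ n + (h - 1) * h ^+ n); last by ring.
  rewrite mulrDl mul1r lerD// -[leLHS]mulr1 ler_pM2l// exprn_ege1// ltW//.
exists (Num.truncn (z / (h - 1))).+1; apply: le_trans (bern _).
by rewrite -ler_pdivrMr// ltW// truncnS_gt.
Qed.

Lemma int_offset (e : nat) (z t : int) : z - e%:Z <= t -> t < z + 1 + e%:Z ->
  exists j : 'I_(2 * e).+1, t == z - e%:Z + j%:Z.
Proof.
move=> lo hi; have lt : (absz (t - (z - e%:Z))%R < (2 * e).+1)%N by lia.
by exists (Ordinal lt); apply/eqP => /=; lia.
Qed.

Lemma four_mul_succ_le k : (0 < k)%N -> (4 * k.+1 <= 8 ^ k)%N.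
Proof. by elim: k => // -[//|k] IH _; rewrite expnS; have := IH isT; lia. Qed.

Lemma succ_add_div_le k q : (0 < k)%N -> (k.+1 + k %/ q <= 3 * k)%N.
Proof. by have := leq_div k q; lia. Qed.

Section Sparse.
Context {R : realType} {d : nat} (N : d.-tuple R -> R) (C1 C2 M : R).
Hypotheses (C1_gt0 : 0 < C1) (C2_gt0 : 0 < C2) (M_ge0 : 0 <= M) (d_gt0 : (0 < d)%N).
Hypothesis norm_small : forall (b : R) (x : d.-tuple R),
  (forall i, `|tnth x i| <= b) -> N x <= C1 * b.
Hypothesis norm_coord : forall (x : d.-tuple R) i, `|tnth x i| <= C2 * N x.
Hypothesis norm_sym : forall x y, N (tsub x y) = N (tsub y x).

(** When [r < C1 * s], a 2-ball reaches at most [2 * C1 * C2 * s] in each coordinate, less than [e]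
    cells either way; [Q] is the full cube of [2 * e + 1] cells per side around its centre. *)
Let e : nat := (Num.truncn (2 * (C1 * C2))).+1.
Let Q : {set {ffun 'I_d -> 'I_(2 * e).+1}} := [set: {ffun 'I_d -> 'I_(2 * e).+1}]%SET.

(** For [C1 * s <= r] the crowded cell would be a clique of more than [k] points, so [r < C1 * s].
    Crowding among the first [n0] points and sparsity among the first [n1] pass to every [n] in
    between. *)
Lemma sparse_rgg_colorable (pts : nat -> d.-tuple R) (s r : R) (n0 n n1 k q : nat)
    (c : {ffun 'I_d -> int}) :
  0 < s -> (n0 <= n)%N -> (n <= n1)%N ->
  (k < #|[set j : 'I_n0 | [forall i, Num.floor (tnth (pts j) i / s) == c i]]%SET|)%N ->
  (forall w : 'I_d -> int,
    (#|[set j : 'I_n1 | in_pattern Q s w (pts j)]%SET| < (k.+1 + k %/ q).+1)%N) ->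
  (forall K, cliqueb (rgg_adj N pts r n) K -> (#|K| <= k)%N) ->
  colorable (rgg_adj N pts r n) [set: 'I_n]%SET (if (k < q)%N then k else k.+1 + k %/ q)%N.
Proof.
move=> s0 n0n nn1 crowded few small.
have rC : r < C1 * s.
  rewrite ltNge; apply/negP => Cr.
  pose f (j : 'I_n0) : 'I_n := widen_ord n0n j.
  have finj : injective f by move=> j j' /(congr1 val) /= /val_inj.
  pose B := [set j : 'I_n0 | [forall i, Num.floor (tnth (pts j) i / s) == c i]]%SET.
  have : cliqueb (rgg_adj N pts r n) [set f j | j in B]%SET.
    apply/forallP => x; apply/implyP => /imsetP[j jB ->].
    apply/forallP => y; apply/implyP => /imsetP[j' jB' ->]; apply/implyP => jj'.
    rewrite /rgg_adj jj' /=; apply: (le_trans _ Cr); apply: norm_small => i.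
    rewrite tnth_tsub; move: jB jB'; rewrite !inE => /forallP/(_ i)/eqP ji /forallP/(_ i)/eqP ji'.
    have := floor_itv (tnth (pts j) i / s); have := floor_itv (tnth (pts j') i / s).
    rewrite ji ji' !ler_pdivlMr// !ltr_pdivrMr// intrD mulrDl mul1r.
    by move: ((c i)%:~R * s) => z; rewrite ler_norml => /andP[? ?] /andP[? ?]; apply/andP; split; lra.
  by move=> /small; rewrite card_imset// leqNgt crowded.
have adj_sym x y : rgg_adj N pts r n x y = rgg_adj N pts r n y x.
  by rewrite /rgg_adj eq_sym norm_sym.
apply: sparse_colorable => // v.
pose w i : int := Num.floor (tnth (pts v) i / s) - e%:Z.
rewrite -ltnS; apply: leq_ltn_trans (few w).
pose f (j : 'I_n) : 'I_n1 := widen_ord nn1 j.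
have finj : injective f by move=> j j' /(congr1 val) /= /val_inj.
rewrite -(card_imset _ finj); apply/subset_leq_card/fintype.subsetP => _ /imsetP[u uv ->].
have close i : `|tnth (pts u) i - tnth (pts v) i| <= 2 * (C1 * C2) * s.
  have adj_close a b : rgg_adj N pts r n a b ->
      `|tnth (pts a) i - tnth (pts b) i| <= C1 * C2 * s.
    move=> /andP[_ ab]; rewrite -tnth_tsub (le_trans (norm_coord _ _))//.
    by rewrite [C1 * C2]mulrC -mulrA ler_pM2l// (le_trans ab)// ltW.
  have Cs : 0 <= C1 * C2 * s by rewrite ltW// !mulr_gt0.
  rewrite -(mulrA 2) mulr_natl mulr2n; move: uv; rewrite inE => /or3P[/eqP->||/existsP[z /andP[vz zu]]].
  - by rewrite subrr normr0 addr_ge0.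
  - by rewrite adj_sym => /adj_close H; rewrite (le_trans H)// lerDl.
  have -> : tnth (pts u) i - tnth (pts v) i =
     (tnth (pts u) i - tnth (pts z) i) + (tnth (pts z) i - tnth (pts v) i) by ring.
  apply: (le_trans (ler_normD _ _)); apply: lerD; apply: adj_close; rewrite adj_sym//.
have off i : exists o : 'I_(2 * e).+1, Num.floor (tnth (pts u) i / s) == w i + o%:Z.
  have be : 2 * (C1 * C2) < e%:R :> R by exact: truncnS_gt.
  have : `|tnth (pts u) i / s - tnth (pts v) i / s| < e%:R.
    rewrite -mulrBl normrM [`|s^-1|]gtr0_norm ?invr_gt0// ltr_pdivrMr//.
    by rewrite (le_lt_trans (close i))// ltr_pM2r.
  rewrite /w; move: (tnth (pts u) i / s) (tnth (pts v) i / s) => a b.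
  rewrite ltr_norml => /andP[ab1 ab2].
  have := floor_itv b; set z := Num.floor b; rewrite intrD => /andP[zb bz].
  have lo : z - e%:Z <= Num.floor a.
    by rewrite floor_ge_int intrB -[e%:~R]pmulrn; lra.
  have hi : Num.floor a < z + 1 + e%:Z.
    by rewrite floor_lt_int !intrD -[e%:~R]pmulrn; lra.
  exact: int_offset lo hi.
have /choice[of_ ofP] := off; rewrite inE; apply/existsP; exists (finfun of_).
by rewrite finset.in_setT; apply/forallP => i; rewrite ffunE; exact: ofP.
Qed.

Context (nu : probability (d.-tuple R) R).
Hypothesis density : forall a s, 0 <= s -> (nu (box a s) <= (M * s ^+ d)%:E)%E.
Context {dO : measure_display} {Omega : measurableType dO} (P : probability Omega R).
Context (X : nat -> Omega -> d.-tuple R) (r : nat -> R).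
Hypothesis iid : iid_with_law P X nu.

Local Notation G n om := (rgg_adj N (fun i => X i om) (r n) n).

Lemma sparse_ae (q : nat) : (0 < q)%N -> exists2 D : nat, (0 < D)%N &
  {ae P, forall om, exists n0, forall n, (n0 <= n)%N -> forall k, (0 < k)%N ->
    (D * k <= trunc_log 2 n)%N -> (forall K, cliqueb (G n om) K -> (#|K| <= k)%N) ->
    colorable (G n om) [set: 'I_n]%SET (if (k < q)%N then k else k.+1 + k %/ q)%N}.
Proof.
move=> q0.
have [h h_ge0 hE] := @root_exists R 2 (2 * (2 * q).+1) (ler0n _ _) isT.
have h1 : 1 < h.
  rewrite ltNge; apply/negP => h_le1; have := exprn_ile1 (2 * (2 * q).+1) h_ge0 h_le1.
  by rewrite hE; lra.
have h0 : 0 < h by apply: lt_trans h1.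
have hX n : 0 < h ^+ n by rewrite exprn_gt0.
have [A A1 crowded] := crowded_grid_cell density iid.
(* Growth per unit of [k]: [G2] for the second moment bound, by [k + 1 <= 2k] and
   [4 (k + 1) <= 8 ^ k]; [G3] for the pattern bound, whose exponent is at most [3k]. *)
pose G2 : R := (1 + M) ^+ 2 * 8%:R * (4%:R * A).
pose G3 : R := (8%:R * #|Q|%:R * M + 1) ^+ 3.
have [D0 D0P] := exists_expr_ge (G2 + G3) h1.
have A4 : 0 <= 4%:R * A by rewrite mulr_ge0// (le_trans _ A1).
have G2_ge0 : 0 <= G2 by rewrite !mulr_ge0 ?exprn_ge0 ?addr_ge0// (le_trans _ A1).
have G3_ge0 : 0 <= G3 by rewrite exprn_ge0// addr_ge0// !mulr_ge0.
pose D := D0.+1.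
have hD : h ^+ D0 <= h ^+ D by rewrite ler_eXn2l.
have G2D : G2 <= h ^+ D by rewrite (le_trans _ hD)// (le_trans _ D0P)// lerDl.
have G3D : G3 <= h ^+ D by rewrite (le_trans _ hD)// (le_trans _ D0P)// lerDr.
(* [g ^+ k] is at most [h ^+ i] by the choice of [D], which spends one of the two factors
   [h ^- i]. *)
have absorb (g : R) (i k : nat) : 0 <= g -> g <= h ^+ D -> (D * k <= i)%N ->
    g ^+ k * h ^- (2 * i) <= h ^- i.
  move=> g0 gD Dk; rewrite ler_pdivrMr// mulrC ler_pdivlMr//.
  apply: (@le_trans _ _ (h ^+ (D * k) * h ^+ i)).
    by rewrite ler_pM2r// exprM lerXn2r ?nnegrE// ltW.
  by rewrite -exprD ler_eXn2l// mul2n -addnn leq_add2r.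
(* The complement is covered by events on the first [2 ^ i] and the first [2 ^ i.+1] points, in
   which [r] does not occur, so no union over [n] is taken. *)
pose good (i k : nat) := [set om | forall n, (2 ^ i <= n < 2 ^ i.+1)%N ->
   (forall K, cliqueb (G n om) K -> (#|K| <= k)%N) ->
    colorable (G n om) [set: 'I_n]%SET (if (k < q)%N then k else k.+1 + k %/ q)%N].
have step (i k : nat) : (0 < k)%N -> (D * k <= i)%N -> exists F, [/\ measurable F,
    (P F <= ((1 + 2%:R * #|Q|%:R) * h ^- i)%:E)%E & ~` good i k `<=` F].
  move=> k0 Dk; have [y [y0 y1 yk ym]] := sparse_scale i h1 hE q0 k0.
  have ki : (k < 2 ^ i)%N.
    apply: leq_ltn_trans (ltn_expl i (ltnSn 1)); apply: leq_trans Dk; exact: leq_pmull.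
  have Ni : 0 < 2%:R ^+ i :> R by rewrite exprn_gt0.
  have kR : 0 < k.+1%:R :> R by rewrite ltr0n.
  have [|s s_ge0 sd] := @root_exists R (k.+1%:R * y / 2%:R ^+ i) d _ d_gt0.
    by rewrite divr_ge0 ?mulr_ge0 ?ltW.
  have sd0 : 0 < s ^+ d by rewrite sd divr_gt0 ?mulr_gt0.
  have s0 : 0 < s.
    rewrite lt0r s_ge0 andbT; apply: contraTneq sd0 => ->.
    by rewrite expr0n -[d == 0%N]negbK -lt0n d_gt0 ltxx.
  have s1 : s <= 1.
    rewrite -(ler_pXn2r d_gt0) ?nnegrE// expr1n sd ler_pdivrMr// mul1r.
    by rewrite -natrX (le_trans (ler_wpM2l (ler0n _ _) y1))// mulr1 ler_nat.
  have Nsd : 2%:R ^+ i * s ^+ d / k.+1%:R = y.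
    by rewrite sd; field; rewrite !lt0r_neq0.
  have [|E1 [mE1 PE1 E1P]] := crowded s M k (2 ^ i)%N s0 s1 ki.
    rewrite natrX (_ : _ / _ * _ = M * (2%:R ^+ i * s ^+ d / k.+1%:R)); last by ring.
    rewrite Nsd.
    by rewrite ler_piMr.
  have [E2 [mE2 PE2 E2P]] := pattern_union_bound iid M_ge0 density Q s0 (2 ^ i.+1)
     (ltn0Sn (k.+1 + k %/ q)).
  exists (E1 `|` E2); split; first exact: measurableU.
  - apply: (le_trans (measureU2 _ mE1 mE2)).
    rewrite mulrDl mul1r EFinD; apply: leeD.
      apply: (le_trans PE1); rewrite lee_fin natrX Nsd yk mulrA.
      apply: le_trans (absorb _ _ _ G2_ge0 G2D Dk); rewrite ler_pM2r ?invr_gt0//.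
      have -> : G2 ^+ k = (1 + M) ^+ (2 * k) * (8%:R ^+ k * (4%:R * A) ^+ k).
        by rewrite exprM -[8%:R ^+ k * _]exprMn -[RHS]exprMn /G2 !mulrA.
      rewrite -!mulrA; apply: ler_pM.
      - by rewrite exprn_ge0// addr_ge0.
      - by rewrite !mulr_ge0 ?exprn_ge0.
      - by rewrite ler_weXn2l ?lerDl// mul2n -addnn -addn1 leq_add2l.
      rewrite mulrA ler_wpM2r ?exprn_ge0//.
      rewrite -natrX -natrM ler_nat; exact: four_mul_succ_le.
    apply: (le_trans PE2); rewrite lee_fin /= mulrCA.
    set p := #|Q|%:R * (M * _).
    have p0 : 0 <= p by rewrite !mulr_ge0// ltW.
    have Qy0 : 0 <= 2%:R * #|Q|%:R * M * y by rewrite !mulr_ge0// ltW.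
    have np : (2 ^ i.+1)%:R * p <= 2%:R * #|Q|%:R * M * y * (k.+1 + k %/ q).+1%:R.
      have -> : (2 ^ i.+1)%:R * p = 2%:R * #|Q|%:R * M * y * k.+1%:R.
        by rewrite /p -Nsd natrX exprS; field; rewrite lt0r_neq0.
      by rewrite ler_wpM2l// ler_nat ltnS ltnW// ltnS leq_addr.
    have := bin_expX_le p0 Qy0 np => /(ler_wpM2l (ler0n R #|Q|)) H; apply: (le_trans H).
    rewrite natrX exprS (_ : 4%:R * _ = 8%:R * #|Q|%:R * M * y); last by ring.
    rewrite exprMn (_ : _ * (_ * _) = 2%:R * #|Q|%:R * ((8%:R * #|Q|%:R * M) ^+ (k.+1 + k %/ q)
       * (2%:R ^+ i * y ^+ (k.+1 + k %/ q)))); last by ring.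
    rewrite ler_wpM2l ?mulr_ge0//; apply: le_trans (absorb _ _ _ G3_ge0 G3D Dk).
    apply: ler_pM => //; rewrite ?exprn_ge0 ?mulr_ge0 ?exprn_ge0 ?(ltW y0)//.
    apply: (@le_trans _ _ ((8%:R * #|Q|%:R * M + 1) ^+ (k.+1 + k %/ q))).
      by rewrite lerXn2r ?nnegrE ?addr_ge0 ?mulr_ge0// lerDl.
    rewrite /G3 -exprM ler_weXn2l ?lerDr ?mulr_ge0//.
    exact: succ_add_div_le.
  - move=> om; apply: contra_notP => /not_orP[nE1 nE2] n /andP[ni1 ni2] small.
    have [c cP] := E1P om nE1.
    exact: (@sparse_rgg_colorable _ s (r n) _ n _ k q c s0 ni1 (ltnW ni2) cP (E2P om nE2) small).
(* At most [i.+1] values of [k] occur at scale [i], a factor that the geometric decay absorbs. *)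
have cover i : exists F, [/\ measurable F,
    (P F <= ((1 + 2%:R * #|Q|%:R) * (i.+1%:R * h^-1 ^+ i))%:E)%E &
    [set om | exists k, [/\ (0 < k)%N, (D * k <= i)%N & ~ good i k om]] `<=` F].
  have /choice[F FP] (k : 'I_i.+1) : exists F, (0 < k)%N && (D * k <= i)%N -> [/\ measurable F,
    (P F <= ((1 + 2%:R * #|Q|%:R) * h ^- i)%:E)%E & ~` good i k `<=` F].
    have [/andP[k0 Dk]|nk] := boolP ((0 < k)%N && (D * k <= i)%N); last by exists set0.
    by have [F HF] := step i k k0 Dk; exists F.
  have [||F' [mF' PF' FF']] := @union_bound _ _ _ P _
      (fun k : 'I_i.+1 => (0 < k)%N && (D * k <= i)%N) F (fun=> (1 + 2%:R * #|Q|%:R) * h ^- i).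
  - by move=> k /FP[].
  - by move=> k /FP[].
  exists F'; split=> //.
    apply: (le_trans PF'); rewrite lee_fin sumr_const -[leLHS]mulr_natl mulrCA exprVn.
    rewrite ler_wpM2l ?addr_ge0 ?mulr_ge0// ler_wpM2r ?invr_ge0 ?(ltW (hX _))//.
    by rewrite ler_nat (leq_trans (max_card _))// card_ord.
  move=> om [k [k0 Dk bad]]; have ki : (k < i.+1)%N.
    by rewrite ltnS (leq_trans _ Dk)// leq_pmull.
  by have := FP (Ordinal ki); rewrite /= k0 Dk => /(_ isT)[_ _ sub]; apply: (FF' (Ordinal ki));
    [rewrite /= k0|exact: sub].
have sum_le n : \sum_(i < n) (1 + 2%:R * #|Q|%:R) * (i.+1%:R * h^-1 ^+ i) <=
    (1 + 2%:R * #|Q|%:R) * (1 - h^-1) ^- 2.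
  rewrite -mulr_sumr ler_wpM2l ?addr_ge0 ?mulr_ge0//.
  by apply: sum_succ_geometric_le; rewrite ?invr_ge0// invf_lt1.
exists D => //; have := borel_cantelli_cover cover sum_le; apply: filterS => om [i0 HI].
exists (2 ^ i0)%N => n i0n k k0 Dk small.
have n_gt0 : (0 < n)%N by rewrite (leq_trans _ i0n)// expn_gt0.
apply: contrapT => ncol; apply: (HI (trunc_log 2 n)); first exact: trunc_log_max.
exists k; split=> // /(_ n); apply: contra_not ncol; apply => //.
by rewrite trunc_logP// trunc_log_ltn.
Qed.

End Sparse.

(** * Conclusion *)

Lemma exists_max_clique (T : finType) (e : rel T) : (0 < #|T|)%N ->
  exists2 K : {set T}, cliqueb e K /\ (0 < #|K|)%N &
    forall K', cliqueb e K' -> (#|K'| <= #|K|)%N.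
Proof.
move=> /card_gt0P[v _].
have v1 : cliqueb e [set v]%SET.
  apply/forallP => x; apply/implyP => /set1P ->; apply/forallP => y; apply/implyP => /set1P ->.
  by rewrite eqxx.
case: (@arg_maxnP _ [set v]%SET (cliqueb e) (fun K : {set T} => #|K|) v1) => K Kc Kmax.
by exists K => //; split=> //; rewrite (leq_trans _ (Kmax _ v1))// cards1.
Qed.

(** An additive 1 is a small relative error only for [q <= k]; this is why smaller cliques call for
    exactly [k] colours. *)
Lemma sparse_rounding_le (R : realFieldType) (q k : nat) : (0 < q)%N ->
  (if (k < q)%N then k else k.+1 + k %/ q)%N%:R <= (1 + 10%:R / q%:R) * k%:R :> R.
Proof.
move=> q0; have qR : 0 < q%:R :> R by rewrite ltr0n.
rewrite mulrDl mul1r mulrAC; case: ltnP => [_|qk].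
  by rewrite lerDl divr_ge0 ?mulr_ge0.
rewrite addSnnS natrD lerD2l ler_pdivlMr// -!natrM ler_nat.
by have := leq_divM k q; move: (k %/ q)%N => u; lia.
Qed.

(** Origin of the 10: with [t = 1 / q] the left side is [1 + 6 t + 4 t^2], and [t <= 1]. *)
Lemma dense_rounding_le (R : realFieldType) (q : nat) : (0 < q)%N ->
  (1 + q%:R^-1) * (1 + 4%:R * q%:R^-1) + q%:R^-1 <= 1 + 10%:R / q%:R :> R.
Proof.
move=> q0; have : 0 <= q%:R^-1 :> R by rewrite invr_ge0.
have : q%:R^-1 <= 1 :> R by rewrite invf_le1 ?ltr0n// ler1n.
by move: (q%:R^-1 : R) => t t1 t0; nra.
Qed.

Lemma is_norm_tsubC (R : realType) (d : nat) (N : d.-tuple R -> R) x y :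
  is_norm N -> N (tsub x y) = N (tsub y x).
Proof.
move=> [_ [_ [NZ _]]]; have -> : tsub x y = tscale (-1) (tsub y x).
  by apply/eq_from_tnth => i; rewrite !tnth_mktuple; ring.
by rewrite NZ normrN normr1 mul1r.
Qed.

Theorem theorem1p7 (R : realType) (d : nat) (N : d.-tuple R -> R)
  (nu : probability (d.-tuple R) R)
  (dO : measure_display) (Omega : measurableType dO) (P : probability Omega R)
  (X : nat -> Omega -> d.-tuple R) (r : nat -> R) :
  (0 < d)%N ->
  is_norm N ->
  has_bounded_density nu ->
  iid_with_law P X nu ->
  (forall n, 0 < r n) ->
  r @ \oo --> 0 ->
  {ae P, forall w, ((fun n : nat =>
      (chromatic_number (rgg_adj N (fun i => X i w) (r n) n))%:R /
      frac_chromatic_number R (rgg_adj N (fun i => X i w) (r n) n)) @ \oo --> (1 : R))}.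
Proof.
move=> d0 Nnorm bdens iid r0 rto0.
have [M M0 dens] := bounded_density_box bdens.
have [C2 C20 ncoord] := norm_coord_bound Nnorm d0.
pose C1 : R := 1 + \sum_i N (tbasis i).
have C10 : 0 < C1 by rewrite ltr_wpDr// sumr_ge0// => i _; exact: Nnorm.1.
have nsmall (b : R) (x : d.-tuple R) : (forall i, `|tnth x i| <= b) -> N x <= C1 * b.
  by move=> xb; apply: norm_small_sum => //; exact: le_trans (normr_ge0 _) (xb (Ordinal d0)).
have npert (lambda b : R) (x y : d.-tuple R) : 0 <= lambda ->
    (forall i, `|lambda * tnth x i - tnth y i| <= b) -> lambda * N x <= N y + C1 * b.
  move=> l0 xb; apply: norm_perturb_sum => //.
  exact: le_trans (normr_ge0 _) (xb (Ordinal d0)).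
pose G n w := rgg_adj N (fun i => X i w) (r n) n.
have upper (q : nat) : {ae P, forall w, exists n0, forall n, (n0 <= n)%N ->
    (chromatic_number (G n w))%:R <= (1 + 10%:R / q.+1%:R) * frac_chromatic_number R (G n w)}.
  have q0 := ltn0Sn q.
  (* The sparse range fixes [D], and the dense range is then applied with the same [D]. *)
  have [D D0 sparse] := sparse_ae C10 C20 M0 d0 nsmall ncoord
    (fun x y => is_norm_tsubC x y Nnorm) dens r iid q0.
  have dense := dense_ae C10 C20 M0 npert nsmall ncoord dens iid r0 rto0
    (eps := q.+1%:R^-1) (D := D).
  have {}dense := dense _ D0; rewrite invr_gt0 ltr0n in dense; have {}dense := dense isT.
  move: sparse dense; apply: filterS2 => w [n1 H1] [n2 H2].
  exists (maxn (maxn n1 n2) 1) => n; rewrite !geq_max => /andP[/andP[n1n n2n] n0].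
  have [|K [Kc K0] Kmax] := @exists_max_clique _ (G n w); first by rewrite card_ord.
  have Kf := @clique_le_frac_chromatic_number R _ _ K Kc.
  have f0 : 0 <= frac_chromatic_number R (G n w) by exact: le_trans Kf.
  have [iD|/ltnW Di] := leqP (trunc_log 2 n) (D * #|K|).
    apply: (le_trans (H2 n n2n K Kc iD)); rewrite ler_wpM2r//.
    exact: dense_rounding_le.
  have /chromatic_number_le chi := H1 n n1n #|K| K0 Di Kmax.
  rewrite -(ler_nat R) in chi; apply: (le_trans chi).
  apply: (le_trans (sparse_rounding_le _ _ q0)).
  by rewrite ler_wpM2l// addr_ge0// divr_ge0.
have := ae_foralln upper; apply: filterS => w H.
apply/cvgrPdist_lt => eps eps0.
pose q := Num.truncn (10%:R / eps).
have [n0 Hn0] := H q; exists (maxn n0 1) => // n /=; rewrite geq_max => /andP[n0n n1].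
rewrite -/(G n w); have [|K [Kc K0] _] := @exists_max_clique _ (G n w); first by rewrite card_ord.
have f0 : 0 < frac_chromatic_number R (G n w).
  by apply: (@lt_le_trans _ _ #|K|%:R); rewrite ?ltr0n//; exact: clique_le_frac_chromatic_number.
have lo := @frac_chromatic_number_le R _ (G n w).
have hi := Hn0 n n0n.
have {}lo : 1 <= (chromatic_number (G n w))%:R / frac_chromatic_number R (G n w).
  by rewrite ler_pdivlMr// mul1r.
rewrite -ler_pdivrMr// in hi.
have qeps : 10%:R / q.+1%:R < eps.
  by rewrite ltr_pdivrMr ?ltr0n// mulrC -ltr_pdivrMr//; exact: truncnS_gt.
rewrite distrC ger0_norm ?subr_ge0// ltrBlDl (le_lt_trans hi)// ltrD2l.
exact: qeps.
Qed.
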